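(* Assume Continuity, Strong convexity, Stochastic noise, Unbiased compression and Point-wise bounded heterogeneity (all stated in the context). Let the iterates be generated by CM-SOBA-MSC with $\beta<\min\{\frac2{\mu_g+L_g},\frac{\mu_gn}{8\tilde\omega_\ell L_g^2}\}$, $\gamma\le\min\{\frac1{L_g},\frac{\mu_gn}{36\tilde\omega_\ell L_g^2}\}$, $\theta\le\min\{1,\frac n{12\tilde\omega_u}\}$, $\rho\ge C_f/\mu_g$ and $\alpha\le\min\{\frac1{2L_{\nabla\Phi}},C_2\}$, where $$C_2^{-2}=2\Big(\frac{2L_{\nabla\Phi}^2}{\theta^2}+\frac{26(L_2^2+25\kappa_g^2L_1^2)L_{y^\star}^2}{\beta^2\mu_g^2}+\frac{78L_g^2L_{z^\star}^2}{\gamma^2\mu_g^2}\Big).$$ Then \begin{align*} &\frac1K\sum_{k=0}^{K-1}\mathbb E\|\nabla\Phi(x^k)\|_2^2\le\frac{4\Delta_\Phi^0}{K\alpha}+\frac{2\Delta_x^0}{K\theta}+\frac{26(L_2^2+25\kappa_g^2L_1^2)\Delta_y^0}{\mu_gK\beta}+\frac{52L_g^2\Delta_z^0}{\mu_gK\gamma}+\frac{52(1+\tilde\omega_\ell)(L_2^2+25\kappa_g^2L_1^2)\beta}{\mu_gn}\tilde\sigma^2\\ &+\Big(\frac{2(1+\tilde\omega_u)\theta}{n}+\frac{78L_g^2(1+\tilde\omega_\ell)\gamma}{\mu_gn}\Big)\tilde\sigma_1^2+\Big(\frac{12\rho^2\tilde\omega_u\theta}{n}+\frac{104(L_2^2+25\kappa_g^2L_1^2)\tilde\omega_\ell\beta}{n\mu_g}+\frac{312L_g^2\rho^2\tilde\omega_\ell\gamma}{n\mu_g}\Big)b_g^2+\Big(\frac{12\tilde\omega_u\theta}{n}+\frac{312L_g^2\tilde\omega_\ell\gamma}{n\mu_g}\Big)b_f^2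 . \end{align*} If one further chooses $$R=\Big\lceil4(1+\omega_u+\omega_\ell)\ln\Big(4(1+\omega_u+\omega_\ell)+\tfrac{(1+\omega_u+\omega_\ell)^2(b_f^2+b_g^2)^2}{\sigma^4}\Big)\Big\rceil,\qquad\alpha=(2L_{\nabla\Phi}+C_2^{-1})^{-1},\qquad\rho=C_f/\mu_g,$$ $$\beta=\Big(\tfrac{\mu_g+L_g}2+\tfrac{8\tilde\omega_\ell L_g^2}{\mu_gn}+\sqrt{\tfrac{2K((1+\tilde\omega_\ell)\tilde\sigma^2+2\tilde\omega_\ell b_g^2)}{n\Delta_y^0}}\Big)^{-1},$$ $$\gamma=\Big(L_g+\tfrac{36\tilde\omega_\ell L_g^2}{\mu_gn}+\sqrt{\tfrac{3K((1+\tilde\omega_\ell)\tilde\sigma_1^2+4\tilde\omega_\ell b_f^2+4\tilde\omega_\ell(C_f^2/\mu_g^2)b_g^2)}{2n\Delta_z^0}}\Big)^{-1},$$ $$\theta=\Big(1+\tfrac{12\tilde\omega_u}n+\sqrt{\tfrac{K((1+\tilde\omega_u)\tilde\sigma_1^2+6\tilde\omega_ub_f^2+6\tilde\omega_u(C_f^2/\mu_g^2)b_g^2)}{n\Delta_x^0}}\Big)^{-1},$$ then CM-SOBA-MSC converges as order $$\frac1K\sum_{k=0}^{K-1}\mathbb E\|\nabla\Phi(x^k)\|_2^2=\mathcal O\Big(\frac{\sqrt\Delta\,\sigma}{\sqrt{nT}}+\frac{(1+\omega_u+\omega_\ell)\Delta\,\tilde\Theta(1)}{T}\Big),$$ where $T=KR$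 is the total number of iterations of CM-SOBA-MSC and $\tilde\Theta$ hides logarithmic terms independent of $T$.
   Context: Setting. $n\ge1$ workers; $f_i,g_i:\mathbb R^{d_x}\times\mathbb R^{d_y}\to\mathbb R$ with $f_i(x,y)=\mathbb E_{\phi\sim\mathcal D_{f_i}}[F(x,y;\phi)]$, $g_i(x,y)=\mathbb E_{\xi\sim\mathcal D_{g_i}}[G(x,y;\xi)]$; $f=\frac1n\sum_if_i$, $g=\frac1n\sum_ig_i$; $y^\star(x)=\arg\min_yg(x,y)$; $\Phi(x)=f(x,y^\star(x))$; $z^\star(x)=-[\nabla^2_{yy}g(x,y^\star(x))]^{-1}\nabla_yf(x,y^\star(x))$. $\nabla^2_{xy}g\in\mathbb R^{d_x\times d_y}$; $\|\cdot\|_2$ is the Euclidean norm of vectors and the spectral norm of matrices. $K\ge1$ is the number of outer iterations. Continuity: for all $i$, $f_i$ is $C_f$-Lipschitz in $y$, and $\nabla f_i,\nabla g_i,\nabla^2_{xy}g_i,\nabla^2_{yy}g_i$ are Lipschitz in $(x,y)$ with constants $L_f,L_g,L_{g_{xy}},L_{g_{yy}}$. Strong convexity: every $g_i$ is $\mu_g$-strongly convex in $y$. Stochastic noise: at every $(x,y)$, for every $i$, $\nabla F(x,y;\phi)$, $\nabla_yG(x,y;\xi)$, $\nabla^2_{xy}G(x,y;\xi)$, $\nabla^2_{yy}G(x,y;\xi)$ are unbiased estimates of $\nabla f_i,\nabla_yg_i,\nabla^2_{xy}g_i,\nabla^2_{yy}g_i$, each with mean squared error (in $\|\cdot\|_2$)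 at most $\sigma^2$. Unbiased compression: a random map $\mathcal C$ is $\omega$-unbiased ($\omega\ge0$) if $\mathbb E[\mathcal C(v)]=v$ and $\mathbb E\|\mathcal C(v)-v\|_2^2\le\omega\|v\|_2^2$ for all $v$. The upper-level compressors $\mathcal C_i^u$ are $\omega_u$-unbiased, the lower-level compressors $\mathcal C_i^\ell$ are $\omega_\ell$-unbiased; fresh randomness is used at each call, and outputs of different workers are mutually independent conditioned on the inputs. Point-wise bounded heterogeneity: for all $x$, at the point $(x,y^\star(x))$, for all $i$, $\|\nabla f_i-\nabla f\|_2^2\le b_f^2$, and $\|\nabla_yg_i-\nabla_yg\|_2^2$, $\|\nabla^2_{xy}g_i-\nabla^2_{xy}g\|_2^2$, $\|\nabla^2_{yy}g_i-\nabla^2_{yy}g\|_2^2\le b_g^2$. Multi-step compression. For an $\omega$-unbiased compressor $\mathcal C$ and $R\ge1$, $\mathrm{MSC}(v;\mathcal C,R)=v^R/(1-(\omega/(1+\omega))^R)$, where $v^0=0$ and $v^r=v^{r-1}+(1+\omega)^{-1}\mathcal C(v-v^{r-1})$ for $r=1,\dots,R$. CM-SOBA-MSC. Positive parameters $\alpha,\beta,\gamma,\theta,\rho$, integer $R\ge1$; initial $x^0,y^0,z^0,h_x^0$ with $\|z^0\|_2\le\rho$. At iteration $k$, worker $i$ draws fresh independent samples $\phi_i^{k,r}\sim\mathcal D_{f_i},\xi_i^{k,r}\sim\mathcal D_{g_i}$, $r=1,\dots,R$, and forms $D_{x,i}^k=\frac1R\sum_r[\nabla_{xy}^2G(x^k,y^k;\xi_i^{k,r})z^k+\nabla_xF(x^k,y^k;\phi_i^{k,r})]$,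 $D_{y,i}^k=\frac1R\sum_r\nabla_yG(x^k,y^k;\xi_i^{k,r})$, $D_{z,i}^k=\frac1R\sum_r[\nabla_{yy}^2G(x^k,y^k;\xi_i^{k,r})z^k+\nabla_yF(x^k,y^k;\phi_i^{k,r})]$. The server sets $\hat D_x^k=\frac1n\sum_i\mathrm{MSC}(D_{x,i}^k;\mathcal C_i^u,R)$, $\hat D_y^k=\frac1n\sum_i\mathrm{MSC}(D_{y,i}^k;\mathcal C_i^\ell,R)$, $\hat D_z^k=\frac1n\sum_i\mathrm{MSC}(D_{z,i}^k;\mathcal C_i^\ell,R)$, $x^{k+1}=x^k-\alpha h_x^k$, $y^{k+1}=y^k-\beta\hat D_y^k$, $\tilde z^{k+1}=z^k-\gamma\hat D_z^k$, $z^{k+1}=\min\{1,\rho/\|\tilde z^{k+1}\|_2\}\tilde z^{k+1}$, $h_x^{k+1}=(1-\theta)h_x^k+\theta\hat D_x^k$. Constants. $\kappa_g=L_g/\mu_g$, $L_1^2=L_f^2+L_{g_{yy}}^2\rho^2$, $L_2^2=L_f^2+L_{g_{xy}}^2\rho^2$, $\tilde\sigma^2=\sigma^2/R$, $\tilde\sigma_1^2=\sigma^2(1+\rho^2)/R$, $\tilde\omega_\ell=\omega_\ell(\omega_\ell/(1+\omega_\ell))^R$, $\tilde\omega_u=\omega_u(\omega_u/(1+\omega_u))^R$. $L_{\nabla\Phi},L_{y^\star},L_{z^\star}>0$ are Lipschitz constants of $\nabla\Phi,y^\star,z^\star$ (they exist under Continuity and Strong convexity). $\Delta_\Phi^0=\Phi(x^0)$,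 $\Delta_x^0=\|h_x^0-\nabla\Phi(x^0)\|_2^2$, $\Delta_y^0=\|y^0-y^\star(x^0)\|_2^2$, $\Delta_z^0=\|z^0-z^\star(x^0)\|_2^2$, $\Delta=\max\{\Delta_\Phi^0,\Delta_x^0,\Delta_y^0,\Delta_z^0\}$. Parameter upper bounds with a zero denominator are read as $+\infty$.
   Formalization: The factors ω̃_ℓ, ω̃_u are taken as ω(ω/(1+ω))^{R−1} instead of exponent R (the printed bound fails at R=1), and Φ≥0 is assumed, since a bound in terms of Φ(x^0) is not invariant under shifting f. In the second part σ and the gaps Δ_x^0, Δ_y^0, Δ_z^0 are positive. *)

(* Defs.v *)
From HB Require Import structures.
From mathcomp Require Import all_boot all_order all_algebra.
From mathcomp Require Import all_classical all_reals all_analysis.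

Set Implicit Arguments.
Unset Strict Implicit.
Unset Printing Implicit Defensive.

Import Order.TTheory GRing.Theory Num.Theory.
Import numFieldNormedType.Exports.

Local Open Scope classical_set_scope.
Local Open Scope ring_scope.

(** * Euclidean and spectral norms *)

(* The library norm on matrices is the sup norm (same topology). *)
Definition norm2 (R : realType) (d : nat) (v : 'cV[R]_d) : R :=
  Num.sqrt (\sum_(i < d) v i 0 ^+ 2).

Definition specnorm (R : realType) (m n : nat) (A : 'M[R]_(m, n)) : R :=
  sup [set norm2 (A *m v) | v in [set v : 'cV[R]_n | norm2 v <= 1]].

(** * Differential calculus *)

Definition grad (R : realType) (d : nat) (h : 'cV[R]_d -> R) (v : 'cV[R]_d)
    : 'cV[R]_d :=
  \col_(i < d) 'D_(delta_mx i 0) h v.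

Definition gradx (R : realType) (m n : nat) (h : 'cV[R]_m -> 'cV[R]_n -> R)
    (x : 'cV[R]_m) (y : 'cV[R]_n) : 'cV[R]_m :=
  grad (fun x' => h x' y) x.

Definition grady (R : realType) (m n : nat) (h : 'cV[R]_m -> 'cV[R]_n -> R)
    (x : 'cV[R]_m) (y : 'cV[R]_n) : 'cV[R]_n :=
  grad (h x) y.

Definition gradxy (R : realType) (m n : nat) (h : 'cV[R]_m -> 'cV[R]_n -> R)
    (x : 'cV[R]_m) (y : 'cV[R]_n) : 'cV[R]_(m + n) :=
  col_mx (gradx h x y) (grady h x y).

(* Entry (i, j) is d/dx_i (dh/dy_j): an m x n matrix. *)
Definition hessxy (R : realType) (m n : nat) (h : 'cV[R]_m -> 'cV[R]_n -> R)
    (x : 'cV[R]_m) (y : 'cV[R]_n) : 'M[R]_(m, n) :=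
  \matrix_(i < m, j < n)
    'D_(delta_mx i 0) (fun x' : 'cV[R]_m => grady h x' y j 0) x.

Definition hessyy (R : realType) (m n : nat) (h : 'cV[R]_m -> 'cV[R]_n -> R)
    (x : 'cV[R]_m) (y : 'cV[R]_n) : 'M[R]_n :=
  \matrix_(i < n, j < n)
    'D_(delta_mx i 0) (fun y' : 'cV[R]_n => grady h x y' j 0) y.

(* The gradient of h exists everywhere. *)
Definition smooth1 (R : realType) (m n : nat) (h : 'cV[R]_m -> 'cV[R]_n -> R)
    : Prop :=
  forall p : 'cV[R]_m * 'cV[R]_n, differentiable (fun q => h q.1 q.2) p.

(* Moreover hessxy h and hessyy h exist everywhere; the second derivatives in x
   alone are not required. *)
Definition smooth2 (R : realType) (m n : nat) (h : 'cV[R]_m -> 'cV[R]_n -> R)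
    : Prop :=
  smooth1 h /\
  forall p : 'cV[R]_m * 'cV[R]_n, differentiable (fun q => grady h q.1 q.2) p.

Definition lipschitz2 (R : realType) (m n : nat) (V : zmodType) (N : V -> R)
    (L : R) (h : 'cV[R]_m -> 'cV[R]_n -> V) : Prop :=
  forall x y x' y',
    N (h x y - h x' y') <= L * norm2 (col_mx (x - x') (y - y')).

Definition lipschitz1 (R : realType) (m d : nat) (L : R)
    (h : 'cV[R]_m -> 'cV[R]_d) : Prop :=
  forall x x', norm2 (h x - h x') <= L * norm2 (x - x').

Definition strongly_convex (R : realType) (d : nat) (mu : R)
    (h : 'cV[R]_d -> R) : Prop :=
  forall (u v : 'cV[R]_d) (t : R), 0 <= t <= 1 ->
    h (t *: u + (1 - t) *: v) <=
      t * h u + (1 - t) * h v - mu / 2 * (t * (1 - t)) * norm2 (u - v) ^+ 2.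

(** * Probability *)

(* T with its Borel sigma-algebra. *)
Definition borel (T : ptopologicalType) := g_sigma_algebraType (@open T).

Definition has_law (R : realType) (d d' : measure_display)
    (Om : measurableType d) (T : measurableType d') (P : probability Om R)
    (X : Om -> T) (mu : probability T R) : Prop :=
  measurable_fun setT X /\
  forall A : set T, measurable A -> P (X @^-1` A) = mu A.

Definition mean_mx (R : realType) (d : measure_display) (T : measurableType d)
    (P : probability T R) (m n : nat) (X : T -> 'M[R]_(m, n)) (A : 'M[R]_(m, n))
    : Prop :=
  forall i j, ('E_P[fun t => X t i j] = (A i j)%:E)%E.

Definition mean_sq (R : realType) (d : measure_display) (T : measurableType d)
    (P : probability T R) (X : T -> R) : \bar R :=
  'E_P[(fun t => X t ^+ 2)%R]%E.

(* Mutual independence of a family of classes of events: the product rule over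
   all finite subfamilies. *)
Definition mutually_independent (R : realType) (d : measure_display)
    (Om : measurableType d) (P : probability Om R) (I : Type)
    (E : I -> set (set Om)) : Prop :=
  forall (m : nat) (j : 'I_m -> I) (A : 'I_m -> set Om),
    injective j -> (forall l, E (j l) (A l)) ->
    P (\bigcap_(l in [set: 'I_m]) A l) = (\prod_(l < m) P (A l))%E.

(** * Compressors *)

(* A random map v |-> C(v) on R^d: one call is [rmap v s] with a seed s drawn
   from [seed_law]. *)
Record random_map (R : realType) (d : nat) := RandomMap {
  seed_disp : measure_display;
  seed : measurableType seed_disp;
  seed_law : probability seed R;
  rmap : 'cV[R]_d -> seed -> 'cV[R]_d }.

Definition unbiased_compressor (R : realType) (d : nat) (om : R)
    (C : random_map R d) : Prop :=
  [/\ 0 <= om,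
      forall j : 'I_d, measurable_fun setT
        (fun p : borel 'cV[R]_d * seed C => rmap (r := C) p.1 p.2 j 0),
      forall v, mean_mx (seed_law C) (rmap (r := C) v) v
    & forall v, (mean_sq (seed_law C) (fun s => norm2 (rmap (r := C) v s - v)%R)
                  <= (om * norm2 v ^+ 2)%:E)%E].

(* Multi-step compression; the r-th compression uses the seed s r. *)
Definition msc (R : realType) (d : nat) (om : R) (C : random_map R d)
    (rd : nat) (v : 'cV[R]_d) (s : 'I_rd -> seed C) : 'cV[R]_d :=
  (1 - (om / (1 + om)) ^+ rd)^-1 *:
    foldl (fun u r => u + (1 + om)^-1 *: rmap (v - u) (s r)) 0 (enum 'I_rd).

(** * The distributed bilevel problem *)

Record problem (R : realType) := Problem {
  nw : nat;
  dx : nat;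
  dy : nat;
  dispf : measure_display;
  Sf : measurableType dispf;
  Df : 'I_nw -> probability Sf R;
  Ff : 'cV[R]_dx -> 'cV[R]_dy -> Sf -> R;
  dispg : measure_display;
  Sg : measurableType dispg;
  Dg : 'I_nw -> probability Sg R;
  Gg : 'cV[R]_dx -> 'cV[R]_dy -> Sg -> R;
  Cu : 'I_nw -> random_map R dx;
  Cl : 'I_nw -> random_map R dy }.

Arguments Ff {R} p _ _ _.
Arguments Gg {R} p _ _ _.
Arguments Df {R} p _.
Arguments Dg {R} p _.
Arguments Cu {R} p _.
Arguments Cl {R} p _.

Definition floc (R : realType) (pb : problem R) (i : 'I_(nw pb))
    (x : 'cV[R]_(dx pb)) (y : 'cV[R]_(dy pb)) : R :=
  fine 'E_(Df pb i)[Ff pb x y]%E.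

Definition gloc (R : realType) (pb : problem R) (i : 'I_(nw pb))
    (x : 'cV[R]_(dx pb)) (y : 'cV[R]_(dy pb)) : R :=
  fine 'E_(Dg pb i)[Gg pb x y]%E.

Definition favg (R : realType) (pb : problem R)
    (x : 'cV[R]_(dx pb)) (y : 'cV[R]_(dy pb)) : R :=
  (nw pb)%:R^-1 * \sum_(i < nw pb) floc i x y.

Definition gavg (R : realType) (pb : problem R)
    (x : 'cV[R]_(dx pb)) (y : 'cV[R]_(dy pb)) : R :=
  (nw pb)%:R^-1 * \sum_(i < nw pb) gloc i x y.

Arguments floc {R} pb i x y.
Arguments gloc {R} pb i x y.
Arguments favg {R} pb x y.
Arguments gavg {R} pb x y.

(* argmin_y g(x, y); the minimizer is unique when g is strongly convex in y. *)
Definition ystar (R : realType) (pb : problem R) (x : 'cV[R]_(dx pb))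
    : 'cV[R]_(dy pb) :=
  xget 0 [set y | forall y', gavg pb x y <= gavg pb x y'].

Arguments ystar {R} pb x.

Definition Phi (R : realType) (pb : problem R) (x : 'cV[R]_(dx pb)) : R :=
  favg pb x (ystar pb x).

Definition zstar (R : realType) (pb : problem R) (x : 'cV[R]_(dx pb))
    : 'cV[R]_(dy pb) :=
  - (invmx (hessyy (gavg pb) x (ystar pb x))
       *m grady (favg pb) x (ystar pb x)).

Arguments Phi {R} pb x.
Arguments zstar {R} pb x.

(** * Assumptions *)

(* What is implicit in writing f_i = E[F], g_i = E[G] and the stochastic
   derivatives of F and G. *)
Definition well_posed (R : realType) (pb : problem R) : Prop :=
  [/\ [/\ (0 < nw pb)%N, (0 < dx pb)%N & (0 < dy pb)%N],
      [/\ measurable_fun setT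
            (fun p : borel 'cV[R]_(dx pb) * borel 'cV[R]_(dy pb) * Sf pb =>
               Ff pb p.1.1 p.1.2 p.2),
          forall i x y, (Df pb i).-integrable setT (EFin \o Ff pb x y)
        & forall s, smooth1 (fun x y => Ff pb x y s)]
    & [/\ measurable_fun setT
            (fun p : borel 'cV[R]_(dx pb) * borel 'cV[R]_(dy pb) * Sg pb =>
               Gg pb p.1.1 p.1.2 p.2),
          forall i x y, (Dg pb i).-integrable setT (EFin \o Gg pb x y)
        & forall s, smooth2 (fun x y => Gg pb x y s)]].

Definition continuity (R : realType) (Cf Lf Lg Lgxy Lgyy : R) (pb : problem R)
    : Prop :=
  forall i : 'I_(nw pb),
  [/\ forall x y y', `|floc pb i x y - floc pb i x y'| <= Cf * norm2 (y - y'),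
      smooth1 (floc pb i) /\ smooth2 (gloc pb i),
      lipschitz2 (@norm2 R _) Lf (gradxy (floc pb i)),
      lipschitz2 (@norm2 R _) Lg (gradxy (gloc pb i))
    & lipschitz2 (@specnorm R _ _) Lgxy (hessxy (gloc pb i)) /\
      lipschitz2 (@specnorm R _ _) Lgyy (hessyy (gloc pb i))].

Definition strong_convexity (R : realType) (mu : R) (pb : problem R) : Prop :=
  0 < mu /\ forall (i : 'I_(nw pb)) x, strongly_convex mu (gloc pb i x).

Definition stochastic_noise (R : realType) (sigma : R) (pb : problem R)
    : Prop :=
  forall (i : 'I_(nw pb)) x y,
  [/\ mean_mx (Df pb i) (fun s => gradxy (fun x y => Ff pb x y s) x y)
        (gradxy (floc pb i) x y) /\
      (mean_sq (Df pb i) (fun s => norm2 (gradxy (fun x y => Ff pb x y s) x y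
         - gradxy (floc pb i) x y)%R)
         <= (sigma ^+ 2)%:E)%E,
      mean_mx (Dg pb i) (fun s => grady (fun x y => Gg pb x y s) x y)
        (grady (gloc pb i) x y) /\
      (mean_sq (Dg pb i) (fun s => norm2 (grady (fun x y => Gg pb x y s) x y
         - grady (gloc pb i) x y)%R)
         <= (sigma ^+ 2)%:E)%E,
      mean_mx (Dg pb i) (fun s => hessxy (fun x y => Gg pb x y s) x y)
        (hessxy (gloc pb i) x y) /\
      (mean_sq (Dg pb i) (fun s => specnorm (hessxy (fun x y => Gg pb x y s) x y
         - hessxy (gloc pb i) x y)%R)
         <= (sigma ^+ 2)%:E)%E
    & mean_mx (Dg pb i) (fun s => hessyy (fun x y => Gg pb x y s) x y)
        (hessyy (gloc pb i) x y) /\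
      (mean_sq (Dg pb i) (fun s => specnorm (hessyy (fun x y => Gg pb x y s) x y
         - hessyy (gloc pb i) x y)%R)
         <= (sigma ^+ 2)%:E)%E].

Definition unbiased_compression (R : realType) (omu oml : R) (pb : problem R)
    : Prop :=
  forall i : 'I_(nw pb),
    unbiased_compressor omu (Cu pb i) /\ unbiased_compressor oml (Cl pb i).

Definition bounded_heterogeneity (R : realType) (bf bg : R) (pb : problem R)
    : Prop :=
  forall x (i : 'I_(nw pb)), let y := ystar pb x in
  [/\ norm2 (gradxy (floc pb i) x y - gradxy (favg pb) x y) ^+ 2 <= bf ^+ 2,
      norm2 (grady (gloc pb i) x y - grady (gavg pb) x y) ^+ 2 <= bg ^+ 2,
      specnorm (hessxy (gloc pb i) x y - hessxy (gavg pb) x y) ^+ 2 <= bg ^+ 2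
    & specnorm (hessyy (gloc pb i) x y - hessyy (gavg pb) x y) ^+ 2
        <= bg ^+ 2].

Definition lipschitz_constants (R : realType) (LPhi Ly Lz : R) (pb : problem R)
    : Prop :=
  [/\ 0 < LPhi, 0 < Ly & 0 < Lz] /\
  [/\ lipschitz1 LPhi (grad (Phi pb)), lipschitz1 Ly (ystar pb)
    & lipschitz1 Lz (zstar pb)].

(* Phi is normalised to be nonnegative: the initial gap is Phi(x^0) itself, and
   a bound in terms of Phi(x^0) is not invariant under adding a constant to f. *)
Definition nonnegative_Phi (R : realType) (pb : problem R) : Prop :=
  forall x, 0 <= Phi pb x.

Definition assumptions (R : realType)
    (mu Cf Lf Lg Lgxy Lgyy LPhi Ly Lz sigma omu oml bf bg : R)
    (pb : problem R) : Prop :=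
  [/\ well_posed pb,
      continuity Cf Lf Lg Lgxy Lgyy pb /\ strong_convexity mu pb,
      stochastic_noise sigma pb,
      unbiased_compression omu oml pb /\ bounded_heterogeneity bf bg pb
    & lipschitz_constants LPhi Ly Lz pb /\ nonnegative_Phi pb].

(** * CM-SOBA-MSC *)

(* All the randomness consumed by a run with rd samples and compression rounds
   per iteration; the lower-level compressors are called once for y and once
   for z, hence two seeds. *)
Record randomness (R : realType) (pb : problem R) (rd : nat) := Randomness {
  om_disp : measure_display;
  Om : measurableType om_disp;
  Pr : probability Om R;
  phi : nat -> 'I_(nw pb) -> 'I_rd -> Om -> Sf pb;
  xi : nat -> 'I_(nw pb) -> 'I_rd -> Om -> Sg pb;
  seedx : nat -> forall i : 'I_(nw pb), 'I_rd -> Om -> seed (Cu pb i);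
  seedy : nat -> forall i : 'I_(nw pb), 'I_rd -> Om -> seed (Cl pb i);
  seedz : nat -> forall i : 'I_(nw pb), 'I_rd -> Om -> seed (Cl pb i) }.

Arguments phi {R pb rd} r _ _ _ _.
Arguments xi {R pb rd} r _ _ _ _.
Arguments seedx {R pb rd} r _ _ _ _.
Arguments seedy {R pb rd} r _ _ _ _.
Arguments seedz {R pb rd} r _ _ _ _.

Variant draw (n rd : nat) :=
  | DrawPhi of nat & 'I_n & 'I_rd
  | DrawXi of nat & 'I_n & 'I_rd
  | DrawX of nat & 'I_n & 'I_rd
  | DrawY of nat & 'I_n & 'I_rd
  | DrawZ of nat & 'I_n & 'I_rd.

Definition draw_events (R : realType) (pb : problem R) (rd : nat)
    (rn : randomness pb rd) (c : draw (nw pb) rd) : set (set (Om rn)) :=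
  match c with
  | DrawPhi k i r => preimage_set_system setT (phi rn k i r) measurable
  | DrawXi k i r => preimage_set_system setT (xi rn k i r) measurable
  | DrawX k i r => preimage_set_system setT (seedx rn k i r) measurable
  | DrawY k i r => preimage_set_system setT (seedy rn k i r) measurable
  | DrawZ k i r => preimage_set_system setT (seedz rn k i r) measurable
  end.

Definition fresh (R : realType) (pb : problem R) (rd : nat)
    (rn : randomness pb rd) : Prop :=
  (forall k i r,
    [/\ has_law (Pr rn) (phi rn k i r) (Df pb i),
        has_law (Pr rn) (xi rn k i r) (Dg pb i),
        has_law (Pr rn) (seedx rn k i r) (seed_law (Cu pb i)),
        has_law (Pr rn) (seedy rn k i r) (seed_law (Cl pb i))
      & has_law (Pr rn) (seedz rn k i r) (seed_law (Cl pb i))]) /\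
  mutually_independent (Pr rn) (@draw_events R pb rd rn).

Record params (R : realType) := Params {
  alpha : R; beta : R; gamma : R; theta : R; rho : R }.

Definition positive_params (R : realType) (p : params R) : Prop :=
  [/\ 0 < alpha p, 0 < beta p, 0 < gamma p, 0 < theta p & 0 < rho p].

Record state (R : realType) (pb : problem R) := State {
  xs : 'cV[R]_(dx pb);
  ys : 'cV[R]_(dy pb);
  zs : 'cV[R]_(dy pb);
  hs : 'cV[R]_(dx pb) }.

Section Step.
Context (R : realType) (pb : problem R) (rd : nat) (omu oml : R).
Context (rn : randomness pb rd) (k : nat) (s : state pb) (w : Om rn).

Definition Dx (i : 'I_(nw pb)) : 'cV[R]_(dx pb) :=
  rd%:R^-1 *: \sum_(r < rd)
    (hessxy (fun x y => Gg pb x y (xi rn k i r w)) (xs s) (ys s) *m zs s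
     + gradx (fun x y => Ff pb x y (phi rn k i r w)) (xs s) (ys s)).

Definition Dy (i : 'I_(nw pb)) : 'cV[R]_(dy pb) :=
  rd%:R^-1 *: \sum_(r < rd)
    grady (fun x y => Gg pb x y (xi rn k i r w)) (xs s) (ys s).

Definition Dz (i : 'I_(nw pb)) : 'cV[R]_(dy pb) :=
  rd%:R^-1 *: \sum_(r < rd)
    (hessyy (fun x y => Gg pb x y (xi rn k i r w)) (xs s) (ys s) *m zs s
     + grady (fun x y => Ff pb x y (phi rn k i r w)) (xs s) (ys s)).

Definition hatDx : 'cV[R]_(dx pb) :=
  (nw pb)%:R^-1 *: \sum_(i < nw pb)
    msc omu (Dx i) (fun r => seedx rn k i r w).

Definition hatDy : 'cV[R]_(dy pb) :=
  (nw pb)%:R^-1 *: \sum_(i < nw pb)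
    msc oml (Dy i) (fun r => seedy rn k i r w).

Definition hatDz : 'cV[R]_(dy pb) :=
  (nw pb)%:R^-1 *: \sum_(i < nw pb)
    msc oml (Dz i) (fun r => seedz rn k i r w).

Definition step (p : params R) : state pb :=
  let z1 := zs s - gamma p *: hatDz in
  State (xs s - alpha p *: hs s)
        (ys s - beta p *: hatDy)
        (Num.min 1 (rho p / norm2 z1) *: z1)
        ((1 - theta p) *: hs s + theta p *: hatDx).

End Step.

Fixpoint iterate (R : realType) (pb : problem R) (rd : nat) (omu oml : R)
    (rn : randomness pb rd) (p : params R) (s0 : state pb) (k : nat)
    (w : Om rn) : state pb :=
  if k is k'.+1
  then step omu oml k' (iterate omu oml p s0 k' w) w p
  else s0.

(* (1/K) sum_(k < K) E || grad Phi (x^k) ||^2 *)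
Definition avg_sqgrad (R : realType) (pb : problem R) (rd : nat) (omu oml : R)
    (rn : randomness pb rd) (p : params R) (s0 : state pb) (K : nat) : \bar R :=
  ((K%:R^-1)%:E * \sum_(k < K)
     mean_sq (Pr rn) (fun w =>
       norm2 (grad (Phi pb) (xs (iterate omu oml p s0 k w)))))%E.

(** * Constants of the theorem *)

Definition gapx (R : realType) (pb : problem R) (s0 : state pb) : R :=
  norm2 (hs s0 - grad (Phi pb) (xs s0)) ^+ 2.
Definition gapy (R : realType) (pb : problem R) (s0 : state pb) : R :=
  norm2 (ys s0 - ystar pb (xs s0)) ^+ 2.
Definition gapz (R : realType) (pb : problem R) (s0 : state pb) : R :=
  norm2 (zs s0 - zstar pb (xs s0)) ^+ 2.
Definition gapmax (R : realType) (pb : problem R) (s0 : state pb) : R :=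
  Num.max (Phi pb (xs s0))
    (Num.max (gapx s0) (Num.max (gapy s0) (gapz s0))).

(* The variance factor of rd-step compression. Each round contracts the mean
   squared error by q = om / (1 + om), so the normalised output has relative
   variance q ^ rd / (1 - q ^ rd) <= om * q ^ (rd - 1), with equality for
   rd = 1, where msc is a single call of the compressor. The exponent is
   therefore rd - 1: with om * q ^ rd the case rd = 1 fails. *)
Definition om_msc (R : realType) (om : R) (rd : nat) : R :=
  om * (om / (1 + om)) ^+ rd.-1.

(* L_2^2 + 25 kappa_g^2 L_1^2 *)
Definition Lcomb (R : realType) (mu Lf Lg Lgxy Lgyy rho : R) : R :=
  (Lf ^+ 2 + Lgxy ^+ 2 * rho ^+ 2)
  + 25 * (Lg / mu) ^+ 2 * (Lf ^+ 2 + Lgyy ^+ 2 * rho ^+ 2).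

Definition C2 (R : realType) (mu Lf Lg Lgxy Lgyy LPhi Ly Lz : R)
    (p : params R) : R :=
  (Num.sqrt (2 * (2 * LPhi ^+ 2 / theta p ^+ 2
     + 26 * Lcomb mu Lf Lg Lgxy Lgyy (rho p) * Ly ^+ 2
         / (beta p ^+ 2 * mu ^+ 2)
     + 78 * Lg ^+ 2 * Lz ^+ 2 / (gamma p ^+ 2 * mu ^+ 2))))^-1.

(* Comparison with a/b, read as +oo when b = 0. *)
Definition le_quot (R : realType) (t a b : R) : Prop := b = 0 \/ t <= a / b.
Definition lt_quot (R : realType) (t a b : R) : Prop := b = 0 \/ t < a / b.

(* Main.v *)
Require Import Defs.
From HB Require Import structures.
From mathcomp Require Import all_boot all_order all_algebra.
From mathcomp Require Import all_classical all_reals all_analysis.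
From mathcomp Require Import measurable_realfun ring lra.

(** The expectation of the Lyapunov function
    [2/alpha Phi(x) + |h - grad Phi(x)|^2/theta + 13 A/(beta mu) |y - y*(x)|^2
     + 26 Lg^2/(gamma mu) |z - z*(x)|^2]
    drops at each iteration by at least half of [E |grad Phi(x)|^2], up to a
    constant noise term; telescoping gives the first bound, and in the second
    one the prescribed number of rounds makes [om_msc] so small that
    compression only contributes terms of the size of the sampling noise.

    Conditional expectations are avoided: a random vector [X] is "noisy"
    around [m] with variance [B] when [E |a + c X|^2 <= E |a + c m|^2 + c^2 B]
    for every [a] that depends only on draws outside a given set. This property
    holds for a single unbiased draw, by independence and Tonelli, and it is
    stable under sums over independent workers and under a further layer of
    (multi-step) compression. No symmetry of the Hessian is needed: if [G] is an
    [L]-Lipschitz gradient of a [mu]-strongly convex function, then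
    [G - (mu + L)/2 id] is [(L - mu)/2]-Lipschitz, and this controls both the
    gradient step in [y] and the linear step in [z]. *)

Set Implicit Arguments.
Unset Strict Implicit.
Unset Printing Implicit Defensive.

Import Order.TTheory GRing.Theory Num.Theory.
Import numFieldNormedType.Exports.

Local Open Scope classical_set_scope.
Local Open Scope ring_scope.

(** * Euclidean and spectral norms *)

Section Euclidean.
Context {R : realType}.

(** Polarization rewrites -2 <h, grad Phi> as |h - grad Phi|^2 - |h|^2 - |grad Phi|^2. Once alpha <=
    1/(2 LPhi), each iteration keeps a surplus of |h|^2 / 2, which must pay for the motion of grad
    Phi, y* and z*, all of size alpha |h|; [C2] is the bound on alpha under which it does. Apart
    from this motion of x, the errors are coupled one way only: y disturbs z and h, z disturbs h.
    Hence the weight of z is chosen against h, then that of y against both, and 25 kappa^2 L1 in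
    [Lcomb] pays for the effect of y on z.

    The three directions of an iteration share their samples and are correlated. Each of the gaps of
    h, y and z is updated by a single direction, shifted by a quantity known from the past, so only
    the noise of that direction matters and the correlations never enter.

    Finiteness of the second moments along the run is not given: it is propagated by induction
    together with the Lyapunov inequality. *)

Definition dot d (u v : 'cV[R]_d) : R := \sum_(i < d) u i 0 * v i 0.

Lemma dotC d (u v : 'cV[R]_d) : dot u v = dot v u.
Proof. by apply: eq_bigr => i _; rewrite mulrC. Qed.

Lemma dotDl d (u v w : 'cV[R]_d) : dot (u + v) w = dot u w + dot v w.
Proof.
by rewrite /dot -big_split; apply: eq_bigr => i _; rewrite mxE mulrDl.
Qed.

Lemma dotZl d a (u w : 'cV[R]_d) : dot (a *: u) w = a * dot u w.
Proof.
by rewrite /dot big_distrr; apply: eq_bigr => i _; rewrite mxE /= mulrA.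
Qed.

Lemma dotNl d (u w : 'cV[R]_d) : dot (- u) w = - dot u w.
Proof. by rewrite -scaleN1r dotZl mulN1r. Qed.

Lemma dotBl d (u v w : 'cV[R]_d) : dot (u - v) w = dot u w - dot v w.
Proof. by rewrite dotDl dotNl. Qed.

Lemma dotDr d (u v w : 'cV[R]_d) : dot u (v + w) = dot u v + dot u w.
Proof. by rewrite ![dot u _]dotC dotDl. Qed.

Lemma dotZr d a (u w : 'cV[R]_d) : dot u (a *: w) = a * dot u w.
Proof. by rewrite ![dot u _]dotC dotZl. Qed.

Lemma dotNr d (u w : 'cV[R]_d) : dot u (- w) = - dot u w.
Proof. by rewrite ![dot u _]dotC dotNl. Qed.

Lemma dotBr d (u v w : 'cV[R]_d) : dot u (v - w) = dot u v - dot u w.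
Proof. by rewrite dotDr dotNr. Qed.

Lemma dot0r d (u : 'cV[R]_d) : dot u 0 = 0.
Proof. by rewrite -(scale0r (0 : 'cV[R]_d)) dotZr mul0r. Qed.

Lemma dot0l d (u : 'cV[R]_d) : dot 0 u = 0.
Proof. by rewrite dotC dot0r. Qed.

Lemma dot_delta d (u : 'cV[R]_d) i : dot u (delta_mx i 0) = u i 0.
Proof.
rewrite /dot (bigD1 i) //= mxE !eqxx mulr1 big1 ?addr0 // => j ji.
by rewrite mxE (negPf ji) mulr0.
Qed.

Lemma dot_mulmx m n (A : 'M[R]_(m, n)) u v :
  dot (A *m u) v = dot u (A^T *m v).
Proof.
rewrite /dot.
under eq_bigr do rewrite mxE big_distrl.
rewrite exchange_big; apply: eq_bigr => j _.
rewrite mxE big_distrr; apply: eq_bigr => i _ /=.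
by rewrite mxE; ring.
Qed.

Lemma dotE d (u : 'cV[R]_d) : dot u u = \sum_(i < d) u i 0 ^+ 2.
Proof. by apply: eq_bigr => i _; rewrite expr2. Qed.

Lemma norm2_sqr d (u : 'cV[R]_d) : norm2 u ^+ 2 = dot u u.
Proof. by rewrite dotE sqr_sqrtr // sumr_ge0 // => i _; rewrite sqr_ge0. Qed.

Lemma norm2_ge0 d (u : 'cV[R]_d) : 0 <= norm2 u.
Proof. exact: sqrtr_ge0. Qed.
Hint Resolve norm2_ge0 : core.

Lemma dot_ge0 d (u : 'cV[R]_d) : 0 <= dot u u.
Proof. by rewrite -norm2_sqr sqr_ge0. Qed.

Lemma norm2_dot d (u : 'cV[R]_d) : norm2 u = Num.sqrt (dot u u).
Proof. by rewrite -norm2_sqr sqrtr_sqr ger0_norm. Qed.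

Lemma norm2_0 d : norm2 (0 : 'cV[R]_d) = 0.
Proof. by rewrite norm2_dot dot0r sqrtr0. Qed.

Lemma dot_eq0 d (u : 'cV[R]_d) : dot u u = 0 -> u = 0.
Proof.
rewrite dotE => /eqP; rewrite psumr_eq0; last by move=> i _; rewrite sqr_ge0.
move=> /allP h; apply/matrixP => i j; rewrite ord1 mxE.
by have := h i (mem_index_enum i); rewrite sqrf_eq0 => /eqP.
Qed.

Lemma norm2_eq0 d (u : 'cV[R]_d) : norm2 u = 0 -> u = 0.
Proof. by move=> h; apply: dot_eq0; rewrite -norm2_sqr h expr0n. Qed.

Lemma dot_sqr_le d (u v : 'cV[R]_d) :
  dot u v ^+ 2 <= dot u u * dot v v.
Proof.
have [v0|v0] := eqVneq (dot v v) 0.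
  by rewrite (dot_eq0 v0) !dot0r expr0n mulr0.
have vp : 0 < dot v v by rewrite lt_def v0 dot_ge0.
have := dot_ge0 (dot v v *: u - dot u v *: v).
rewrite !(dotBl, dotBr, dotZl, dotZr) (dotC v u) => h.
rewrite -subr_ge0 -(pmulr_rge0 _ vp); apply: le_trans h _.
by rewrite le_eqVlt; apply/orP; left; apply/eqP; ring.
Qed.

Lemma normr_dot_le d (u v : 'cV[R]_d) : `|dot u v| <= norm2 u * norm2 v.
Proof.
rewrite -(ler_pXn2r (n := 2)) ?nnegrE ?mulr_ge0 //.
by rewrite real_normK ?num_real // exprMn !norm2_sqr dot_sqr_le.
Qed.

Lemma dot_le d (u v : 'cV[R]_d) : dot u v <= norm2 u * norm2 v.
Proof. exact: le_trans (ler_norm _) (normr_dot_le _ _). Qed.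

Lemma norm2D_sqr d (u v : 'cV[R]_d) :
  norm2 (u + v) ^+ 2 = norm2 u ^+ 2 + 2 * dot u v + norm2 v ^+ 2.
Proof. by rewrite !norm2_sqr !(dotDl, dotDr) (dotC v u); ring. Qed.

Lemma norm2Z d a (u : 'cV[R]_d) : norm2 (a *: u) = `|a| * norm2 u.
Proof.
by rewrite !norm2_dot dotZl dotZr mulrA -expr2 sqrtrM ?sqr_ge0 // sqrtr_sqr.
Qed.

Lemma norm2Z_sqr d a (u : 'cV[R]_d) :
  norm2 (a *: u) ^+ 2 = a ^+ 2 * norm2 u ^+ 2.
Proof. by rewrite !norm2_sqr dotZl dotZr mulrA expr2. Qed.

Lemma norm2N d (u : 'cV[R]_d) : norm2 (- u) = norm2 u.
Proof. by rewrite -scaleN1r norm2Z normrN1 mul1r. Qed.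

Lemma norm2C d (u v : 'cV[R]_d) : norm2 (u - v) = norm2 (v - u).
Proof. by rewrite -opprB norm2N. Qed.

Lemma norm2D d (u v : 'cV[R]_d) : norm2 (u + v) <= norm2 u + norm2 v.
Proof.
rewrite -(ler_pXn2r (n := 2)) ?nnegrE ?addr_ge0 // norm2D_sqr sqrrD.
by have := dot_le u v; lra.
Qed.

Lemma norm2B d (u v : 'cV[R]_d) : norm2 (u - v) <= norm2 u + norm2 v.
Proof. by rewrite -(norm2N v) norm2D. Qed.

Lemma norm2_sum d I (r : seq I) (F : I -> 'cV[R]_d) :
  norm2 (\sum_(i <- r) F i) <= \sum_(i <- r) norm2 (F i).
Proof.
elim/big_rec2: _ => [|i y x _ h]; first by rewrite norm2_0.
by apply: le_trans (norm2D _ _) _; rewrite lerD2l.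
Qed.

Lemma norm2_col_mx m n (u : 'cV[R]_m) (v : 'cV[R]_n) :
  norm2 (col_mx u v) ^+ 2 = norm2 u ^+ 2 + norm2 v ^+ 2.
Proof.
rewrite !norm2_sqr !dotE big_split_ord /=.
by congr (_ + _); apply: eq_bigr => i _; rewrite (col_mxEu, col_mxEd).
Qed.

Lemma norm2_col_mx0r m n (u : 'cV[R]_m) : norm2 (col_mx u (0 : 'cV_n)) = norm2 u.
Proof.
by rewrite [LHS]norm2_dot -norm2_sqr norm2_col_mx norm2_0 expr0n addr0 sqrtr_sqr
   ger0_norm.
Qed.

Lemma norm2_col_mx0l m n (u : 'cV[R]_m) : norm2 (col_mx (0 : 'cV_n) u) = norm2 u.
Proof.
by rewrite [LHS]norm2_dot -norm2_sqr norm2_col_mx norm2_0 expr0n add0r sqrtr_sqr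
   ger0_norm.
Qed.

Lemma norm2_col_mxu m n (u : 'cV[R]_m) (v : 'cV[R]_n) :
  norm2 u <= norm2 (col_mx u v).
Proof.
by rewrite -(ler_pXn2r (n := 2)) ?nnegrE // norm2_col_mx lerDl sqr_ge0.
Qed.

Lemma norm2_col_mxd m n (u : 'cV[R]_m) (v : 'cV[R]_n) :
  norm2 v <= norm2 (col_mx u v).
Proof.
by rewrite -(ler_pXn2r (n := 2)) ?nnegrE // norm2_col_mx lerDr sqr_ge0.
Qed.

Lemma coord_le_norm2 d (u : 'cV[R]_d) i : `|u i 0| <= norm2 u.
Proof.
rewrite -(ler_pXn2r (n := 2)) ?nnegrE // real_normK ?num_real //.
rewrite norm2_sqr dotE (bigD1 i) //= lerDl sumr_ge0 // => j _.
exact: sqr_ge0.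
Qed.

Lemma mx_norm_le_norm2 d (u : 'cV[R]_d) : `|u| <= norm2 u.
Proof.
rewrite -[`|u|]/(mx_norm u).
have [->|/mx_norm_neq0[[i j] ->]] := eqVneq (mx_norm u) 0; first exact: norm2_ge0.
by rewrite ord1 coord_le_norm2.
Qed.

Lemma coord_le_mx_norm m n (A : 'M[R]_(m, n)) i j : `|A i j| <= `|A|.
Proof.
by rewrite -[`|A|]/(mx_norm A) mx_normrE (le_bigmax _ (fun k => `|A k.1 k.2|) (i, j)).
Qed.

(** Only the equivalence of the two norms matters, for topology, measurability and boundedness, so
    the crude factor [d] is enough. *)
Lemma norm2_le_mx_norm d (u : 'cV[R]_d) : norm2 u <= d%:R * `|u|.
Proof.
have -> : u = \sum_(i < d) u i 0 *: delta_mx i 0.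
  by rewrite [LHS]matrix_sum_delta; apply: eq_bigr => i _; rewrite big_ord1.
apply: le_trans (norm2_sum _ _) _.
set s := \sum_(k < d) (_ *: _).
have -> : s = u.
  by rewrite /s [RHS]matrix_sum_delta; apply: eq_bigr => k _; rewrite big_ord1.
have -> : d%:R * `|u| = \sum_(i < d) `|u|.
  by rewrite sumr_const card_ord mulr_natl.
apply: ler_sum => i _; rewrite norm2Z.
suff -> : norm2 (delta_mx i 0 : 'cV[R]_d) = 1 by rewrite mulr1 coord_le_mx_norm.
by rewrite norm2_dot dot_delta mxE !eqxx sqrtr1.
Qed.

(** Shows that the set defining [specnorm] is bounded above, without which its [sup] would be a
    default value. *)
Lemma norm2_mulmx_bound m n (A : 'M[R]_(m, n)) (v : 'cV[R]_n) :
  norm2 (A *m v) <= (m%:R * n%:R * `|A|) * norm2 v.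
Proof.
apply: le_trans (norm2_le_mx_norm _) _.
rewrite -!mulrA ler_wpM2l //.
rewrite -[`|A *m v|]/(mx_norm _).
have [->|/mx_norm_neq0[[i j] ->]] := eqVneq (mx_norm (A *m v)) 0.
  by rewrite !mulr_ge0.
rewrite mxE /=; apply: le_trans (ler_norm_sum _ _ _) _.
have -> : n%:R * (`|A| * norm2 v) = \sum_(i < n) (`|A| * norm2 v).
  by rewrite sumr_const card_ord mulr_natl.
apply: ler_sum => k _.
by rewrite normrM ler_pM // ?coord_le_mx_norm // ord1 coord_le_norm2.
Qed.

Lemma specnormP m n (A : 'M[R]_(m, n)) (v : 'cV[R]_n) :
  norm2 (A *m v) <= specnorm A * norm2 v.
Proof.
have [v0|v0] := eqVneq (norm2 v) 0.
  by rewrite (norm2_eq0 v0) mulmx0 !norm2_0 mulr0.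
have vp : 0 < norm2 v by rewrite lt_def v0 norm2_ge0.
rewrite -ler_pdivrMr //.
have -> : norm2 (A *m v) / norm2 v = norm2 (A *m ((norm2 v)^-1 *: v)).
  by rewrite -scalemxAr norm2Z ger0_norm ?invr_ge0 // mulrC.
apply: ub_le_sup; last first.
  exists ((norm2 v)^-1 *: v) => //=.
  by rewrite norm2Z ger0_norm ?invr_ge0 // mulVf.
exists (m%:R * n%:R * `|A|) => _ [u /= u1 <-].
apply: le_trans (norm2_mulmx_bound _ _) _.
by rewrite -[leRHS]mulr1 ler_wpM2l // !mulr_ge0.
Qed.

Lemma specnorm_sqrP m n (A : 'M[R]_(m, n)) (v : 'cV[R]_n) b :
  specnorm A ^+ 2 <= b ^+ 2 -> norm2 (A *m v) ^+ 2 <= b ^+ 2 * norm2 v ^+ 2.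
Proof.
move=> h; apply: le_trans (_ : (specnorm A * norm2 v) ^+ 2 <= _).
  rewrite ler_pXn2r ?nnegrE ?specnormP //.
  exact: le_trans (specnormP _ _).
by rewrite exprMn ler_wpM2r ?sqr_ge0.
Qed.

(** Test the form at [u = A^T v] and cancel one factor |A^T v|. *)
Lemma norm2_bilinear_le m n (A : 'M[R]_(m, n)) M : 0 <= M ->
  (forall u v, dot (A *m u) v <= M * norm2 u * norm2 v) ->
  forall v, norm2 (A^T *m v) <= M * norm2 v.
Proof.
move=> M0 h v; have := h (A^T *m v) v.
rewrite dot_mulmx -norm2_sqr expr2.
have [->|e0] := eqVneq (norm2 (A^T *m v)) 0; first by rewrite mulr_ge0.
have ep : 0 < norm2 (A^T *m v) by rewrite lt_def e0 norm2_ge0.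
by rewrite mulrAC ler_pM2r.
Qed.

Lemma norm2D_sqr_le d (u v : 'cV[R]_d) :
  norm2 (u + v) ^+ 2 <= 2 * (norm2 u ^+ 2 + norm2 v ^+ 2).
Proof.
rewrite norm2D_sqr; have := sqr_ge0 (norm2 (u - v)); rewrite norm2D_sqr norm2N dotNr.
lra.
Qed.

Lemma norm2D3_sqr_le d (u v w : 'cV[R]_d) :
  norm2 (u + v + w) ^+ 2 <= 3 * (norm2 u ^+ 2 + norm2 v ^+ 2 + norm2 w ^+ 2).
Proof.
rewrite !norm2D_sqr dotDl.
have := sqr_ge0 (norm2 (u - v)); have := sqr_ge0 (norm2 (u - w)).
have := sqr_ge0 (norm2 (v - w)).
rewrite !norm2D_sqr !norm2N !dotNr; lra.
Qed.

(* Convexity of the square, with weights [1 - s] and [s]. *)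
Lemma norm2_convex_le d (u v : 'cV[R]_d) (a s : R) : 0 < s <= 1 ->
  norm2 u <= (1 - s) * a ->
  norm2 (u + v) ^+ 2 <= (1 - s) * a ^+ 2 + s^-1 * norm2 v ^+ 2.
Proof.
move=> /andP[s0 s1] h.
have a0 : 0 <= (1 - s) * a by apply: le_trans h.
have hv := norm2_ge0 v; have hu := norm2_ge0 u; have huv := norm2_ge0 (u + v).
have h1 : norm2 (u + v) <= (1 - s) * a + s * (norm2 v / s).
  by rewrite [s * _]mulrC divfK ?gt_eqF // (le_trans (norm2D _ _)) ?lerD2r.
have q0 : 0 <= norm2 v / s by rewrite divr_ge0 // ltW.
have -> : s^-1 * norm2 v ^+ 2 = s * (norm2 v / s) ^+ 2.
  by field; rewrite gt_eqF.
move: (norm2 v / s) q0 h1 => q q0 h1.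
have h2 : norm2 (u + v) ^+ 2 <= ((1 - s) * a + s * q) ^+ 2.
  by rewrite ler_pXn2r ?nnegrE // (le_trans huv).
apply: (le_trans h2); rewrite -subr_ge0.
suff -> : (1 - s) * a ^+ 2 + s * q ^+ 2 - ((1 - s) * a + s * q) ^+ 2 =
   s * (1 - s) * (a - q) ^+ 2 by rewrite mulr_ge0 ?sqr_ge0 ?mulr_ge0 ?subr_ge0 // ltW.
by ring.
Qed.

End Euclidean.
#[export] Hint Extern 0 (is_true (@Order.le _ _ _ (norm2 _))) => solve [apply: norm2_ge0] : core.

(** * Gradients and strong convexity *)

Section Gradients.
Context {R : realType}.

Lemma is_derive_eps (V : normedModType R) (f : V -> R) (x v : V) (l : R) :
  (forall e, 0 < e -> exists2 del, 0 < del & forall h : R, `|h| < del ->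
    `|f (h *: v + x) - f x - h * l| <= e * `|h|) ->
  is_derive x v f l.
Proof.
move=> H.
have c : h^-1 *: ((f \o shift x) (h *: v) - f x) @[h --> 0^'] --> l.
  apply/cvgrPdist_le => e e0; have [del d0 hd] := H _ e0.
  exists del => //= h /=; rewrite sub0r normrN => hdel h0.
  rewrite distrC /= -[l](mulKf h0) -[h^-1 *: _]/(h^-1 * _) -mulrBr normrM.
  by rewrite normfV ler_pdivrMl ?normr_gt0 // [`|h| * e]mulrC hd.
split; last exact/cvg_lim.
by apply/cvg_ex; exists l.
Qed.

(** Frechet differentiability with gradient [g], phrased with the Euclidean norm so that remainders
    combine directly with Cauchy-Schwarz. *)
Definition hasgrad d (f : 'cV[R]_d -> R) (y g : 'cV[R]_d) : Prop :=
  forall e, 0 < e -> exists2 del, 0 < del & forall v, norm2 v < del ->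
    `|f (y + v) - f y - dot g v| <= e * norm2 v.

Lemma hasgrad_is_derive d (f : 'cV[R]_d -> R) y g v :
  hasgrad f y g -> is_derive y v f (dot g v).
Proof.
move=> H; apply: is_derive_eps => e e0.
have v1 : 0 < norm2 v + 1 by rewrite ltr_wpDl.
have [del d0 hd] := H (e / (norm2 v + 1)) (divr_gt0 e0 v1).
exists (del / (norm2 v + 1)); first exact: divr_gt0.
move=> h hh; rewrite [_ + y]addrC; have := hd (h *: v); rewrite dotZr norm2Z => Hh.
apply: le_trans (Hh _) _.
  move: hh; rewrite ltr_pdivlMr // => hh; apply: le_lt_trans hh.
  by rewrite ler_wpM2l // lerDl.
rewrite [`|h| * _]mulrC mulrA ler_wpM2r // -mulrA ger_pMr //.
by rewrite mulrC ler_pdivrMr // mul1r lerDl.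
Qed.

Lemma hasgrad_grad d (f : 'cV[R]_d -> R) y g : hasgrad f y g -> grad f y = g.
Proof.
move=> H; apply/matrixP => i j; rewrite ord1 mxE.
by have [_ ->] := hasgrad_is_derive (delta_mx i 0) H; rewrite dot_delta.
Qed.

Lemma hasgrad_scale d (f : 'cV[R]_d -> R) c y g :
  hasgrad f y g -> hasgrad (fun v => c * f v) y (c *: g).
Proof.
move=> H e e0; have c1 : 0 < `|c| + 1 by rewrite ltr_wpDl.
have [del d0 hd] := H _ (divr_gt0 e0 c1); exists del => // v vd.
rewrite dotZl -!mulrBr normrM.
apply: le_trans (ler_wpM2l (normr_ge0 c) (hd v vd)) _.
rewrite mulrA ler_wpM2r // mulrCA ger_pMr // ler_pdivrMr // mul1r lerDl //.
Qed.

Lemma hasgradD d (f f' : 'cV[R]_d -> R) y g g' :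
  hasgrad f y g -> hasgrad f' y g' -> hasgrad (fun v => f v + f' v) y (g + g').
Proof.
move=> H H' e e0; have e2 : 0 < e / 2 by rewrite divr_gt0.
have [del d0 hd] := H _ e2; have [del' d0' hd'] := H' _ e2.
exists (Num.min del del'); first by rewrite lt_min d0.
move=> v; rewrite lt_min => /andP[v1 v2]; rewrite dotDl.
have -> : f (y + v) + f' (y + v) - (f y + f' y) - (dot g v + dot g' v) =
  (f (y + v) - f y - dot g v) + (f' (y + v) - f' y - dot g' v) by ring.
apply: le_trans (ler_normD _ _) _; rewrite {1}(splitr e) mulrDl lerD //.
- exact: hd.
- exact: hd'.
Qed.

Lemma hasgrad_sum d (I : Type) (s : seq I) (f : I -> 'cV[R]_d -> R) y g :
  (forall i, hasgrad (f i) y (g i)) ->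
  hasgrad (fun v => \sum_(i <- s) f i v) y (\sum_(i <- s) g i).
Proof.
move=> H; elim: s => [|i s IH].
  rewrite big_nil => e e0; exists 1 => // v _.
  by rewrite !big_nil dot0l !subr0 normr0 mulr_ge0 // ltW.
rewrite big_cons => e e0; have [del d0 hd] := hasgradD (H i) IH e0.
by exists del => // v /hd; rewrite !big_cons.
Qed.

(** Divide by [t] and let it tend to 0. This converts bounds on increments, from strong convexity or
    Lipschitz continuity, into bounds on gradients and Hessians. *)
Lemma hasgrad_dot_le d (f : 'cV[R]_d -> R) y g v K M : hasgrad f y g ->
  (forall t, 0 < t <= 1 -> f (y + t *: v) - f y <= t * K + t ^+ 2 * M) ->
  dot g v <= K.
Proof.
move=> H h; apply/ler_addgt0Pr => e e0.
have v1 : 0 < norm2 v + 1 by rewrite ltr_wpDl.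
have [del d0 hd] := H _ (divr_gt0 (divr_gt0 e0 (ltr0Sn _ 1)) v1).
have M1 : 0 < `|M| + 1 by rewrite ltr_wpDl.
(* Small enough for the expansion to apply at [t *: v] and for the quadratic term to cost at most
   [t * (e / 2)]; the remainder of the expansion takes the other half of [e]. *)
pose t := Num.min 1 (Num.min (del / 2 / (norm2 v + 1)) (e / 2 / (`|M| + 1))).
have t0 : 0 < t by rewrite !lt_min ltr01 !divr_gt0.
have t1 : t <= 1 by rewrite ge_min lexx.
have td : t * norm2 v < del.
  apply: le_lt_trans (_ : del / 2 < del); last by lra.
  have : t <= del / 2 / (norm2 v + 1) by rewrite !ge_min lexx orbT.
  rewrite ler_pdivlMr // => th; apply: le_trans th.
  by rewrite ler_wpM2l ?(ltW t0) // lerDl.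
have tM : t * M <= e / 2.
  have : t <= e / 2 / (`|M| + 1) by rewrite !ge_min lexx !orbT.
  rewrite ler_pdivlMr // => th; apply: le_trans th.
  by rewrite ler_wpM2l ?(ltW t0) // (le_trans (ler_norm _)) // lerDl.
have h1 := hd (t *: v); rewrite norm2Z ger0_norm ?(ltW t0) // dotZr in h1.
have {h1} := h1 td; rewrite ler_norml => /andP[h1 _].
have h2 : f (y + t *: v) - f y <= t * K + t ^+ 2 * M by apply: h; rewrite t0.
have h3 : e / 2 / (norm2 v + 1) * (t * norm2 v) <= t * (e / 2).
  rewrite mulrCA ler_wpM2l ?(ltW t0) // mulrAC ler_pdivrMr //.
  by rewrite ler_wpM2l ?divr_ge0 ?(ltW e0) // lerDl.
rewrite -(ler_pM2l t0) mulrDr.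
have h4 : t ^+ 2 * M <= t * (e / 2) by rewrite expr2 -mulrA ler_wpM2l // ltW.
lra.
Qed.

Lemma hasgrad_line d (f : 'cV[R]_d -> R) (G : 'cV[R]_d -> 'cV[R]_d) u v :
  (forall y, hasgrad f y (G y)) ->
  forall t : R, is_derive t (1 : R) (fun t => f (u + t *: v)) (dot (G (u + t *: v)) v).
Proof.
move=> H t; apply: is_derive_eps => e e0.
have v1 : 0 < norm2 v + 1 by rewrite ltr_wpDl.
have [del d0 hd] := H (u + t *: v) (e / (norm2 v + 1)) (divr_gt0 e0 v1).
exists (del / (norm2 v + 1)); first exact: divr_gt0.
move=> h hh; have := hd (h *: v); rewrite dotZr norm2Z => Hh.
have -> : h *: (1 : R) + t = t + h by rewrite [h *: _]mulr1 addrC.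
rewrite scalerDl addrA; apply: le_trans (Hh _) _.
  move: hh; rewrite ltr_pdivlMr // => hh; apply: le_lt_trans hh.
  by rewrite ler_wpM2l // lerDl.
rewrite [`|h| * _]mulrC mulrA ler_wpM2r // -mulrA ger_pMr //.
by rewrite mulrC ler_pdivrMr // mul1r lerDl.
Qed.

(** The mean value theorem is applied to the difference [X] of both sides along the segment; its
    derivative is nonpositive on [0, 1] by the Lipschitz bound, so the gradient is not
    integrated. *)
Lemma descent_lemma d (f : 'cV[R]_d -> R) (G : 'cV[R]_d -> 'cV[R]_d) L u v :
  (forall y, hasgrad f y (G y)) -> lipschitz1 L G ->
  f (u + v) <= f u + dot (G u) v + L / 2 * norm2 v ^+ 2.
Proof.
move=> H lG.
pose X (t : R) := f (u + t *: v) - (t * dot (G u) v + L / 2 * norm2 v ^+ 2 * t ^+ 2).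
pose dX (t : R) := dot (G (u + t *: v)) v - (dot (G u) v + L * norm2 v ^+ 2 * t).
have D t : is_derive t (1 : R) X (dX t).
  have := hasgrad_line u v H t => ?.
  apply: is_deriveB.
  apply: is_derive_eps => e e0; exists (e / (`|L / 2 * norm2 v ^+ 2| + 1)).
    by rewrite divr_gt0 // ltr_wpDl.
  move=> h; rewrite ltr_pdivlMr ?ltr_wpDl // => hh.
  rewrite [h *: _]mulr1.
  have -> : (h + t) * dot (G u) v + L / 2 * norm2 v ^+ 2 * (h + t) ^+ 2 -
    (t * dot (G u) v + L / 2 * norm2 v ^+ 2 * t ^+ 2) -
    h * (dot (G u) v + L * norm2 v ^+ 2 * t) = L / 2 * norm2 v ^+ 2 * h * h by field.
  rewrite normrM ler_wpM2r // normrM mulrC (le_trans _ (ltW hh)) //.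
  by rewrite ler_wpM2l // lerDl.
have cX : {within `[0, 1], continuous X}.
  apply: continuous_subspaceT => t; apply: differentiable_continuous.
  by apply/derivable1_diffP; have [] := D t.
have [c c01] := MVT_segment ler01 (fun t _ => D t) cX.
rewrite /X /dX subr0 mulr1 !scale1r !scale0r addr0 !mul0r !mul1r expr0n expr1n /= mulr0 addr0 subr0 mulr1.
have c0 : 0 <= c by move: c01; rewrite in_itv /= => /andP[].
have : dot (G (u + c *: v) - G u) v <= L * norm2 v ^+ 2 * c.
  apply: le_trans (dot_le _ _) _.
  have := lG (u + c *: v) u; rewrite [u + _]addrC addrK norm2Z ger0_norm // => h.
  by apply: le_trans (ler_wpM2r (norm2_ge0 _) h) _; rewrite le_eqVlt; apply/orP; left; apply/eqP; ring.
rewrite dotBl => h E; lra.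
Qed.

Lemma strongly_convex_le d mu (f : 'cV[R]_d -> R) u v g :
  strongly_convex mu f -> hasgrad f u g ->
  f u + dot g (v - u) + mu / 2 * norm2 (v - u) ^+ 2 <= f v.
Proof.
move=> sc H.
suff : dot g (v - u) <= f v - f u - mu / 2 * norm2 (v - u) ^+ 2 by lra.
apply: (hasgrad_dot_le (M := mu / 2 * norm2 (v - u) ^+ 2) H) => t /andP[t0 t1].
have := sc v u t; rewrite (ltW t0) t1 => /(_ isT).
have -> : t *: v + (1 - t) *: u = u + t *: (v - u).
  by rewrite scalerBl scale1r scalerBr addrCA addrA addrC !addrA.
by move=> h; nra.
Qed.

Section StronglyConvexSmooth.
Variables (d : nat) (mu L : R) (f : 'cV[R]_d -> R) (G : 'cV[R]_d -> 'cV[R]_d).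
Hypothesis mu0 : 0 < mu.
Hypothesis fG : forall y, hasgrad f y (G y).
Hypothesis lG : lipschitz1 L G.
Hypothesis sc : strongly_convex mu f.

Lemma sc_first_order u v :
  f u + dot (G u) (v - u) + mu / 2 * norm2 (v - u) ^+ 2 <= f v.
Proof. exact: strongly_convex_le. Qed.

Lemma sc_descent u v : f (u + v) <= f u + dot (G u) v + L / 2 * norm2 v ^+ 2.
Proof. exact: descent_lemma. Qed.

Lemma sc_mu_le_L : (0 < d)%N -> mu <= L.
Proof.
case: d f G fG lG sc => // d' f' G' fG' lG' sc' _.
pose e : 'cV[R]_d'.+1 := delta_mx 0 0.
have e1 : norm2 e ^+ 2 = 1 by rewrite norm2_sqr dot_delta mxE !eqxx.
have := strongly_convex_le e sc' (fG' 0).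
have := descent_lemma 0 e fG' lG'.
by rewrite add0r subr0 e1; lra.
Qed.

(** A gradient step of length 1/L lowers [f] by at least |G y|^2 / (2 L), which a minimum
    forbids. *)
Lemma sc_min y : (forall y', f y <= f y') -> 0 < L -> G y = 0.
Proof.
move=> h L0; apply: norm2_eq0; apply/eqP; rewrite -sqrf_eq0; apply/eqP.
have := sc_descent y (- L^-1 *: G y); have := h (y + - L^-1 *: G y).
rewrite dotZr -norm2_sqr norm2Z_sqr; set N := norm2 _ ^+ 2 => h1 h2.
have N0 : 0 <= N by exact: sqr_ge0.
apply/eqP; rewrite eq_le N0 andbT.
have E : - L^-1 * N + L / 2 * ((- L^-1) ^+ 2 * N) = - (N / (2 * L)).
  by field; rewrite gt_eqF.
have : 0 <= - (N / (2 * L)) by rewrite -E; lra.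
by rewrite oppr_ge0 ler_pdivrMr ?mul0r // mulr_gt0.
Qed.

(* Baillon-Haddad for [f - mu/2 |.|^2], whose gradient is [G - mu]; the slack
   [e] avoids the degenerate case [L = mu]. *)
Let cocoercive u v e : 0 < e -> mu <= L ->
  norm2 (G u - G v - mu *: (u - v)) ^+ 2 <=
  (L - mu + e) * dot (G u - G v - mu *: (u - v)) (u - v).
Proof.
move=> e0 muL; pose K := L - mu + e.
have K0 : 0 < K by rewrite /K; lra.
(* After subtracting mu/2 |.|^2 and its linearization at [x], the function has gradient [p] at [y].
   Its gradient step [y - p / K] is where the upper bound from [y] and the lower bound from [x] are
   compared. Adding the instances (u, v) and (v, u) cancels the function values. *)
have half x y : let p := G y - G x - mu *: (y - x) in
  f x - f y + dot (G x) (y - x) + mu / 2 * norm2 (y - x) ^+ 2 + norm2 p ^+ 2 / (2 * K) <= 0.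
  move=> p.
  have D := sc_descent y (- K^-1 *: p).
  have S := sc_first_order x (y + - K^-1 *: p).
  have E : y + - K^-1 *: p - x = (y - x) + - K^-1 *: p by rewrite addrAC.
  rewrite E dotDr !dotZr norm2D_sqr dotZr norm2Z_sqr in S.
  rewrite dotZr norm2Z_sqr in D.
  have Gp : dot (G y) p = norm2 p ^+ 2 + dot (G x) p + mu * dot (y - x) p.
    by rewrite norm2_sqr {2}/p !dotBl dotZl dotBl; ring.
  rewrite Gp in D.
  have N0 : 0 <= norm2 p ^+ 2 by exact: sqr_ge0.
  have E1 : norm2 p ^+ 2 / (2 * K) = (K / 2) * (K^-1 ^+ 2 * norm2 p ^+ 2).
    by field; rewrite gt_eqF.
  have E2 : K^-1 * norm2 p ^+ 2 = K * (K^-1 ^+ 2 * norm2 p ^+ 2).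
    by field; rewrite gt_eqF.
  rewrite E1; move: D S; rewrite sqrrN !mulNr mulrDr mulrDr E2.
  have Q0 : 0 <= K^-1 ^+ 2 * norm2 p ^+ 2 by rewrite mulr_ge0 ?sqr_ge0.
  move: (K^-1 ^+ 2 * norm2 p ^+ 2) Q0 => Q Q0 D S.
  have : 0 <= e * Q by rewrite mulr_ge0 // ltW.
  have -> : K / 2 * Q = K * Q - ((L - mu) * Q + e * Q) / 2 by rewrite /K; field.
  by rewrite mulrBl; lra.
have h1 := half u v; have h2 := half v u.
have E : norm2 (G v - G u - mu *: (v - u)) = norm2 (G u - G v - mu *: (u - v)).
  by rewrite -norm2N; congr norm2; apply/matrixP => i j; rewrite !mxE; ring.
rewrite /= E (norm2C v u) in h1; rewrite /= in h2.
have S : norm2 (G u - G v - mu *: (u - v)) ^+ 2 / K <=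
   dot (G u - G v - mu *: (u - v)) (u - v).
  have -> : norm2 (G u - G v - mu *: (u - v)) ^+ 2 / K =
    norm2 (G u - G v - mu *: (u - v)) ^+ 2 / (2 * K) +
    norm2 (G u - G v - mu *: (u - v)) ^+ 2 / (2 * K) by field; rewrite gt_eqF.
  rewrite !dotBl dotZl -norm2_sqr.
  have : dot (G u) (v - u) = - dot (G u) (u - v) by rewrite -dotNr opprB.
  by move=> E'; rewrite E' in h1; lra.
by rewrite ler_pdivrMr // mulrC in S.
Qed.

(** Completing the square turns cocoercivity, |p|^2 <= (L - mu) <p, w>, into the statement that [p]
    lies in the ball of radius (L - mu)/2 |w| around (L - mu)/2 w. *)
Lemma grad_deviation u v : mu <= L ->
  norm2 (G u - G v - ((mu + L) / 2) *: (u - v)) <= (L - mu) / 2 * norm2 (u - v).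
Proof.
move=> muL; have lm : 0 <= (L - mu) / 2 by lra.
rewrite -(ler_pXn2r (n := 2)) ?nnegrE ?mulr_ge0 //; last by lra.
set w := u - v; set p := G u - G v - mu *: w.
have -> : G u - G v - ((mu + L) / 2) *: w = p + (- ((L - mu) / 2)) *: w.
  by apply/matrixP => i j; rewrite !mxE; field.
suff h : norm2 p ^+ 2 <= (L - mu) * dot p w.
  by rewrite norm2D_sqr norm2Z_sqr dotZr exprMn sqrrN; lra.
(* The multiplicative slack of [cocoercive] is divided by |<p, w>| + 1 to become an additive slack
   [e]. *)
apply/ler_addgt0Pr => e e0.
have N1 : 0 < `|dot p w| + 1 by rewrite ltr_wpDl.
have := cocoercive u v (divr_gt0 e0 N1) muL; rewrite -/w -/p => h.
apply: (le_trans h); rewrite mulrDl lerD2l mulrAC ler_pdivrMr //.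
by rewrite ler_wpM2l ?(ltW e0) // (le_trans (ler_norm _)) // lerDl.
Qed.

End StronglyConvexSmooth.

(** Split off the multiple (mu + L)/2 of [w]: the factor 1 - t (mu + L)/2, nonnegative by the
    step-size bound, and the deviation t (L - mu)/2 add up to 1 - t mu. It applies both to gradient
    differences and to Hessian-vector products. *)
Lemma step_contraction d (w p : 'cV[R]_d) (mu L t : R) :
  norm2 (p - ((mu + L) / 2) *: w) <= (L - mu) / 2 * norm2 w ->
  0 <= t -> t * ((mu + L) / 2) <= 1 ->
  norm2 (w - t *: p) <= (1 - t * mu) * norm2 w.
Proof.
move=> h t0 t1.
have -> : w - t *: p = (1 - t * ((mu + L) / 2)) *: w - t *: (p - ((mu + L) / 2) *: w).
  by apply/matrixP => i j; rewrite !mxE; ring.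
apply: le_trans (norm2B _ _) _; rewrite !norm2Z ger0_norm ?subr_ge0 // ger0_norm //.
have := ler_wpM2l t0 h; nra.
Qed.

End Gradients.

(** * Functions of two variables *)

Section TwoVariables.
Context {R : realType} {m n : nat}.
Implicit Types h : 'cV[R]_m -> 'cV[R]_n -> R.

Definition hasgrad2 h x y gx gy : Prop :=
  forall e, 0 < e -> exists2 del, 0 < del & forall u v,
    norm2 u < del -> norm2 v < del ->
    `|h (x + u) (y + v) - h x y - dot gx u - dot gy v| <= e * (norm2 u + norm2 v).

(** The differential on the product is linear, hence determined by its values on the basis vectors
    of the two factors, which are the partial derivatives collected in [gradx] and [grady]. *)
Lemma differentiable_hasgrad2 h x y :
  differentiable (fun q => h q.1 q.2) (x, y) ->
  hasgrad2 h x y (gradx h x y) (grady h x y).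
Proof.
move=> D.
pose f (q : 'cV[R]_m * 'cV[R]_n) := h q.1 q.2.
pose l := 'd f (x, y).
have lx u : l (u, 0) = dot (gradx h x y) u.
  have -> : (u, 0) = \sum_i u i 0 *: (delta_mx i 0 : 'cV[R]_m, 0 : 'cV[R]_n).
    rewrite [u in LHS]matrix_sum_delta.
    elim/big_rec2: _ => [//|i [u1 u2] u' _ [-> <-]].
    by rewrite big_ord1; apply: injective_projections; rewrite /= ?scaler0 ?addr0.
  rewrite linear_sum; apply: eq_bigr => i _; rewrite linearZ /= mulrC; congr (_ * _).
  rewrite mxE -deriveE // /derive; congr (lim _).
  apply: (congr1 (fun F : R -> R => F @ 0^')); apply/funext => t.
  by rewrite /= /f /= scaler0 add0r.
have ly v : l (0, v) = dot (grady h x y) v.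
  have -> : (0, v) = \sum_i v i 0 *: (0 : 'cV[R]_m, delta_mx i 0 : 'cV[R]_n).
    rewrite [v in LHS]matrix_sum_delta.
    elim/big_rec2: _ => [//|i [u1 u2] u' _ [<- ->]].
    by rewrite big_ord1; apply: injective_projections; rewrite /= ?scaler0 ?addr0.
  rewrite linear_sum; apply: eq_bigr => i _; rewrite linearZ /= mulrC; congr (_ * _).
  rewrite mxE -deriveE // /derive; congr (lim _).
  apply: (congr1 (fun F : R -> R => F @ 0^')); apply/funext => t.
  by rewrite /= /f /= scaler0 add0r.
move=> e e0.
have := diff_locally D; move/eqaddoP => /(_ e e0) /nbhs_ballP[del /= d0 hd].
exists del => // u v ud vd.
have H : ball (0 : 'cV[R]_m * 'cV[R]_n) del (u, v).
  split; split=> // i j; rewrite ord1 /ball /= mxE sub0r normrN.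
  - exact: le_lt_trans (coord_le_norm2 _ _) ud.
  - exact: le_lt_trans (coord_le_norm2 _ _) vd.
have := hd _ H.
have -> : `|((u, v) : 'cV[R]_m * 'cV[R]_n)| = Num.max `|u| `|v| by [].
set A := `|_|; set B := `|_ - _ - _ - _|.
have -> : A = B.
  rewrite /A /B; congr `|_|.
  transitivity (h (u + x) (v + y) - (h x y + l (u, v))) => //.
  have -> : (u, v) = (u, 0) + (0, v) :> 'cV[R]_m * 'cV[R]_n.
    by apply: injective_projections; rewrite /= ?addr0 ?add0r.
  have -> : l ((u, 0) + (0, v)) = l (u, 0) + l (0, v) by exact: linearD.
  by rewrite lx ly [u + x]addrC [v + y]addrC !opprD !addrA.
move=> /le_trans; apply; rewrite ler_wpM2l ?(ltW e0) //.
rewrite ge_max; apply/andP; split.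
- by apply: le_trans (mx_norm_le_norm2 _) _; rewrite lerDl.
- by apply: le_trans (mx_norm_le_norm2 _) _; rewrite lerDr.
Qed.

Lemma hasgrad2_x h x y gx gy : hasgrad2 h x y gx gy ->
  hasgrad (fun x' => h x' y) x gx.
Proof.
move=> H e e0; have [del d0 hd] := H e e0; exists del => // u ud.
have := hd u 0 ud; rewrite norm2_0 addr0 dot0r subr0 addr0; exact.
Qed.

Lemma hasgrad2_y h x y gx gy : hasgrad2 h x y gx gy -> hasgrad (h x) y gy.
Proof.
move=> H e e0; have [del d0 hd] := H e e0; exists del => // v vd.
have := hd 0 v _ vd; rewrite norm2_0 addr0 dot0r subr0 add0r; exact.
Qed.

Lemma smooth1_hasgrad2 h x y : smooth1 h ->
  hasgrad2 h x y (gradx h x y) (grady h x y).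
Proof. by move=> s; apply: differentiable_hasgrad2; exact: s. Qed.

Lemma smooth1_gradx h x y : smooth1 h -> hasgrad (fun x' => h x' y) x (gradx h x y).
Proof. by move=> s; exact: (hasgrad2_x (smooth1_hasgrad2 x y s)). Qed.

Lemma smooth1_grady h x y : smooth1 h -> hasgrad (h x) y (grady h x y).
Proof. by move=> s; exact: (hasgrad2_y (smooth1_hasgrad2 x y s)). Qed.

Definition grady_coord h j : 'cV[R]_m -> 'cV[R]_n -> R := fun x y => grady h x y j 0.

Lemma smooth2_coord h j : smooth2 h -> smooth1 (grady_coord h j).
Proof.
move=> [_ s] p.
apply: (differentiable_comp (f := fun q => grady h q.1 q.2)
  (g := fun M : 'cV[R]_n => M j 0)); first exact: s.
exact: differentiable_coord.
Qed.

Lemma dot_hessxyT h x y u j :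
  ((hessxy h x y)^T *m u) j 0 = dot (gradx (grady_coord h j) x y) u.
Proof. by rewrite mxE; apply: eq_bigr => i _; rewrite !mxE. Qed.

Lemma dot_hessyyT h x y v j :
  ((hessyy h x y)^T *m v) j 0 = dot (grady (grady_coord h j) x y) v.
Proof. by rewrite mxE; apply: eq_bigr => i _; rewrite !mxE. Qed.

Lemma norm2_le_coord d (u : 'cV[R]_d) c : (forall j, `|u j 0| <= c) ->
  norm2 u <= d%:R * c.
Proof.
move=> h; apply: le_trans (norm2_le_mx_norm _) _.
have [d0|d0] := posnP d; first by rewrite (_ : d%:R = 0) ?mul0r // d0.
rewrite ler_wpM2l // -[`|u|]/(mx_norm u).
have [->|/mx_norm_neq0[[i j] ->]] := eqVneq (mx_norm u) 0; last by rewrite ord1 h.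
exact: le_trans (normr_ge0 _) (h (Ordinal d0)).
Qed.

(** The row index of [hessxy] and [hessyy] is the direction of differentiation, so the Jacobian of
    [grady h] is made of their transposes. Each coordinate is expanded to precision e / (n + 1), to
    be summed over [n] of them. *)
Lemma smooth2_expansion h x y : smooth2 h ->
  forall e, 0 < e -> exists2 del, 0 < del & forall u v,
    norm2 u < del -> norm2 v < del ->
    norm2 (grady h (x + u) (y + v) - grady h x y - (hessxy h x y)^T *m u
      - (hessyy h x y)^T *m v) <= e * (norm2 u + norm2 v).
Proof.
move=> s e e0.
have n1 : 0 < (n%:R + 1 : R) by rewrite ltr_wpDl.
have H j := smooth1_hasgrad2 x y (smooth2_coord j s).
have {}H j := H j _ (divr_gt0 e0 n1).
pose del j := s2val (cid2 (H j)).
(* The default 1 keeps the radius positive also when there is no coordinate. *)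
exists (\big[Num.min/1]_j del j).
  elim/big_ind: _ => //; first by move=> a b a0 b0; rewrite lt_min a0.
  by move=> j _; rewrite /del; case: cid2.
move=> u v ud vd.
have hj j : `|grady_coord h j (x + u) (y + v) - grady_coord h j x y -
    dot (gradx (grady_coord h j) x y) u - dot (grady (grady_coord h j) x y) v|
    <= e / (n%:R + 1) * (norm2 u + norm2 v).
  have dj : \big[Num.min/1]_j del j <= del j by exact: bigmin_le_cond.
  have := lt_le_trans ud dj; have := lt_le_trans vd dj.
  by rewrite /del; case: cid2 => /= a a0 ha va ua; exact: ha.
have h0 : 0 <= norm2 u + norm2 v by rewrite addr_ge0.
apply: le_trans (norm2_le_coord (c := e / (n%:R + 1) * (norm2 u + norm2 v)) _) _.
  move=> j; have := hj j; rewrite -dot_hessxyT -dot_hessyyT.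
  set C := _^T *m u; set D := _^T *m v; move=> hC.
  have -> : (grady h (x + u) (y + v) - grady h x y - C - D) j 0 =
    grady h (x + u) (y + v) j 0 - grady h x y j 0 - C j 0 - D j 0.
    by clearbody C D; rewrite !mxE.
  exact: hC.
rewrite mulrA ler_wpM2r // mulrCA ger_pMr // ler_pdivrMr // mul1r lerDl //.
Qed.

Lemma smooth2_hasgrad_y h x y w : smooth2 h ->
  hasgrad (fun y' => dot (grady h x y') w) y (hessyy h x y *m w).
Proof.
move=> s e e0; have w1 : 0 < norm2 w + 1 by rewrite ltr_wpDl.
have [del d0 hd] := smooth2_expansion x y s (divr_gt0 e0 w1).
exists del => // v vd; have := hd 0 v; rewrite norm2_0 addr0 add0r mulmx0 subr0.
move=> /(_ d0 vd) H.
have -> : dot (hessyy h x y *m w) v = dot ((hessyy h x y)^T *m v) w.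
  by rewrite dot_mulmx dotC.
rewrite (_ : _ - _ - _ = dot (grady h x (y + v) - grady h x y - (hessyy h x y)^T *m v) w); last first.
  by rewrite !dotBl.
move: H; set D := _ - _ => H.
rewrite (le_trans (normr_dot_le D w)) //.
apply: le_trans (ler_wpM2r (norm2_ge0 w) H) _.
by rewrite mulrAC ler_wpM2r // mulrAC ler_pdivrMr // ler_wpM2l ?(ltW e0) // lerDl.
Qed.

Lemma smooth2_hasgrad_x h x y w : smooth2 h ->
  hasgrad (fun x' => dot (grady h x' y) w) x (hessxy h x y *m w).
Proof.
move=> s e e0; have w1 : 0 < norm2 w + 1 by rewrite ltr_wpDl.
have [del d0 hd] := smooth2_expansion x y s (divr_gt0 e0 w1).
exists del => // u ud; have := hd u 0 ud; rewrite norm2_0 !addr0 mulmx0 subr0.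
move=> /(_ d0) H.
have -> : dot (hessxy h x y *m w) u = dot ((hessxy h x y)^T *m u) w.
  by rewrite dot_mulmx dotC.
rewrite (_ : _ - _ - _ = dot (grady h (x + u) y - grady h x y - (hessxy h x y)^T *m u) w); last first.
  by rewrite !dotBl.
move: H; set D := _ - _ => H.
rewrite (le_trans (normr_dot_le D w)) //.
apply: le_trans (ler_wpM2r (norm2_ge0 w) H) _.
by rewrite mulrAC ler_wpM2r // mulrAC ler_pdivrMr // ler_wpM2l ?(ltW e0) // lerDl.
Qed.

Lemma hessxy_bound h x y L : 0 <= L -> smooth2 h ->
  (forall x' y', norm2 (grady h x y - grady h x' y') <= L * norm2 (col_mx (x - x') (y - y'))) ->
  forall w, norm2 (hessxy h x y *m w) <= L * norm2 w.
Proof.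
move=> L0 s lip w.
rewrite -[hessxy h x y]trmxK; apply: norm2_bilinear_le => // u {}w.
have -> : dot ((hessxy h x y)^T *m u) w = dot (hessxy h x y *m w) u.
  by rewrite dot_mulmx trmxK dotC.
apply: (hasgrad_dot_le (M := 0) (smooth2_hasgrad_x x y w s)) => t /andP[t0 t1].
rewrite mulr0 addr0 -dotBl; apply: le_trans (dot_le _ _) _.
rewrite norm2C; apply: le_trans (ler_wpM2r (norm2_ge0 w) (lip _ _)) _.
rewrite subrr norm2_col_mx0r opprD addrA subrr sub0r norm2N norm2Z ger0_norm ?(ltW t0) //.
by rewrite le_eqVlt; apply/orP; left; apply/eqP; ring.
Qed.

(* The bilinear form transfers the estimate from the Jacobian of the gradient
   to its transpose [hessyy], so no symmetry of the Hessian is needed. *)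
Lemma hessyy_deviation h x y c r : 0 <= r -> smooth2 h ->
  (forall y', norm2 (grady h x y' - grady h x y - c *: (y' - y)) <= r * norm2 (y' - y)) ->
  forall w, norm2 (hessyy h x y *m w - c *: w) <= r * norm2 w.
Proof.
move=> r0 s dev w.
have -> : hessyy h x y *m w - c *: w = ((hessyy h x y)^T - c%:M)^T *m w.
  by rewrite linearB /= trmxK tr_scalar_mx mulmxBl mul_scalar_mx.
apply: norm2_bilinear_le => // v {}w.
rewrite mulmxBl mul_scalar_mx dotBl dotZl dot_mulmx trmxK dotC.
rewrite lerBlDr; apply: (hasgrad_dot_le (M := 0) (smooth2_hasgrad_y x y w s)) => t /andP[t0 t1].
rewrite mulr0 addr0 -dotBl.
have := dev (y + t *: v).
rewrite (_ : y + t *: v - y = t *: v); last by rewrite addrC addKr.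
rewrite norm2Z ger0_norm ?(ltW t0) //.
set g := grady h x (y + t *: v) - grady h x y => h1.
have : dot (g - c *: (t *: v)) w <= r * (t * norm2 v) * norm2 w.
  by apply: le_trans (dot_le _ _) _; rewrite ler_wpM2r.
rewrite dotBl !dotZl; lra.
Qed.

End TwoVariables.

(** * Derivatives and convexity of averages over the workers *)

Section Averages.
Context {R : realType} {m n N : nat}.
Variable (h : 'I_N -> 'cV[R]_m -> 'cV[R]_n -> R).
Hypothesis N0 : (0 < N)%N.
Let avg x y := N%:R^-1 * \sum_i h i x y.

Let N0' : (N%:R : R) != 0. Proof. by rewrite pnatr_eq0 -lt0n. Qed.
Let Np : 0 < (N%:R^-1 : R). Proof. by rewrite invr_gt0 ltr0n. Qed.

Lemma avg_smooth1 : (forall i, smooth1 (h i)) -> smooth1 avg.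
Proof.
move=> s p.
have -> : (fun q => avg q.1 q.2) = N%:R^-1 *: (\sum_i (fun q : 'cV[R]_m * 'cV[R]_n => h i q.1 q.2)).
  by apply/funext => q; rewrite /avg /= fct_sumE.
by apply: differentiableZ; apply: differentiable_sum => i; exact: s.
Qed.

Lemma avg_gradx x y : (forall i, smooth1 (h i)) ->
  gradx avg x y = N%:R^-1 *: \sum_i gradx (h i) x y.
Proof.
move=> s; apply: hasgrad_grad; apply: hasgrad_scale; apply: hasgrad_sum => i.
exact: smooth1_gradx.
Qed.

Lemma avg_grady x y : (forall i, smooth1 (h i)) ->
  grady avg x y = N%:R^-1 *: \sum_i grady (h i) x y.
Proof.
move=> s; apply: hasgrad_grad; apply: hasgrad_scale; apply: hasgrad_sum => i.
exact: smooth1_grady.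
Qed.

Lemma avg_smooth2 : (forall i, smooth2 (h i)) -> smooth2 avg.
Proof.
move=> s; have s1 i : smooth1 (h i) by have [] := s i.
split; first exact: avg_smooth1.
move=> p.
have -> : (fun q => grady avg q.1 q.2) = N%:R^-1 *: (\sum_i (fun q : 'cV[R]_m * 'cV[R]_n => grady (h i) q.1 q.2)).
  by apply/funext => q; rewrite avg_grady // /= fct_sumE.
by apply: differentiableZ; apply: differentiable_sum => i; have [_] := s i; exact.
Qed.

Let avg_coord j x y : (forall i, smooth2 (h i)) ->
  grady_coord avg j x y = N%:R^-1 * \sum_i grady_coord (h i) j x y.
Proof.
move=> s; have s1 i : smooth1 (h i) by have [] := s i.
by rewrite /grady_coord avg_grady // mxE summxE.
Qed.

Lemma avg_hessxy x y : (forall i, smooth2 (h i)) ->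
  hessxy avg x y = N%:R^-1 *: \sum_i hessxy (h i) x y.
Proof.
move=> s; apply/matrixP => a j; rewrite !mxE summxE.
have -> : (fun x' => grady avg x' y j 0) =
   (fun x' => N%:R^-1 * \sum_i grady_coord (h i) j x' y).
  by apply/funext => x'; exact: avg_coord.
have H : hasgrad (fun x' => N%:R^-1 * \sum_i grady_coord (h i) j x' y) x
    (N%:R^-1 *: \sum_i gradx (grady_coord (h i) j) x y).
  apply: hasgrad_scale; apply: hasgrad_sum => i.
  by apply: smooth1_gradx; exact: smooth2_coord.
have [_ ->] := hasgrad_is_derive (delta_mx a 0) H.
rewrite dot_delta mxE summxE; congr (_ * _); apply: eq_bigr => i _.
by rewrite !mxE.
Qed.

Lemma avg_hessyy x y : (forall i, smooth2 (h i)) ->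
  hessyy avg x y = N%:R^-1 *: \sum_i hessyy (h i) x y.
Proof.
move=> s; apply/matrixP => a j; rewrite !mxE summxE.
have -> : (fun y' => grady avg x y' j 0) =
   (fun y' => N%:R^-1 * \sum_i grady_coord (h i) j x y').
  by apply/funext => y'; exact: avg_coord.
have H : hasgrad (fun y' => N%:R^-1 * \sum_i grady_coord (h i) j x y') y
    (N%:R^-1 *: \sum_i grady (grady_coord (h i) j) x y).
  apply: hasgrad_scale; apply: hasgrad_sum => i.
  by apply: smooth1_grady; exact: smooth2_coord.
have [_ ->] := hasgrad_is_derive (delta_mx a 0) H.
rewrite dot_delta mxE summxE; congr (_ * _); apply: eq_bigr => i _.
by rewrite !mxE.
Qed.

Lemma avg_strongly_convex mu x :
  (forall i, strongly_convex mu (h i x)) -> strongly_convex mu (avg x).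
Proof.
move=> s u v t t01; rewrite /avg.
have E (c : R) : c = N%:R^-1 * \sum_(i < N) c.
  by rewrite sumr_const card_ord -(mulr_natl c N) mulKf.
rewrite [mu / 2 * _ * _]E !mulrA ![_ * N%:R^-1]mulrC -!mulrA -mulrDr -mulrBr ler_pM2l //.
rewrite !big_distrr -big_split -sumrB; apply: ler_sum => i _.
by have := s i u v t t01; rewrite !mulrA.
Qed.

Lemma norm2_avg_le d (u : 'I_N -> 'cV[R]_d) c :
  (forall i, norm2 (u i) <= c) -> norm2 (N%:R^-1 *: \sum_i u i) <= c.
Proof.
move=> hu; rewrite norm2Z ger0_norm ?(ltW Np) // -[c](mulKf N0') ler_pM2l //.
apply: le_trans (norm2_sum _ _) _.
rewrite mulr_natl -[N in leRHS]card_ord -sumr_const; exact: ler_sum.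
Qed.

End Averages.

(** * Deterministic estimates for the bilevel problem *)

Section Minimizer.
Context {R : realType} {n : nat}.
Variables (mu : R) (f : 'cV[R]_n -> R) (G : 'cV[R]_n -> 'cV[R]_n).
Hypothesis mu0 : 0 < mu.
Hypothesis fG : forall y, hasgrad f y (G y).
Hypothesis sc : strongly_convex mu f.

Lemma hasgrad_continuous (y : 'cV[R]_n) : f v @[v --> y] --> f y.
Proof.
move=> B /nbhs_ballP[e /= e0 eB].
have [del d0 hd] := fG y (ltr01 : 0 < (1 : R)).
have g1 : 0 < norm2 (G y) + 1 by rewrite ltr_wpDl.
have n1 : 0 < (n%:R + 1 : R) by rewrite ltr_wpDl.
pose r := Num.min del (e / (norm2 (G y) + 1)) / (n%:R + 1).
have r0 : 0 < r by rewrite divr_gt0 // lt_min d0 divr_gt0.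
apply/nbhs_ballP; exists r => // v [_ yv]; apply: eB; rewrite /ball /=.
have vr : norm2 (v - y) < Num.min del (e / (norm2 (G y) + 1)).
  apply: (@le_lt_trans _ _ (n%:R * r)).
    apply: norm2_le_coord => j; rewrite !mxE distrC.
    by apply: ltW; exact: (yv j 0).
  rewrite /r mulrCA gtr_pMr ?lt_min ?d0 ?divr_gt0 //.
  by rewrite ltr_pdivrMr // mul1r ltrDl.
move: vr; rewrite lt_min => /andP[v1]; rewrite ltr_pdivlMr // => v2.
have := hd _ v1; rewrite [y + _]addrC subrK mul1r => h.
rewrite distrC; apply: le_lt_trans (_ : norm2 (v - y) + norm2 (G y) * norm2 (v - y) < _).
  have -> : f v - f y = (f v - f y - dot (G y) (v - y)) + dot (G y) (v - y) by rewrite subrK.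
  by apply: le_trans (ler_normD _ _) _; rewrite lerD ?normr_dot_le.
by move: v2; rewrite mulrDr mulr1 addrC mulrC.
Qed.

(** Coercivity from strong convexity at 0, and compactness of a closed ball. The extreme value
    theorem is applied to row vectors, whence the transposes. *)
Lemma sc_minimizer_exists : exists y, forall y', f y <= f y'.
Proof.
(* Beyond norm 2 |G 0| / mu the quadratic term mu/2 |y'|^2 outweighs <G 0, y'>, so [f y'] is at
   least [f 0]. *)
pose r := 2 * norm2 (G 0) / mu + 1.
have r0 : 0 < r by rewrite ltr_wpDl // divr_ge0 ?mulr_ge0 // ltW.
pose A := [set v : 'rV[R]_n | `|v| <= r].
have cA : compact A.
  apply: bounded_closed_compact.
    by exists r; split; [exact: num_real|move=> M rM v /= /le_trans; apply; exact: ltW].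
  apply: (@closed_comp _ _ (fun v : 'rV[R]_n => `|v|) [set x | x <= r]).
    by move=> v _; exact: norm_continuous.
  exact: closed_le.
have A0 : A !=set0 by exists 0; rewrite /A /= normr0 ltW.
have cf : {within A, continuous (fun v : 'rV[R]_n => f v^T)}.
  apply: continuous_subspaceT => v.
  apply: (@continuous_comp _ _ _ trmx f); last exact: hasgrad_continuous.
  move=> B /nbhs_ballP[e /= e0 eB]; apply/nbhs_ballP; exists e => // w [_ hw].
  by apply: eB; split=> // i j; rewrite !mxE.
have [c Ac hc] := EVT_min_rV A0 cA cf.
exists c^T => y'.
have [yr|yr] := leP `|y'^T| r.
  by have := hc y'^T; rewrite trmxK; apply; rewrite inE.
have h0 : f c^T <= f 0.
  have := hc 0; rewrite trmx0; apply.
  by rewrite inE /A /= normr0 ltW.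
apply: le_trans h0 _.
have := strongly_convex_le y' sc (fG 0); rewrite subr0.
have yr2 : r < norm2 y'.
  apply: lt_le_trans yr _; rewrite -[`|_|]/(mx_norm y'^T).
  have [->|/mx_norm_neq0[[i j] ->]] := eqVneq (mx_norm y'^T) 0; first exact: norm2_ge0.
  by rewrite mxE /= ord1 coord_le_norm2.
have := normr_dot_le (G 0) y'; rewrite ler_norml => /andP[h1 _] h2.
apply: le_trans h2; rewrite -addrA lerDl.
have h3 : norm2 (G 0) <= mu / 2 * norm2 y'.
  have : 2 * norm2 (G 0) / mu < norm2 y' by apply: lt_trans yr2; rewrite ltrDl.
  by rewrite ltr_pdivrMr // => /ltW; lra.
have := ler_wpM2r (norm2_ge0 y') h3; lra.
Qed.

End Minimizer.

Lemma inj_unitmx (R : fieldType) n (A : 'M[R]_n) :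
  (forall v : 'cV[R]_n, A *m v = 0 -> v = 0) -> A \in unitmx.
Proof.
move=> h; rewrite -unitmx_tr -row_free_unit -kermx_eq0; apply/eqP/row_matrixP => i.
rewrite row0; apply: trmx_inj; rewrite trmx0; apply: h.
apply: trmx_inj; rewrite trmx_mul trmxK trmx0 -row_mul mulmx_ker; exact: row0.
Qed.

(** * Lower-level solution, adjoint vector and gradient of [Phi] *)

Section Problem.
Context {R : realType} {mu Cf Lf Lg Lgxy Lgyy LPhi Ly Lz sigma omu oml bf bg : R}.
Context {pb : problem R}.
Hypothesis asm : assumptions mu Cf Lf Lg Lgxy Lgyy LPhi Ly Lz sigma omu oml bf bg pb.
Local Notation N := (nw pb).
Local Notation m := (dx pb).
Local Notation n := (dy pb).
Local Notation f := (favg pb).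
Local Notation g := (gavg pb).
Local Notation ys := (ystar pb).
Local Notation zs := (zstar pb).

Let N0 : (0 < N)%N. Proof. by case: asm => -[[]]. Qed.
Let m0 : (0 < m)%N. Proof. by case: asm => -[[]]. Qed.
Let n0 : (0 < n)%N. Proof. by case: asm => -[[]]. Qed.
Let i0 : 'I_N := Ordinal N0.

Let cont i : [/\ forall x y y', `|floc pb i x y - floc pb i x y'| <= Cf * norm2 (y - y'),
      smooth1 (floc pb i) /\ smooth2 (gloc pb i),
      lipschitz2 (@norm2 R _) Lf (gradxy (floc pb i)),
      lipschitz2 (@norm2 R _) Lg (gradxy (gloc pb i))
    & lipschitz2 (@specnorm R _ _) Lgxy (hessxy (gloc pb i)) /\
      lipschitz2 (@specnorm R _ _) Lgyy (hessyy (gloc pb i))].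
Proof. by case: asm => _ [c _] _ _ _; exact: c. Qed.

Lemma floc_smooth1 i : smooth1 (floc pb i). Proof. by have [_ []] := cont i. Qed.
Lemma gloc_smooth2 i : smooth2 (gloc pb i). Proof. by have [_ []] := cont i. Qed.
Lemma gloc_smooth1 i : smooth1 (gloc pb i). Proof. by have [] := gloc_smooth2 i. Qed.
Lemma favg_smooth1 : smooth1 f. Proof. by apply: avg_smooth1; exact: floc_smooth1. Qed.
Lemma gavg_smooth2 : smooth2 g. Proof. by apply: avg_smooth2; exact: gloc_smooth2. Qed.
Lemma gavg_smooth1 : smooth1 g. Proof. by have [] := gavg_smooth2. Qed.

Lemma mu_gt0 : 0 < mu. Proof. by case: asm => _ [_ []]. Qed.

Let sc x : strongly_convex mu (g x).
Proof. by apply: avg_strongly_convex => // i; case: asm => _ [_ [_]] + _ _ _; exact. Qed.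

Lemma grady_gloc_lip i x y y' :
  norm2 (grady (gloc pb i) x y - grady (gloc pb i) x y') <= Lg * norm2 (y - y').
Proof.
have [_ _ _ h _] := cont i; have := h x y x y'.
rewrite /gradxy opp_col_mx add_col_mx subrr norm2_col_mx0l.
by apply: le_trans; exact: norm2_col_mxd.
Qed.

Lemma grady_gavg x y : grady g x y = N%:R^-1 *: \sum_i grady (gloc pb i) x y.
Proof. by apply: avg_grady => // i; exact: gloc_smooth1. Qed.

Lemma avg_dist_le d (u v : 'I_N -> 'cV[R]_d) c :
  (forall i, norm2 (u i - v i) <= c) ->
  norm2 (N%:R^-1 *: (\sum_i u i) - N%:R^-1 *: (\sum_i v i)) <= c.
Proof. by move=> h; rewrite -scalerBr -sumrB; exact: norm2_avg_le. Qed.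

Let lipG x : lipschitz1 Lg (grady g x).
Proof. by move=> y y'; rewrite !grady_gavg; apply: avg_dist_le => i; exact: grady_gloc_lip. Qed.

Let hgG x y : hasgrad (g x) y (grady g x y).
Proof. by apply: smooth1_grady; exact: gavg_smooth1. Qed.

Lemma mu_le_Lg : mu <= Lg.
Proof. exact: (sc_mu_le_L (hgG 0) (lipG 0) (sc 0) n0). Qed.

Lemma Lg_gt0 : 0 < Lg. Proof. exact: lt_le_trans mu_gt0 mu_le_Lg. Qed.

Lemma ystar_min x y' : g x (ys x) <= g x y'.
Proof.
have [y hy] := sc_minimizer_exists mu_gt0 (hgG x) (sc x).
exact: (@xgetPex _ 0 [set y | forall y', g x y <= g x y'] (ex_intro _ y hy)).
Qed.

Lemma grady_ystar x : grady g x (ys x) = 0.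
Proof. exact: (sc_min (hgG x) (lipG x) (ystar_min x) Lg_gt0). Qed.

Let dev x y y' :
  norm2 (grady g x y - grady g x y' - ((mu + Lg) / 2) *: (y - y')) <= (Lg - mu) / 2 * norm2 (y - y').
Proof. exact: (grad_deviation (hgG x) (lipG x) (sc x) y y' mu_le_Lg). Qed.

Let r0 : 0 <= (Lg - mu) / 2.
Proof. by rewrite divr_ge0 // subr_ge0 mu_le_Lg. Qed.

Lemma y_contraction x y t : 0 <= t -> t * ((mu + Lg) / 2) <= 1 ->
  norm2 (y - t *: grady g x y - ys x) <= (1 - t * mu) * norm2 (y - ys x).
Proof.
move=> t0 t1.
have -> : y - t *: grady g x y - ys x = (y - ys x) - t *: (grady g x y - grady g x (ys x)).
  by rewrite grady_ystar subr0 addrAC.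
exact: (step_contraction (dev x y (ys x)) t0 t1).
Qed.

Let Hdev x y w : norm2 (hessyy g x y *m w - ((mu + Lg) / 2) *: w) <= (Lg - mu) / 2 * norm2 w.
Proof. exact: (hessyy_deviation r0 gavg_smooth2 (fun y' => dev x y' y)). Qed.

Lemma hess_contraction x y w t : 0 <= t -> t * ((mu + Lg) / 2) <= 1 ->
  norm2 (w - t *: (hessyy g x y *m w)) <= (1 - t * mu) * norm2 w.
Proof. by move=> t0 t1; exact: (step_contraction (Hdev x y w)). Qed.

(** Reverse triangle inequality around (mu + Lg)/2 times the identity, as (mu + Lg)/2 - (Lg - mu)/2
    = mu. It yields injectivity, hence invertibility, of the Hessian. *)
Lemma hessyy_ge x y w : mu * norm2 w <= norm2 (hessyy g x y *m w).
Proof.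
have c0 : 0 <= (mu + Lg) / 2 by have := mu_gt0; have := Lg_gt0; lra.
have := norm2B (hessyy g x y *m w) (hessyy g x y *m w - ((mu + Lg) / 2) *: w).
rewrite opprB addrC subrK norm2Z ger0_norm // => h.
by have := Hdev x y w; lra.
Qed.

Lemma hessyy_le x y w : norm2 (hessyy g x y *m w) <= Lg * norm2 w.
Proof.
have c0 : 0 <= (mu + Lg) / 2 by have := mu_gt0; have := Lg_gt0; lra.
have := norm2D (hessyy g x y *m w - ((mu + Lg) / 2) *: w) (((mu + Lg) / 2) *: w).
rewrite subrK norm2Z ger0_norm // => h.
by have := Hdev x y w; lra.
Qed.

Lemma hessyy_zstar x : hessyy g x (ys x) *m zs x + grady f x (ys x) = 0.
Proof.
have u : hessyy g x (ys x) \in unitmx.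
  apply: inj_unitmx => v hv; apply: norm2_eq0; apply/eqP.
  have := hessyy_ge x (ys x) v; rewrite hv norm2_0 pmulr_rle0 ?mu_gt0 // => h.
  by rewrite eq_le h norm2_ge0.
by rewrite /zstar mulmxN mulmxA mulmxV // mul1mx addNr.
Qed.

Lemma grady_favg x y : grady f x y = N%:R^-1 *: \sum_i grady (floc pb i) x y.
Proof. by apply: avg_grady => // i; exact: floc_smooth1. Qed.

Lemma gradx_favg x y : gradx f x y = N%:R^-1 *: \sum_i gradx (floc pb i) x y.
Proof. by apply: avg_gradx => // i; exact: floc_smooth1. Qed.

Let grady_floc_le i x y : norm2 (grady (floc pb i) x y) <= Cf.
Proof.
set w := grady _ x y.
have h : dot w w <= Cf * norm2 w.
  have H : hasgrad (floc pb i x) y w by apply: smooth1_grady; exact: floc_smooth1.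
  apply: (hasgrad_dot_le (M := 0) H) => t /andP[t0 _].
  have [hC _ _ _ _] := cont i.
  rewrite mulr0 addr0; apply: le_trans (ler_norm _) _; apply: le_trans (hC _ _ _) _.
  rewrite [y + _]addrC addrK norm2Z ger0_norm ?(ltW t0) //.
  by rewrite le_eqVlt; apply/orP; left; apply/eqP; ring.
have [w0|w0] := eqVneq (norm2 w) 0; last first.
  have wp : 0 < norm2 w by rewrite lt_def w0 norm2_ge0.
  by rewrite -norm2_sqr expr2 ler_pM2r in h.
(* When the gradient vanishes, what remains is 0 <= Cf, read off the Lipschitz bound between 0 and a
   unit vector. *)
rewrite w0; have [hC _ _ _ _] := cont i.
pose e : 'cV[R]_n := delta_mx (Ordinal n0) 0.
have e1 : norm2 e = 1 by rewrite norm2_dot dot_delta mxE !eqxx sqrtr1.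
by have := hC x e 0; rewrite subr0 e1 mulr1; exact: le_trans.
Qed.

(** Places [zs x] inside the ball onto which z is projected, so that the projection cannot increase
    the distance to it. *)
Lemma zstar_le x : norm2 (zs x) <= Cf / mu.
Proof.
rewrite ler_pdivlMr ?mu_gt0 // mulrC; apply: le_trans (hessyy_ge x (ys x) _) _.
have -> : hessyy g x (ys x) *m zs x = - grady f x (ys x).
  by apply/eqP; rewrite -addr_eq0 hessyy_zstar.
by rewrite norm2N grady_favg; apply: norm2_avg_le => // i; exact: grady_floc_le.
Qed.

Let Ly0 : 0 < Ly. Proof. by case: asm => _ _ _ _ [[[]]]. Qed.
Let lipys : lipschitz1 Ly ys. Proof. by case: asm => _ _ _ _ [[_ []]]. Qed.

(** No derivative of [ystar] enters: its Lipschitz constant controls the size of its increment, and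
    the first-order contribution of that increment is eliminated by the linear system defining
    [zstar]. *)
Lemma hasgrad_Phi x :
  hasgrad (Phi pb) x (gradx f x (ys x) + hessxy g x (ys x) *m zs x).
Proof.
move=> e e0.
set y := ys x.
(* The first factor pays for two remainders, that of [f] and that of [grady g] paired with [zs x];
   the second for |u| + |k| <= (1 + Ly) |u|. *)
have k0 : 0 < (1 + norm2 (zs x)) * (1 + Ly).
  by rewrite mulr_gt0 // ltr_wpDr // ltW.
have e1 := divr_gt0 e0 k0.
have [d1 d10 H1] := smooth2_expansion x y gavg_smooth2 e1.
have [d2 d20 H2] := smooth1_hasgrad2 x y favg_smooth1 e1.
exists (Num.min d1 d2 / (1 + Ly)); first by rewrite divr_gt0 ?lt_min ?d10 // ltr_wpDr // ltW.
move=> u; rewrite ltr_pdivlMr ?ltr_wpDr ?(ltW Ly0) // mulrDr mulr1 => ud.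
pose k := ys (x + u) - y.
have kE : ys (x + u) = y + k by rewrite /k [y + _]addrC subrK.
have hk : norm2 k <= Ly * norm2 u by have := lipys (x + u) x; rewrite [x + u]addrC addrK addrC.
have [uk1 uk2] : norm2 u + norm2 k < d1 /\ norm2 u + norm2 k < d2.
  by move: ud; rewrite lt_min mulrC => /andP[a b]; split; [apply: le_lt_trans a|apply: le_lt_trans b]; rewrite lerD2l.
have u1 : norm2 u < d1 by apply: le_lt_trans uk1; rewrite lerDl.
have u2 : norm2 u < d2 by apply: le_lt_trans uk2; rewrite lerDl.
have k1 : norm2 k < d1 by apply: le_lt_trans uk1; rewrite lerDr.
have k2 : norm2 k < d2 by apply: le_lt_trans uk2; rewrite lerDr.
have {H1} := H1 u k u1 k1; rewrite -kE !grady_ystar subr0 sub0r => H1.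
have {H2} := H2 u k u2 k2; rewrite -kE => H2.
pose q := - ((hessxy g x y)^T *m u) - (hessyy g x y)^T *m k.
(* Adjoint argument: [grady g] vanishes at both minimizers, so [q] is only the remainder of its
   expansion. Pairing it with [zs x] trades the increment [k] of [ystar] for [u]. *)
have E : dot (grady f x y) k - dot (hessxy g x y *m zs x) u = dot (zs x) q.
  have -> : grady f x y = - (hessyy g x y *m zs x).
    by apply/eqP; rewrite -addr_eq0 addrC hessyy_zstar.
  by rewrite dotNl !dot_mulmx /q dotBr dotNr addrC.
rewrite /Phi kE -/y.
have -> : favg pb (x + u) (y + k) - favg pb x y - dot (gradx f x y + hessxy g x y *m zs x) u =
   (favg pb (x + u) (y + k) - favg pb x y - dot (gradx f x y) u - dot (grady f x y) k) + dot (zs x) q.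
  by rewrite dotDl -E; ring.
apply: le_trans (ler_normD _ _) _.
have H3 : `|dot (zs x) q| <= norm2 (zs x) * (e / ((1 + norm2 (zs x)) * (1 + Ly)) * (norm2 u + norm2 k)).
  by apply: le_trans (normr_dot_le _ _) _; rewrite ler_wpM2l.
rewrite -kE; apply: le_trans (lerD H2 H3) _.
have -> : e / ((1 + norm2 (zs x)) * (1 + Ly)) * (norm2 u + norm2 k) +
  norm2 (zs x) * (e / ((1 + norm2 (zs x)) * (1 + Ly)) * (norm2 u + norm2 k)) =
  e / (1 + Ly) * (norm2 u + norm2 k).
  field; rewrite !gt_eqF // ltr_wpDr // ltW //.
rewrite mulrAC ler_pdivrMr ?ltr_wpDr ?(ltW Ly0) // -mulrA ler_wpM2l ?(ltW e0) //.
by rewrite mulrDr mulr1 lerD2l mulrC.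
Qed.

Lemma grad_Phi x : grad (Phi pb) x = gradx f x (ys x) + hessxy g x (ys x) *m zs x.
Proof. exact: hasgrad_grad (hasgrad_Phi x). Qed.

Lemma Phi_descent x v :
  Phi pb (x + v) <= Phi pb x + dot (grad (Phi pb) x) v + LPhi / 2 * norm2 v ^+ 2.
Proof.
apply: (@descent_lemma _ _ _ (grad (Phi pb))); first by move=> u; rewrite grad_Phi; exact: hasgrad_Phi.
by case: asm => _ _ _ _ [[_ []]].
Qed.

Definition dloc_x i x y z := hessxy (gloc pb i) x y *m z + gradx (floc pb i) x y.
Definition dloc_z i x y z := hessyy (gloc pb i) x y *m z + grady (floc pb i) x y.
Definition davg_x x y z := N%:R^-1 *: \sum_i dloc_x i x y z.
Definition davg_z x y z := N%:R^-1 *: \sum_i dloc_z i x y z.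

Lemma davg_xE x y z : davg_x x y z = hessxy g x y *m z + gradx f x y.
Proof.
rewrite /davg_x big_split /= scalerDr gradx_favg avg_hessxy //; last exact: gloc_smooth2.
by rewrite -scalemxAl mulmx_suml.
Qed.

Lemma davg_zE x y z : davg_z x y z = hessyy g x y *m z + grady f x y.
Proof.
rewrite /davg_z big_split /= scalerDr grady_favg avg_hessyy //; last exact: gloc_smooth2.
by rewrite -scalemxAl mulmx_suml.
Qed.

Lemma norm2_avg_sqr_le d (u : 'I_N -> 'cV[R]_d) c :
  (forall i, norm2 (u i) ^+ 2 <= c) -> norm2 (N%:R^-1 *: \sum_i u i) ^+ 2 <= c.
Proof.
move=> h; have c0 : 0 <= c by apply: le_trans (h i0); exact: sqr_ge0.
rewrite -[c]sqr_sqrtr // ler_pXn2r ?nnegrE ?sqrtr_ge0 //.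
apply: norm2_avg_le => // i.
by rewrite -(ler_pXn2r (n := 2)) ?nnegrE ?sqrtr_ge0 // [Num.sqrt c ^+ 2]sqr_sqrtr //.
Qed.

Let lip_sqr d (u : 'cV[R]_d) (L a : R) : norm2 u <= L * a -> norm2 u ^+ 2 <= L ^+ 2 * a ^+ 2.
Proof. by move=> h; rewrite -exprMn ler_pXn2r ?nnegrE // (le_trans _ h). Qed.

Let spec_sqr p d (A : 'M[R]_(p, d)) z (L a r : R) : norm2 z <= r -> specnorm A <= L * a ->
  norm2 (A *m z) ^+ 2 <= L ^+ 2 * r ^+ 2 * a ^+ 2.
Proof.
move=> zr h; have r0' : 0 <= r by apply: le_trans zr.
have h1 : norm2 (A *m z) <= L * a * norm2 z.
  by apply: le_trans (specnormP A z) _; exact: ler_wpM2r.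
apply: le_trans (lip_sqr h1) _.
rewrite exprMn [leRHS]mulrAC; apply: ler_wpM2l.
  by apply: mulr_ge0; exact: sqr_ge0.
by rewrite ler_pXn2r ?nnegrE.
Qed.

(** * Bias, second moments and mean steps at a fixed state *)

Section State.
Variables (x : 'cV[R]_m) (y z : 'cV[R]_n) (rho : R).
Hypothesis zr : norm2 z <= rho.
Let ey := norm2 (y - ys x).
Let ez := norm2 (z - zs x).
Let L1 := Lf ^+ 2 + Lgyy ^+ 2 * rho ^+ 2.
Let L2 := Lf ^+ 2 + Lgxy ^+ 2 * rho ^+ 2.

Let eyE : norm2 (col_mx (x - x) (y - ys x)) = ey.
Proof. by rewrite subrr norm2_col_mx0l. Qed.

Let hxy i : norm2 ((hessxy (gloc pb i) x y - hessxy (gloc pb i) x (ys x)) *m z) ^+ 2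
  <= Lgxy ^+ 2 * rho ^+ 2 * ey ^+ 2.
Proof.
have [_ _ _ _ [h _]] := cont i; have := h x y x (ys x).
by rewrite eyE => h'; exact: (spec_sqr zr h').
Qed.

Let hyy i : norm2 ((hessyy (gloc pb i) x y - hessyy (gloc pb i) x (ys x)) *m z) ^+ 2
  <= Lgyy ^+ 2 * rho ^+ 2 * ey ^+ 2.
Proof.
have [_ _ _ _ [_ h]] := cont i; have := h x y x (ys x).
by rewrite eyE => h'; exact: (spec_sqr zr h').
Qed.

Let hf i : norm2 (gradxy (floc pb i) x y - gradxy (floc pb i) x (ys x)) <= Lf * ey.
Proof.
by have [_ _ h _ _] := cont i; have := h x y x (ys x); rewrite eyE.
Qed.

Let hfx i : norm2 (gradx (floc pb i) x y - gradx (floc pb i) x (ys x)) ^+ 2 <= Lf ^+ 2 * ey ^+ 2.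
Proof.
apply: lip_sqr; apply: le_trans (hf i).
by rewrite /gradxy opp_col_mx add_col_mx norm2_col_mxu.
Qed.

Let hfy i : norm2 (grady (floc pb i) x y - grady (floc pb i) x (ys x)) ^+ 2 <= Lf ^+ 2 * ey ^+ 2.
Proof.
apply: lip_sqr; apply: le_trans (hf i).
by rewrite /gradxy opp_col_mx add_col_mx norm2_col_mxd.
Qed.

Let het i : [/\ norm2 (gradxy (floc pb i) x (ys x) - gradxy f x (ys x)) ^+ 2 <= bf ^+ 2,
      norm2 (grady (gloc pb i) x (ys x) - grady g x (ys x)) ^+ 2 <= bg ^+ 2,
      specnorm (hessxy (gloc pb i) x (ys x) - hessxy g x (ys x)) ^+ 2 <= bg ^+ 2
    & specnorm (hessyy (gloc pb i) x (ys x) - hessyy g x (ys x)) ^+ 2 <= bg ^+ 2].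
Proof. by case: asm => _ _ _ [_ h] _; exact: h. Qed.

Let rho2 : norm2 z ^+ 2 <= rho ^+ 2.
Proof. by rewrite ler_pXn2r ?nnegrE // (le_trans _ zr). Qed.

Let hetx i : norm2 (dloc_x i x (ys x) z - davg_x x (ys x) z) ^+ 2 <= 2 * (rho ^+ 2 * bg ^+ 2 + bf ^+ 2).
Proof.
have [h1 _ h3 _] := het i.
have -> : dloc_x i x (ys x) z - davg_x x (ys x) z =
  (hessxy (gloc pb i) x (ys x) - hessxy g x (ys x)) *m z
   + (gradx (floc pb i) x (ys x) - gradx f x (ys x)).
  by rewrite davg_xE /dloc_x mulmxBl opprD addrACA.
apply: le_trans (norm2D_sqr_le _ _) _; rewrite ler_pM2l // lerD //.
  apply: le_trans (specnorm_sqrP z h3) _.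
  by rewrite [leRHS]mulrC ler_wpM2l ?sqr_ge0.
apply: le_trans h1; rewrite ler_pXn2r ?nnegrE //.
by rewrite /gradxy opp_col_mx add_col_mx norm2_col_mxu.
Qed.

Let hetz i : norm2 (dloc_z i x (ys x) z - davg_z x (ys x) z) ^+ 2 <= 2 * (rho ^+ 2 * bg ^+ 2 + bf ^+ 2).
Proof.
have [h1 _ _ h3] := het i.
have -> : dloc_z i x (ys x) z - davg_z x (ys x) z =
  (hessyy (gloc pb i) x (ys x) - hessyy g x (ys x)) *m z
   + (grady (floc pb i) x (ys x) - grady f x (ys x)).
  by rewrite davg_zE /dloc_z mulmxBl opprD addrACA.
apply: le_trans (norm2D_sqr_le _ _) _; rewrite ler_pM2l // lerD //.
  apply: le_trans (specnorm_sqrP z h3) _.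
  by rewrite [leRHS]mulrC ler_wpM2l ?sqr_ge0.
apply: le_trans h1; rewrite ler_pXn2r ?nnegrE //.
by rewrite /gradxy opp_col_mx add_col_mx norm2_col_mxd.
Qed.

(** The part of the direction of worker [i] that vanishes at the lower-level solution. Its average
    over the workers is the bias of the x-direction, so one estimate serves both [bias_le] and
    [dloc_x_le]. *)
Let restx i := dloc_x i x y z - dloc_x i x (ys x) z + hessxy g x (ys x) *m (z - zs x).

Lemma hessxy_gavg_le w : norm2 (hessxy g x (ys x) *m w) <= Lg * norm2 w.
Proof.
apply: hessxy_bound => //; [exact: ltW Lg_gt0|exact: gavg_smooth2|move=> x' y'].
rewrite !grady_gavg; apply: avg_dist_le => i.
have [_ _ _ h _] := cont i; apply: le_trans (h _ _ _ _).
by rewrite /gradxy opp_col_mx add_col_mx norm2_col_mxd.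
Qed.

Let restx_le i : norm2 (restx i) ^+ 2 <= 3 * L2 * ey ^+ 2 + 3 * Lg ^+ 2 * ez ^+ 2.
Proof.
have -> : restx i = (hessxy (gloc pb i) x y - hessxy (gloc pb i) x (ys x)) *m z
   + (gradx (floc pb i) x y - gradx (floc pb i) x (ys x)) + hessxy g x (ys x) *m (z - zs x).
  by rewrite /restx /dloc_x mulmxBl opprD addrACA.
apply: le_trans (norm2D3_sqr_le _ _ _) _.
have := hxy i; have := hfx i; have := lip_sqr (hessxy_gavg_le (z - zs x)).
by rewrite -/ez /L2; lra.
Qed.

Lemma bias_le : norm2 (davg_x x y z - grad (Phi pb) x) ^+ 2 <=
  3 * L2 * ey ^+ 2 + 3 * Lg ^+ 2 * ez ^+ 2.
Proof.
have -> : davg_x x y z - grad (Phi pb) x = N%:R^-1 *: \sum_i restx i.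
  have -> : \sum_i restx i = \sum_i dloc_x i x y z - \sum_i dloc_x i x (ys x) z
      + N%:R *: (hessxy g x (ys x) *m (z - zs x)).
    by rewrite /restx big_split /= sumrB sumr_const card_ord scaler_nat.
  rewrite scalerDr scalerBr scalerA mulVf ?pnatr_eq0 -?lt0n // scale1r.
  rewrite -/(davg_x x y z) -/(davg_x x (ys x) z) (davg_xE x (ys x)) grad_Phi mulmxBr.
  move: (davg_x x y z) (hessxy g x (ys x) *m z) (hessxy g x (ys x) *m zs x) (gradx f x (ys x)).
  by move=> a b c e; apply/matrixP => k l; rewrite !mxE; ring.
exact: norm2_avg_sqr_le.
Qed.

Lemma dloc_x_le i : norm2 (dloc_x i x y z) ^+ 2 <=
  6 * rho ^+ 2 * bg ^+ 2 + 6 * bf ^+ 2 + 3 * norm2 (grad (Phi pb) x) ^+ 2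
  + 9 * L2 * ey ^+ 2 + 9 * Lg ^+ 2 * ez ^+ 2.
Proof.
have -> : dloc_x i x y z = (dloc_x i x (ys x) z - davg_x x (ys x) z) + grad (Phi pb) x + restx i.
  rewrite /restx davg_xE grad_Phi mulmxBr.
  move: (dloc_x i x y z) (dloc_x i x (ys x) z) (hessxy g x (ys x) *m z)
    (hessxy g x (ys x) *m zs x) (gradx f x (ys x)) => a b c e k.
  by apply/matrixP => l l'; rewrite !mxE; ring.
apply: le_trans (norm2D3_sqr_le _ _ _) _.
by have := hetx i; have := restx_le i; lra.
Qed.

Lemma dloc_y_le i : norm2 (grady (gloc pb i) x y) ^+ 2 <= 2 * Lg ^+ 2 * ey ^+ 2 + 2 * bg ^+ 2.
Proof.
have [_ h _ _] := het i; rewrite grady_ystar subr0 in h.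
rewrite -[grady _ x y](subrK (grady (gloc pb i) x (ys x))).
apply: le_trans (norm2D_sqr_le _ _) _.
by have := lip_sqr (grady_gloc_lip i x y (ys x)); rewrite -/ey; lra.
Qed.

Let drift_z i : norm2 (dloc_z i x y z - dloc_z i x (ys x) z) ^+ 2 <= 2 * L1 * ey ^+ 2.
Proof.
have -> : dloc_z i x y z - dloc_z i x (ys x) z =
  (hessyy (gloc pb i) x y - hessyy (gloc pb i) x (ys x)) *m z
   + (grady (floc pb i) x y - grady (floc pb i) x (ys x)).
  by rewrite /dloc_z mulmxBl opprD addrACA.
apply: le_trans (norm2D_sqr_le _ _) _.
by have := hyy i; have := hfy i; rewrite /L1; lra.
Qed.

Let davg_zstar : davg_z x (ys x) z = hessyy g x (ys x) *m (z - zs x).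
Proof.
rewrite davg_zE mulmxBr; have /eqP := hessyy_zstar x; rewrite addr_eq0 => /eqP ->.
by rewrite opprK.
Qed.

(** Unlike in [dloc_x_le] no gradient of [Phi] appears, because the averaged z-direction is zero at
    the lower-level solution. *)
Lemma dloc_z_le i : norm2 (dloc_z i x y z) ^+ 2 <=
  4 * rho ^+ 2 * bg ^+ 2 + 4 * bf ^+ 2 + 8 * L1 * ey ^+ 2 + 4 * Lg ^+ 2 * ez ^+ 2.
Proof.
pose t := dloc_z i x y z - dloc_z i x (ys x) z + hessyy g x (ys x) *m (z - zs x).
have -> : dloc_z i x y z = (dloc_z i x (ys x) z - davg_z x (ys x) z) + t.
  rewrite /t davg_zstar.
  move: (dloc_z i x y z) (dloc_z i x (ys x) z) (hessyy g x (ys x) *m _) => a b c.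
  by apply/matrixP => l l'; rewrite !mxE; ring.
apply: le_trans (norm2D_sqr_le _ _) _.
have h : norm2 t ^+ 2 <= 2 * (norm2 (dloc_z i x y z - dloc_z i x (ys x) z) ^+ 2 +
    norm2 (hessyy g x (ys x) *m (z - zs x)) ^+ 2) by exact: norm2D_sqr_le.
have := hetz i; have := drift_z i; have := lip_sqr (hessyy_le x (ys x) (z - zs x)).
by rewrite -/ez; lra.
Qed.

(** The linear step contracts at [ys x]. The drift [q] caused by [y] and the displacement of [zs]
    from [x] to the next point [x'] form the perturbation, weighted by convexity with s = t mu. *)
Lemma z_step_le x' t : 0 < t -> t * Lg <= 1 ->
  norm2 (z - t *: davg_z x y z - zs x') ^+ 2 <=
  (1 - t * mu) * ez ^+ 2
  + (t * mu)^-1 * (2 * (2 * t ^+ 2 * L1 * ey ^+ 2 + Lz ^+ 2 * norm2 (x - x') ^+ 2)).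
Proof.
move=> t0 tL; have mp := mu_gt0; have mL := mu_le_Lg.
have t1 : t * ((mu + Lg) / 2) <= 1 by apply: le_trans tL; rewrite ler_pM2l //; lra.
have s01 : 0 < t * mu <= 1.
  by rewrite mulr_gt0 //=; apply: le_trans tL; rewrite ler_pM2l.
pose q := N%:R^-1 *: \sum_i (dloc_z i x y z - dloc_z i x (ys x) z).
have qE : q = davg_z x y z - davg_z x (ys x) z by rewrite /q sumrB scalerBr.
have q2 : norm2 q ^+ 2 <= 2 * L1 * ey ^+ 2 by exact: norm2_avg_sqr_le.
have -> : z - t *: davg_z x y z - zs x' =
  ((z - zs x) - t *: (hessyy g x (ys x) *m (z - zs x))) + (- t *: q + (zs x - zs x')).
  rewrite qE -davg_zstar; move: (davg_z x y z) (davg_z x (ys x) z) (zs x) (zs x') => a b c e.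
  by apply/matrixP => l l'; rewrite !mxE; ring.
have := norm2_convex_le (- t *: q + (zs x - zs x')) s01
  (hess_contraction x (ys x) (z - zs x) (ltW t0) t1).
rewrite -/ez => h; apply: le_trans h _; rewrite lerD2l.
rewrite ler_pM2l; last by rewrite invr_gt0; case/andP: s01.
apply: le_trans (norm2D_sqr_le _ _) _; rewrite ler_pM2l // lerD //.
  by rewrite norm2Z_sqr sqrrN; have := ler_wpM2l (sqr_ge0 t) q2; lra.
apply: lip_sqr; case: asm => _ _ _ _ [[_ [_ _ h]] _]; exact: h.
Qed.

Lemma y_step_le x' t : 0 < t -> t * ((mu + Lg) / 2) <= 1 ->
  norm2 (y - t *: grady g x y - ys x') ^+ 2 <=
  (1 - t * mu) * ey ^+ 2 + (t * mu)^-1 * (Ly ^+ 2 * norm2 (x - x') ^+ 2).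
Proof.
move=> t0 t1; have mp := mu_gt0; have mL := mu_le_Lg.
have s01 : 0 < t * mu <= 1.
  by rewrite mulr_gt0 //=; apply: le_trans t1; rewrite ler_pM2l //; lra.
have -> : y - t *: grady g x y - ys x' = (y - t *: grady g x y - ys x) + (ys x - ys x').
  by rewrite addrA subrK.
have := norm2_convex_le (ys x - ys x') s01 (y_contraction x y (ltW t0) t1).
rewrite -/ey => h; apply: le_trans h _; rewrite lerD2l.
rewrite ler_pM2l; last by rewrite invr_gt0; case/andP: s01.
by apply: lip_sqr; exact: lipys.
Qed.

End State.
End Problem.

(** * Freezing an independent variable *)

Section Independence.
Context {R : realType} {d : measure_display} {Om : measurableType d}.
Context {P : probability Om R} {I : Type} {ev : I -> set (set Om)}.
Hypothesis evI : forall c, setI_closed (ev c).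
Hypothesis evT : forall c, ev c setT.
Hypothesis evm : forall c A, ev c A -> measurable A.
Hypothesis ind : mutually_independent P ev.

Definition outside (ev : I -> set (set Om)) (E : set I) : set (set Om) :=
  [set A | exists2 c, ~ E c & ev c A].

(** A pi-system generating the events outside [E]. Extending the family by [setT] off its finite
    support makes intersections of cylinders with overlapping supports cylinders again. *)
Let cylinders (E : set I) : set (set Om) :=
  [set B | exists2 s : seq {classic I}, uniq s &
    exists A : {classic I} -> set Om,
      [/\ forall x, ev x (A x), forall x, x \in s -> ~ E x,
          forall x, x \notin s -> A x = setT & B = \bigcap_(x in [set` s]) A x]].

Let cylindersI E : setI_closed (cylinders E).
Proof.
move=> _ _ [s us [A [Ae As At ->]]] [t ut [B [Be Bt Bs ->]]].
exists (undup (s ++ t)); first exact: undup_uniq.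
exists (fun x => A x `&` B x); split.
- by move=> x; apply: evI.
- by move=> x; rewrite mem_undup mem_cat => /orP[/As|/Bt].
- by move=> x; rewrite mem_undup mem_cat negb_or => /andP[/At -> /Bs ->]; rewrite setIT.
- apply/seteqP; split => [w [hA hB] x /=|w h].
    rewrite mem_undup mem_cat => _; split.
      by have [/hA//|/At ->] := boolP (x \in s).
    by have [/hB//|/Bs ->] := boolP (x \in t).
  by split=> x /= xs; have [] := h x _; rewrite //= mem_undup mem_cat xs ?orbT.
Qed.

Let prod_rule (s : seq {classic I}) (A : {classic I} -> set Om) :
  uniq s -> (forall x, ev x (A x)) ->
  P (\bigcap_(x in [set` s]) A x) = (\prod_(x <- s) P (A x))%E.
Proof.
move=> us Ae.
have := @ind (size s) (fun l => tnth (in_tuple s) l) (fun l => A (tnth (in_tuple s) l)).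
rewrite [X in _ -> _ = X](big_tnth _ _ s) => <- //; last first.
  by move=> i j; apply: (@tuple_uniqP _ _ (in_tuple s) us).
congr (P _); apply/seteqP; split => w h.
  by move=> l _; apply: h; rewrite /= mem_tnth.
move=> x /= xs; have /tnthP[l ->] : x \in in_tuple s by [].
exact: h.
Qed.

(** The finite measures P(. & B) and P(B) P(.) agree on the cylinders by the product rule, hence on
    the sigma-algebra they generate. *)
Lemma independent_outside (E : set I) c (A B : set Om) : E c ->
  <<s outside ev E >> A -> ev c B -> P (A `&` B) = (P A * P B)%E.
Proof.
move=> Ec sA eB.
have mB := evm eB.
have sub : <<s outside ev E >> `<=` <<s cylinders E >>.
  apply: sub_sigma_algebra2 => C [x Ex eC].
  exists [:: x] => //.
  exists (fun y => if pselect (y = x) then C else setT); split.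
  - by move=> y; case: pselect => [e|_] //=; rewrite e.
  - by move=> y; rewrite inE => /eqP ->.
  - by move=> y; case: pselect => // e /negP[]; rewrite e inE.
  - apply/seteqP; split => [w Cw y /=|w]; first by case: pselect.
    by move=> /(_ x (mem_head _ _)); case: pselect.
have cm : cylinders E `<=` measurable.
  move=> _ [s us [F [Fe _ _ ->]]].
  by apply: fin_bigcap_measurable => // x _; apply: evm (Fe x).
pose r := NngNum (fine_ge0 (measure_ge0 P B)).
have PBE : (r%:num%:E = P B)%E by rewrite /= fineK // fin_num_measure.
pose m1 := mrestr P mB.
pose m2 := mscale r P.
have m2E C : m2 C = (P B * P C)%E by rewrite /m2 /mscale /= -PBE.
suff : m1 A = m2 A by rewrite m2E muleC.
apply: (g_sigma_algebra_measure_unique (cylinders E) cm (fun=> setT)) => //.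
- move=> _; exists [::] => //; exists (fun=> setT); split => //.
  by rewrite set_nil bigcap_set0.
- by rewrite bigcup_const //; exists 0%N.
- move=> _ [s us [F [Fe Fs Ft ->]]].
  rewrite -[LHS]/(P (_ `&` B)) -[RHS]/(m2 _) m2E.
  (* Adjoin [B] as the event of index [c], which is not in the support because [c] lies in [E]. *)
  pose F' (x : {classic I}) := if pselect (x = c) then B else F x.
  have cs : c \notin s by apply/negP => /Fs.
  have F'F x : x \in s -> F' x = F x.
    by move=> xs; rewrite /F'; case: pselect => // xc; rewrite -xc xs in cs.
  have -> : \bigcap_(x in [set` s]) F x `&` B = \bigcap_(x in [set` (c : {classic I}) :: s]) F' x.
    have F'c : F' c = B by rewrite /F'; case: pselect.
    apply/seteqP; split => [w [h Bw] x /=|w h].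
      by rewrite in_cons => /orP[/eqP ->|xs]; [rewrite F'c|rewrite F'F //; apply: h].
    split=> [x /= xs|]; first by rewrite -F'F //; apply: h; rewrite /= in_cons xs orbT.
    by rewrite -F'c; apply: h; rewrite /= mem_head.
  rewrite prod_rule //; last 2 first.
  - by rewrite /= us andbT.
  - by move=> x; rewrite /F'; case: pselect => [e|_] //=; rewrite e.
  rewrite prod_rule // big_cons; congr (_ * _)%E.
    by rewrite /F'; case: pselect.
  by apply: eq_big_seq => x xs; rewrite F'F.
- by move=> _; rewrite -[ltLHS]/(P (_ `&` B)) setTI (le_lt_trans (probability_le1 _ _)) // ltry.
- exact: sub.
Qed.

End Independence.

(** * Joint law of the past and a fresh draw *)

Section Freezing.
Local Open Scope ereal_scope.
Context {R : realType} {d d' : measure_display} {Om : measurableType d}.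
Context {T : measurableType d'} (P : probability Om R) (mu : probability T R).
Context (G : set (set Om)) (X : Om -> T).
Hypothesis Gm : G `<=` measurable.
Hypothesis lawX : has_law P X mu.
Hypothesis indG : forall A B, <<s G >> A -> measurable B ->
  P (A `&` X @^-1` B) = (P A * P (X @^-1` B))%E.

Let GT : measurableType _ := g_sigma_algebraType G.

Lemma measurable_id_g_sigma : measurable_fun setT (id : Om -> GT).
Proof.
move=> _ A mA; rewrite setTI preimage_id.
exact: (smallest_sub (@sigma_algebra_measurable _ Om) Gm).
Qed.

(** By independence the pair (w, X w), with w seen through the smaller sigma-algebra, has a product
    law; Tonelli then integrates the fresh variable first. *)
Lemma freezing (f : (GT * T)%type -> \bar R) : measurable_fun setT f ->
  (forall p, 0 <= f p)%E ->
  (\int[P]_w f (w, X w) = \int[P]_w \int[mu]_t f (w, t))%E.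
Proof.
move=> mf f0.
pose i := HB.pack_for {mfun Om >-> GT} (id : Om -> GT)
  (isMeasurableFun.Build _ _ _ _ _ measurable_id_g_sigma).
have mpair : measurable_fun setT (fun w : Om => ((w : GT), X w)).
  apply/measurable_fun_pair; [exact: measurable_id_g_sigma|exact: lawX.1].
pose j := HB.pack_for {mfun Om >-> (GT * T)%type} (fun w : Om => ((w : GT), X w))
  (isMeasurableFun.Build _ _ _ _ _ mpair).
have E1 : (\int[P]_w f (w, X w) = \int[distribution P j]_p f p)%E.
  by rewrite ge0_integral_distribution.
have E2 : (\int[distribution P j]_p f p = \int[distribution P i \x mu]_p f p)%E.
  apply: eq_measure_integral => A mA _; apply/esym.
  apply: (@product_measure_unique _ _ _ _ _ (distribution P i) mu (distribution P j)) => //.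
  move=> A1 A2 mA1 mA2; rewrite /distribution /pushforward /= -lawX.2 // -indG //.
rewrite E1 E2 fubini_tonelli1 // /fubini_F.
rewrite [LHS](@ge0_integral_distribution _ _ _ _ _ _ i) //.
  exact: measurable_fun_fubini_tonelli_F.
by move=> w; apply: integral_ge0.
Qed.

End Freezing.

(** * Measurability and second moments *)

Section Measurability.
Context {R : realType}.

Definition mvec d (T : measurableType d) m n (X : T -> 'M[R]_(m, n)) : Prop :=
  forall i j, measurable_fun setT (fun w => X w i j).

Section MVec.
Context {d} {T : measurableType d}.

Lemma mvec_cst m n (A : 'M[R]_(m, n)) : mvec (fun _ : T => A).
Proof. by move=> i j; exact: measurable_cst. Qed.

Lemma mvecD m n (X Y : T -> 'M[R]_(m, n)) :
  mvec X -> mvec Y -> mvec (fun w => X w + Y w).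
Proof.
move=> mX mY i j; under eq_fun do rewrite mxE.
by apply: measurable_funD; [exact: mX|exact: mY].
Qed.

Lemma mvecZ m n (c : T -> R) (X : T -> 'M[R]_(m, n)) :
  measurable_fun setT c -> mvec X -> mvec (fun w => c w *: X w).
Proof.
move=> mc mX i j; under eq_fun do rewrite mxE.
by apply: measurable_funM => //; exact: mX.
Qed.

Lemma mvecZl m n (c : R) (X : T -> 'M[R]_(m, n)) :
  mvec X -> mvec (fun w => c *: X w).
Proof. by move=> mX; apply: mvecZ => //; exact: measurable_cst. Qed.

Lemma mvecN m n (X : T -> 'M[R]_(m, n)) : mvec X -> mvec (fun w => - X w).
Proof.
by move=> mX; under eq_fun do rewrite -scaleN1r; exact: mvecZl.
Qed.

Lemma mvecB m n (X Y : T -> 'M[R]_(m, n)) :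
  mvec X -> mvec Y -> mvec (fun w => X w - Y w).
Proof. by move=> mX mY; apply: mvecD => //; exact: mvecN. Qed.

Lemma mvec_sum m n (I : Type) (s : seq I) (X : I -> T -> 'M[R]_(m, n)) :
  (forall i, mvec (X i)) -> mvec (fun w => \sum_(i <- s) X i w).
Proof.
move=> mX; elim: s => [|i s IH].
  by under eq_fun do rewrite big_nil; exact: mvec_cst.
by under eq_fun do rewrite big_cons; exact: mvecD.
Qed.

Lemma mvec_mulmx m n p (X : T -> 'M[R]_(m, n)) (Y : T -> 'M[R]_(n, p)) :
  mvec X -> mvec Y -> mvec (fun w => X w *m Y w).
Proof.
move=> mX mY i j; under eq_fun do rewrite mxE.
apply: measurable_sum => k; apply: measurable_funM; [exact: mX|exact: mY].
Qed.

Lemma mvec_col_mx m n p (X : T -> 'M[R]_(m, p)) (Y : T -> 'M[R]_(n, p)) :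
  mvec X -> mvec Y -> mvec (fun w => col_mx (X w) (Y w)).
Proof.
move=> mX mY i j; case: (split_ordP i) => k ->.
  by under eq_fun do rewrite col_mxEu; exact: mX.
by under eq_fun do rewrite col_mxEd; exact: mY.
Qed.

Lemma measurable_norm2 n (X : T -> 'cV[R]_n) : mvec X ->
  measurable_fun setT (fun w => norm2 (X w)).
Proof.
move=> mX; apply: (measurableT_comp (f := @Num.sqrt R)).
  by apply: continuous_measurable_fun => x; exact: sqrt_continuous.
by apply: measurable_sum => i; apply: measurable_funX; exact: mX.
Qed.

Lemma measurable_norm2_sqr n (X : T -> 'cV[R]_n) : mvec X ->
  measurable_fun setT (fun w => norm2 (X w) ^+ 2).
Proof. by move=> mX; apply: measurable_funX; exact: measurable_norm2. Qed.

Lemma measurable_norm2_sqr_EFin n (X : T -> 'cV[R]_n) : mvec X ->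
  measurable_fun setT (fun w => (norm2 (X w) ^+ 2)%:E).
Proof. by move=> mX; apply/measurable_EFinP; exact: measurable_norm2_sqr. Qed.

End MVec.

Lemma mvec_comp d d' (T : measurableType d) (T' : measurableType d') m n
    (f : T' -> T) (X : T -> 'M[R]_(m, n)) :
  measurable_fun setT f -> mvec X -> mvec (X \o f).
Proof.
move=> mf mX i j.
exact: (measurableT_comp (f := fun w => X w i j) (mX i j) mf).
Qed.

Lemma continuous_borel_measurable n (f : 'cV[R]_n -> R) :
  continuous f -> measurable_fun setT (f : borel 'cV[R]_n -> R).
Proof.
move=> /continuousP cf.
apply: (measurability (RGenOInfty.G (R := R))).
  exact: RGenOInfty.measurableE.
move=> _ [_ [x ->] <-]; rewrite setTI; apply: sub_sigma_algebra.
by apply: cf; exact: interval_open.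
Qed.

(* Open sets are countable unions of boxes with rational centers. *)
Lemma mvec_borel d (T : measurableType d) n (X : T -> 'cV[R]_n) :
  mvec X -> measurable_fun setT (X : T -> borel 'cV[R]_n).
Proof.
move=> mX; apply: (@measurability _ _ T (borel 'cV[R]_n) setT X (@open 'cV[R]_n)) => //.
move=> _ [U oU <-]; rewrite setTI.
pose c (p : 'cV[rat]_n * nat) := map_mx ratr p.1 : 'cV[R]_n.
pose r (p : 'cV[rat]_n * nat) := p.2.+1%:R^-1 : R.
pose B p := if pselect (ball (c p) (r p) `<=` U) then ball (c p) (r p) else set0.
have -> : U = \bigcup_p B p.
  apply/seteqP; split => [x Ux|x [p _]]; last first.
    by rewrite /B; case: pselect => // pU /pU.
  move/open_nbhs_nbhs : (conj oU Ux) => /nbhs_ballP[e /= e0 eU].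
  have [k] : exists k : nat, 0 + k.+1%:R^-1 < e / 2.
    by apply: ltr_add_invr; rewrite divr_gt0.
  rewrite add0r => ke.
  have h i : exists q : rat, `|x i 0 - ratr q| < (k.+1%:R^-1 : R).
    have /rat_in_itvoo[q] : x i 0 - k.+1%:R^-1 < x i 0 + k.+1%:R^-1.
      by rewrite ltrD2l gtrN // invr_gt0.
    rewrite in_itv /= => /andP[q1 q2]; exists q.
    by rewrite ltr_distlC q1.
  pose q := \col_i projT1 (cid (h i)).
  have xq : ball (c (q, k)) (r (q, k)) x.
    split=> [|i j]; first by rewrite /r /= invr_gt0.
    rewrite !ord1 /c /= !mxE /ball /=.
    by case: cid => /= ? ?; rewrite distrC.
  exists (q, k) => //; rewrite /B; case: pselect => // -[].
  move=> y cy; apply: eU; rewrite (splitr e).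
  apply: (@ball_triangle _ _ (c (q, k))).
    by apply: le_ball (ball_sym xq); exact: ltW.
  by apply: le_ball cy; exact: ltW.
rewrite preimage_bigcup; apply: countable_bigcupT_measurable => [|p].
  exact: (countableP [set: 'cV[rat]_n * nat]).
rewrite /B; case: pselect => ?; last by rewrite preimage_set0.
have -> : X @^-1` ball (c p) (r p) =
   \bigcap_(i in [set: 'I_n]) [set w | `|c p i 0 - X w i 0| < r p].
  apply/seteqP; split => [w [_ h] i _|w h]; first exact: h.
  split=> [|i j]; first by rewrite /r invr_gt0.
  by rewrite ord1; exact: h.
apply: fin_bigcap_measurable => // i _.
have -> : [set w | `|c p i 0 - X w i 0| < r p] =
  (fun w => `|c p i 0 - X w i 0|) @^-1` `]-oo, r p[.
  by apply/seteqP; split => w /=; rewrite in_itv.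
rewrite -[_ @^-1` _]setTI.
have mn : measurable_fun setT (fun w => `|c p i 0 - X w i 0|).
  apply: (measurableT_comp (f := @Num.norm R R)); first exact: normr_measurable.
  by apply: measurable_funB => //; exact: mX.
exact: mn.
Qed.

Lemma continuous_mvec d (T : measurableType d) n (f : 'cV[R]_n -> R)
    (X : T -> 'cV[R]_n) :
  continuous f -> mvec X -> measurable_fun setT (fun w => f (X w)).
Proof.
move=> cf mX.
exact: (measurableT_comp (continuous_borel_measurable cf) (mvec_borel mX)).
Qed.

Lemma measurable_inv_max (c : R) : 0 < c ->
  measurable_fun setT (fun x : R => (Num.max c x)^-1).
Proof.
move=> c0; apply: continuous_measurable_fun => x.
apply: cvgV; first by rewrite gt_eqF // lt_max c0.
apply: (@continuous_max _ _ (cst c) id); [exact: cvg_cst|exact: cvg_id].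
Qed.

(** A pointwise limit of difference quotients with steps 1/(k+1). *)
Lemma measurable_derive d (T : measurableType d) n (h : T -> 'cV[R]_n -> R)
    (x : T -> 'cV[R]_n) (v : 'cV[R]_n) :
  (forall t : R, measurable_fun setT (fun w => h w (x w + t *: v))) ->
  (forall w, derivable (h w) (x w) v) ->
  measurable_fun setT (fun w => 'D_v (h w) (x w)).
Proof.
move=> mh dh.
apply: (@measurable_fun_cvg _ _ _ _ (fun k w =>
  (k.+1%:R^-1)^-1 * (h w (x w + k.+1%:R^-1 *: v) - h w (x w + (0:R) *: v)))).
  move=> k; apply: measurable_funM; first exact: measurable_cst.
  by apply: measurable_funB; exact: mh.
move=> w _; rewrite scale0r addr0.
have := dh w; rewrite /derivable => /cvg_ex[l hl].
have Dl : 'D_v (h w) (x w) = l by rewrite /derive; apply: cvg_lim hl.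
rewrite Dl.
have := (@cvg_comp _ _ _ (fun k : nat => k.+1%:R^-1 : R) _ \oo (0^') _ _ hl).
rewrite /comp.
rewrite /comp /shift /= => H.
rewrite [X in X @ _](_ : _ = fun k : nat => (k.+1%:R^-1)^-1 *:
    (h w (k.+1%:R^-1 *: v + x w) - h w (x w))); last first.
  by apply/funext => k; rewrite [x w + _]addrC.
apply: H => A [e /= e0 eA].
have [k] : exists k : nat, 0 + k.+1%:R^-1 < e by apply: ltr_add_invr.
rewrite add0r => ke; exists k => // j /= kj; apply: eA; last first.
  by rewrite gt_eqF // invr_gt0.
rewrite /ball /= sub0r normrN ger0_norm ?invr_ge0 //.
by apply: le_lt_trans ke; rewrite lef_pV2 ?posrE // ler_nat.
Qed.

End Measurability.

(** * Integrals of nonnegative functions and second moments *)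

Section LowerIntegral.
Context {R : realType} {d} {T : measurableType d}.
Local Open Scope ereal_scope.

(** For nonnegative integrands the integral is a supremum over simple functions below, so
    monotonicity also covers integrands not shown to be measurable, such as the squared spectral
    norm of a sampled Hessian error. *)
Lemma le_integral_ge0 (mu : {measure set T -> \bar R}) (f g : T -> \bar R) :
  (forall x, 0 <= f x) -> (forall x, f x <= g x) ->
  \int[mu]_x f x <= \int[mu]_x g x.
Proof.
move=> f0 fg; rewrite !ge0_integralTE //; last by move=> x; exact: le_trans (fg x).
apply: le_ereal_sup => _ [h hf <-]; exists h => // x.
exact: le_trans (hf x) (fg x).
Qed.

Lemma mean_sqE (P : probability T R) (X : T -> R) :
  mean_sq P X = \int[P]_w (X w ^+ 2)%:E.
Proof. by rewrite /mean_sq unlock. Qed.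

Lemma integral_prob_cst (P : probability T R) (a : R) :
  \int[P]_w a%:E = a%:E.
Proof. by have := expectation_cst P a; rewrite unlock. Qed.

End LowerIntegral.

Section SecondMoment.
Context {R : realType} {d} {T : measurableType d} (P : probability T R) (n : nat).
Variables (V : T -> 'cV[R]_n) (m : 'cV[R]_n) (b : R).
Hypothesis mV : mvec V.
Hypothesis EV : mean_mx P V m.
Hypothesis b2 : (\int[P]_t (norm2 (V t - m) ^+ 2)%:E <= b%:E)%E.

Let mVm : mvec (fun t => V t - m).
Proof. by apply: mvecB => //; exact: mvec_cst. Qed.

Let intN : P.-integrable setT (fun t => (norm2 (V t - m) ^+ 2)%:E).
Proof.
apply/integrableP; split; first exact: measurable_norm2_sqr_EFin.
rewrite (le_lt_trans _ (ltry b)) // (le_trans _ b2) //.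
by under eq_integral do rewrite gee0_abs ?lee_fin ?sqr_ge0 //.
Qed.

Lemma integrable_coord i : P.-integrable setT (fun t => (V t i 0)%:E).
Proof.
apply: (@le_integrable _ _ _ _ _ measurableT _
  (fun t => (norm2 (V t - m) ^+ 2)%:E + (1 + `|m i 0|)%:E)%E).
- exact/measurable_EFinP.
- move=> t _; rewrite -EFinD !abse_EFin lee_fin [leRHS]ger0_norm; last first.
    by rewrite !addr_ge0 // sqr_ge0.
  have := coord_le_norm2 (V t - m) i; rewrite !mxE.
  (* Gives N <= N^2 + 1/4, so the square-integrable deviation dominates the coordinate. *)
  have := sqr_ge0 (norm2 (V t - m) - 1/2).
  have := ler_normD (V t i 0 - m i 0) (m i 0); rewrite subrK.
  set N := norm2 _; set A := `|_ - _|; set B := `|V t i 0|; set C := `|m i 0|.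
  rewrite -[(N - _) ^+ 2]/((N - 1/2) * (N - 1/2)) -[N ^+ 2]/(N * N); nra.
- apply: integrableD => //.
  exact: finite_measure_integrable_cst.
Qed.

Let intV := integrable_coord.

(** Expand around [a + c *: m]; the cross term integrates to zero coordinate by coordinate. *)
Lemma second_moment_le (a : 'cV[R]_n) (c : R) :
  (\int[P]_t (norm2 (a + c *: V t) ^+ 2)%:E <=
   (norm2 (a + c *: m) ^+ 2 + c ^+ 2 * b)%:E)%E.
Proof.
pose L t := \sum_(i < n) ((2 * c * (a + c *: m) i 0) * (V t i 0 - m i 0)).
have E t : (norm2 (a + c *: V t) ^+ 2)%:E =
   ((norm2 (a + c *: m) ^+ 2)%:E + (c ^+ 2)%:E * (norm2 (V t - m) ^+ 2)%:E +
    \sum_(i < n) ((2 * c * (a + c *: m) i 0)%:E * ((V t i 0)%:E - (m i 0)%:E)))%E.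
  have -> : a + c *: V t = (a + c *: m) + c *: (V t - m).
    by rewrite scalerBr addrA addrAC addrK.
  rewrite norm2D_sqr norm2Z_sqr dotZr.
  under eq_bigr do rewrite -EFinB -EFinM.
  rewrite sumEFin -EFinM -!EFinD; congr (_%:E).
  rewrite addrAC; congr (_ + _).
  rewrite /dot mulrA big_distrr /=; apply: eq_bigr => i _; rewrite !mxE; ring.
under eq_integral do rewrite E.
have intVm i : P.-integrable setT (fun t => (2 * c * (a + c *: m) i 0)%:E *
    ((V t i 0)%:E - (m i 0)%:E))%E.
  apply: integrableZl => //; apply: integrableB => //.
  exact: finite_measure_integrable_cst.
rewrite integralD //; last 2 first.
- apply: integrableD => //; first exact: finite_measure_integrable_cst.
  exact: integrableZl.
- exact: integrable_sum.
rewrite integralD //; last 2 first.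
- exact: finite_measure_integrable_cst.
- exact: integrableZl.
rewrite integralZl // integral_prob_cst.
rewrite integral_sum // big1 ?adde0; last first.
  move=> i _; rewrite integralZl //; last first.
    by apply: integrableB => //; exact: finite_measure_integrable_cst.
  rewrite integralB //; last exact: finite_measure_integrable_cst.
  rewrite integral_prob_cst.
  by have := EV i 0; rewrite unlock => ->; rewrite subee // mule0.
rewrite EFinD; apply: leeD2l; rewrite [leRHS]EFinM.
by apply: lee_wpmul2l; first by rewrite lee_fin sqr_ge0.
Qed.
End SecondMoment.

(** * Conditional noise *)

Section Noise.
Context {R : realType} {pb : problem R} {rd : nat} {rn : randomness pb rd}.
Hypothesis fr : fresh rn.

Local Notation draws := (draw (nw pb) rd).
Local Notation ev := (@draw_events R pb rd rn).
(** The sample space with the sigma-algebra of all draws outside [E], so that being fixed by those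
    draws becomes ordinary measurability. *)
Definition sig (E : set draws) := g_sigma_algebraType (outside ev E).
HB.instance Definition _ (E : set draws) := Measurable.on (sig E).

Definition mout (E : set draws) m n (X : Om rn -> 'M[R]_(m, n)) : Prop :=
  mvec (X : sig E -> 'M[R]_(m, n)).

Definition esq n (X : Om rn -> 'cV[R]_n) : \bar R :=
  (\int[Pr rn]_w (norm2 (X w) ^+ 2)%:E)%E.

Lemma esq_ge0 n (X : Om rn -> 'cV[R]_n) : (0 <= esq X)%E.
Proof. by apply: integral_ge0 => w _; rewrite lee_fin sqr_ge0. Qed.
Hint Resolve esq_ge0 : core.

Let ev_preimage c : exists d (T : measurableType d) (X : Om rn -> T),
  measurable_fun setT X /\ ev c = preimage_set_system setT X measurable.
Proof.
case: c => k i r; have [h1 h2 h3 h4 h5] := fr.1 k i r.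
- by eexists; eexists; exists (phi rn k i r); split; [exact: h1.1|].
- by eexists; eexists; exists (xi rn k i r); split; [exact: h2.1|].
- by eexists; eexists; exists (seedx rn k i r); split; [exact: h3.1|].
- by eexists; eexists; exists (seedy rn k i r); split; [exact: h4.1|].
- by eexists; eexists; exists (seedz rn k i r); split; [exact: h5.1|].
Qed.

Let evI c : setI_closed (ev c).
Proof.
have [d [T [X [mX ->]]]] := ev_preimage c.
move=> _ _ [A mA <-] [B mB <-]; exists (A `&` B); first exact: measurableI.
by rewrite !setTI preimage_setI.
Qed.

Let evT c : ev c setT.
Proof.
have [d [T [X [mX ->]]]] := ev_preimage c.
by exists setT => //; rewrite preimage_setT setTI.
Qed.

Let evm c A : ev c A -> measurable A.
Proof.
have [d [T [X [mX ->]]]] := ev_preimage c.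
by move=> [B mB <-]; exact: mX.
Qed.

Lemma outside_measurable E : outside ev E `<=` measurable.
Proof. by move=> A [c _ /evm]. Qed.

Lemma measurable_sig E d (U : measurableType d) (f : Om rn -> U) :
  measurable_fun setT (f : sig E -> U) -> measurable_fun setT f.
Proof.
move=> mf.
exact: (measurableT_comp mf (measurable_id_g_sigma (@outside_measurable E))).
Qed.

Lemma mout_mvec E m n (X : Om rn -> 'M[R]_(m, n)) : mout E X -> mvec X.
Proof. by move=> h i j; apply: (@measurable_sig E); exact: h. Qed.

Lemma sig_mono E E' d (U : measurableType d) (f : Om rn -> U) : E `<=` E' ->
  measurable_fun setT (f : sig E' -> U) -> measurable_fun setT (f : sig E -> U).
Proof.
move=> EE' mf _ A mA; have := mf measurableT A mA.
apply: sub_sigma_algebra2 => B [c Ec eB]; exists c => //.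
by move=> /EE'.
Qed.

Lemma mout_mono E E' m n (X : Om rn -> 'M[R]_(m, n)) : E `<=` E' ->
  mout E' X -> mout E X.
Proof. by move=> EE' h i j; apply: (sig_mono EE'); exact: h. Qed.

Lemma draw_measurable E c d (T : measurableType d) (X : Om rn -> T) :
  ev c = preimage_set_system setT X measurable -> ~ E c ->
  measurable_fun setT (X : sig E -> T).
Proof.
move=> evc Ec _ A mA; apply: sub_sigma_algebra; exists c => //.
by rewrite evc; exists A.
Qed.

(* [X] has conditional mean [m] and total conditional variance at most [B],
   given all draws outside [E]; the phrasing through second moments avoids
   conditional expectations. *)
Definition noisy (E : set draws) n (X m : Om rn -> 'cV[R]_n) (B : \bar R) : Prop :=
  forall a c, mout E a ->
    (esq (fun w => a w + c *: X w)%R <=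
     esq (fun w => a w + c *: m w)%R + (c ^+ 2)%:E * B)%E.

Lemma noisy_draw c d (T : measurableType d) (X : Om rn -> T)
    (mu : probability T R) n (V : Om rn -> T -> 'cV[R]_n) m (b : Om rn -> R) :
  ev c = preimage_set_system setT X measurable ->
  has_law (Pr rn) X mu ->
  mvec (fun p : sig [set c] * T => V p.1 p.2) ->
  mout [set c] m -> measurable_fun setT (b : sig [set c] -> R) ->
  (forall w, mean_mx mu (V w) (m w)) ->
  (forall w, mean_sq mu (fun t => norm2 (V w t - m w)) <= (b w)%:E)%E ->
  noisy [set c] (fun w => V w (X w)) m (\int[Pr rn]_w (b w)%:E)%E.
Proof.
move=> evc lawX mV mm mb EV b2 a k ma.
pose f (p : sig [set c] * T) := (norm2 (a p.1 + k *: V p.1 p.2) ^+ 2)%:E.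
have mf : measurable_fun setT f.
  apply: measurable_norm2_sqr_EFin; apply: mvecD; last exact: mvecZl.
  exact: (mvec_comp (f := fst) measurable_fst ma).
have b0 w : 0 <= b w.
  by rewrite -lee_fin (le_trans _ (b2 w)) // mean_sqE integral_ge0 // => t _;
     rewrite lee_fin sqr_ge0.
have -> : esq (fun w => a w + k *: V w (X w)) = (\int[Pr rn]_w f (w, X w))%E by [].
rewrite (@freezing _ _ _ _ _ (Pr rn) mu (outside ev [set c]) X) //; last 3 first.
- exact: outside_measurable.
- move=> A B sA mB; apply: (independent_outside evI evT evm fr.2 (E := [set c])) => //.
  by rewrite evc; exists B; rewrite // setTI.
- by move=> p; rewrite lee_fin sqr_ge0.
have mN : measurable_fun setT (fun w => (norm2 (a w + k *: m w) ^+ 2)%:E).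
  apply: measurable_norm2_sqr_EFin; apply: (mout_mvec (E := [set c])).
  by apply: mvecD => //; exact: mvecZl.
have mb' : measurable_fun setT b by exact: (measurable_sig mb).
rewrite /esq -ge0_integralZl_EFin ?sqr_ge0 //; last 2 first.
- by move=> w _; rewrite lee_fin.
- exact/measurable_EFinP.
rewrite -ge0_integralD //; last 3 first.
- by move=> w _; rewrite lee_fin sqr_ge0.
- by move=> w _; rewrite mule_ge0 // lee_fin // sqr_ge0.
- by apply: measurable_funeM; exact/measurable_EFinP.
apply: le_integral_ge0 => w.
  by apply: integral_ge0 => t _; rewrite lee_fin sqr_ge0.
have mVw : mvec (V w).
  move=> i j.
  exact: (measurableT_comp (mV i j) (pair1_measurable (w : sig [set c]))).
have bw : (\int[mu]_t (norm2 (V w t - m w) ^+ 2)%:E <= (b w)%:E)%E.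
  by have := b2 w; rewrite mean_sqE.
by have := second_moment_le mVw (EV w) bw (a w) k; rewrite EFinD [((_ * b w)%R%:E)%E]EFinM.
Qed.

Lemma eq_noisy E n (X X' m m' : Om rn -> 'cV[R]_n) B :
  X =1 X' -> m =1 m' -> noisy E X m B -> noisy E X' m' B.
Proof. by move=> /funext <- /funext <-. Qed.

Lemma noisyZ E n (X m : Om rn -> 'cV[R]_n) B c0 : noisy E X m B ->
  noisy E (fun w => c0 *: X w) (fun w => c0 *: m w) ((c0 ^+ 2)%:E * B).
Proof.
move=> h a c ma; have := h a (c * c0) ma.
rewrite exprMn EFinM muleA.
by under [in X in (X <= _)%E -> _]eq_fun do rewrite -scalerA;
   under [in X in (_ <= X + _)%E -> _]eq_fun do rewrite -scalerA.
Qed.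

Lemma noisy_mono E E' n (X m : Om rn -> 'cV[R]_n) B : E `<=` E' ->
  noisy E X m B -> noisy E' X m B.
Proof. by move=> EE' h a c ma; apply: h; exact: mout_mono ma. Qed.

(** Two exchanges in order: [X'] is replaced by its mean while [X] counts as part of the shift, then
    [X] while [m'] does. Hence the two asymmetric measurability conditions. *)
Lemma noisyD E E' n (X X' m m' : Om rn -> 'cV[R]_n) B B' :
  (0 <= B)%E -> (0 <= B')%E ->
  noisy E X m B -> noisy E' X' m' B' -> mout E' X -> mout E m' ->
  noisy (E `|` E') (fun w => X w + X' w) (fun w => m w + m' w) (B + B').
Proof.
move=> B0 B'0 h h' mX mm' a c ma.
under [X in (esq X <= _)%E]eq_fun do rewrite scalerDr addrA.
apply: (le_trans (h' (fun w => a w + c *: X w) c _)).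
  apply: mvecD; last exact: mvecZl.
  by apply: mout_mono ma; exact: subsetUr.
rewrite ge0_muleDr // addeA; apply: leeD2r.
under [X in (esq X <= _)%E]eq_fun do rewrite addrAC.
under [X in (_ <= esq X + _)%E]eq_fun do rewrite scalerDr addrA addrAC.
apply: (h (fun w => a w + c *: m' w) c); apply: mvecD; last exact: mvecZl.
by apply: mout_mono ma; exact: subsetUl.
Qed.

Lemma noisy_cst E n (X : Om rn -> 'cV[R]_n) : noisy E X X 0%E.
Proof. by move=> a c _; rewrite mule0 adde0. Qed.

Lemma noisy_sum (I : eqType) (s : seq I) F (E : I -> set draws) n
    (X m : I -> Om rn -> 'cV[R]_n) B : uniq s ->
  (forall i, 0 <= B i)%E ->
  (forall i, E i `<=` F) -> (forall i, mout F (m i)) ->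
  (forall i, noisy (E i) (X i) (m i) (B i)) ->
  (forall i j, i != j -> mout (E j) (X i)) ->
  noisy [set c | exists2 i, i \in s & E i c] (fun w => \sum_(i <- s) X i w)
    (fun w => \sum_(i <- s) m i w) (\sum_(i <- s) B i)%E.
Proof.
move=> us B0 EF mm h mX.
elim: s us => [_|i s IH /= /andP[ins us]].
  rewrite big_nil; apply: (@eq_noisy _ _ (fun=> 0) _ (fun=> 0)).
  - by move=> w; rewrite big_nil.
  - by move=> w; rewrite big_nil.
  - exact: noisy_cst.
rewrite big_cons addeC.
apply: (@eq_noisy _ _ (fun w => \sum_(j <- s) X j w + X i w) _
                      (fun w => \sum_(j <- s) m j w + m i w)).
- by move=> w; rewrite big_cons addrC.
- by move=> w; rewrite big_cons addrC.
have sub : [set c | exists2 j, j \in s & E j c] `<=` F by move=> c [j _ /EF].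
apply: (@noisy_mono (E i `|` [set c | exists2 j, j \in s & E j c])).
  move=> c [Ei|[j js Ej]]; first by exists i => //; rewrite mem_head.
  by exists j => //; rewrite in_cons js orbT.
have mXs : mout (E i) (fun w => \sum_(j <- s) X j w).
  (* Since [i] is not in [s] the sum is unchanged, and each summand is now measurable outside [E i]
     for every index. *)
  rewrite (_ : (fun w => _) = fun w => \sum_(j <- s) (if j == i then 0 else X j w)).
    apply: mvec_sum => j; have [ji|ji] := eqVneq j i; first exact: mvec_cst.
    exact: mX.
  apply/funext => w; apply: eq_big_seq => j js.
  by case: eqP => // ji; rewrite -ji js in ins.
rewrite setUC.
apply: noisyD => //; last 3 first.
- by apply: sume_ge0 => j _; exact: B0.
- exact: IH.
- exact: (mout_mono sub).
Qed.

(* Two successive layers of noise: the variance of the outer layer is relative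
   to the second moment of the inner one. *)
Lemma noisy_comp E E' n (X Y m : Om rn -> 'cV[R]_n) B t : (0 <= B)%E -> 0 <= t ->
  noisy E' X Y (t%:E * esq Y) -> noisy E Y m B ->
  noisy (E `|` E') X m (B + t%:E * (esq m + B))%E.
Proof.
move=> B0 t0 h h' a c ma.
apply: (le_trans (h a c _)); first by apply: mout_mono ma; exact: subsetUr.
have t0' : (0 <= t%:E)%E by rewrite lee_fin.
rewrite (ge0_muleDr _ B0 (mule_ge0 t0' (adde_ge0 (esq_ge0 m) B0))).
rewrite addeA; apply: leeD.
  by apply: h'; apply: mout_mono ma; exact: subsetUl.
apply: lee_wpmul2l; first by rewrite lee_fin sqr_ge0.
apply: lee_wpmul2l => //.
have := h' (fun=> 0) 1 (mvec_cst _); rewrite expr1n mul1e.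
under eq_fun do rewrite add0r scale1r.
by under [X in (_ <= esq X + _)%E -> _]eq_fun do rewrite add0r scale1r.
Qed.

(** * Noise of multi-step compression *)

Section MultiStep.
Variables (d : nat) (om : R) (C : random_map R d).
Hypothesis uC : unbiased_compressor om C.
Variables (dr : 'I_rd -> draws) (sd : 'I_rd -> Om rn -> seed C).
Hypothesis drE : forall r, ev (dr r) = preimage_set_system setT (sd r) measurable.
Hypothesis drI : injective dr.
Hypothesis sdL : forall r, has_law (Pr rn) (sd r) (seed_law C).

Let q := om / (1 + om).
Let rounds (V : Om rn -> 'cV[R]_d) (s : seq 'I_rd) (w : Om rn) :=
  foldl (fun u r => u + (1 + om)^-1 *: rmap (V w - u) (sd r w)) 0 s.
Definition seeds_of (s : seq 'I_rd) : set draws := [set c | exists2 r, r \in s & c = dr r].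

Let om0 : 0 <= om. Proof. by case: uC. Qed.
Let om1 : 1 + om != 0. Proof. by rewrite gt_eqF // ltr_wpDr. Qed.
Let q0 : 0 <= q. Proof. by rewrite divr_ge0 // addr_ge0. Qed.
Let q1 : q < 1. Proof. by rewrite ltr_pdivrMr ?mul1r ?ltrDr // ltr_wpDr. Qed.
Let qE : 1 - (1 + om)^-1 = q. Proof. by rewrite /q; field. Qed.

Lemma measurable_rmap e (T : measurableType e) (u : T -> 'cV[R]_d) (s : T -> seed C) :
  mvec u -> measurable_fun setT s -> mvec (fun p => rmap (u p) (s p)).
Proof.
move=> mu ms i j; rewrite ord1; have [_ mC _ _] := uC.
apply: (measurableT_comp (mC i) (g := fun p => ((u p : borel 'cV[R]_d), s p))).
by apply/measurable_fun_pair => //; exact: mvec_borel.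
Qed.

Lemma mout_rounds E (V : Om rn -> 'cV[R]_d) s : mout E V ->
  (forall r, r \in s -> ~ E (dr r)) -> mout E (rounds V s).
Proof.
move=> mV; elim/last_ind: s => [|s r IH] h; first exact: mvec_cst.
rewrite /mout /rounds; under eq_fun do rewrite -cats1 foldl_cat /=.
have mu : mout E (rounds V s) by apply: IH => r' rs; apply: h; rewrite mem_rcons in_cons rs orbT.
apply: mvecD; first exact: mu.
apply: mvecZl; apply: measurable_rmap; first exact: mvecB.
by apply: draw_measurable (drE r) _; apply: h; rewrite mem_rcons mem_head.
Qed.

Lemma mout_msc E (V : Om rn -> 'cV[R]_d) : mout E V -> (forall r, ~ E (dr r)) ->
  mout E (fun w => msc om (V w) (fun r => sd r w)).
Proof. by move=> mV h; apply: mvecZl; apply: (@mout_rounds E V (enum 'I_rd)). Qed.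

(** One round sends the residual e to e - C(e)/(1 + om), with mean q e and variance at most om/(1 +
    om)^2 |e|^2 = q (1 - q) |e|^2. *)
Let noisy_round (e : Om rn -> 'cV[R]_d) r :
  mout [set dr r] e ->
  noisy [set dr r] (fun w => e w - (1 + om)^-1 *: rmap (e w) (sd r w))
    (fun w => q *: e w) ((q * (1 - q))%:E * esq e).
Proof.
move=> me; have [_ _ mC vC] := uC.
have mN : measurable_fun setT (fun w : sig [set dr r] => norm2 (e w) ^+ 2).
  exact: measurable_norm2_sqr.
have h : noisy [set dr r] (fun w => rmap (e w) (sd r w)) e (om%:E * esq e).
  rewrite [(_ * esq e)%E](_ : _ = (\int[Pr rn]_w (om * norm2 (e w) ^+ 2)%:E)%E); last first.
    rewrite /esq; under [RHS]eq_integral do rewrite EFinM.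
    rewrite ge0_integralZl_EFin //.
    - by move=> w _; rewrite lee_fin sqr_ge0.
    - by apply/measurable_EFinP; exact: (measurable_sig mN).
  apply: (noisy_draw (V := fun w t => rmap (e w) t) (drE r) (sdL r)) => //.
  - apply: measurable_rmap; last exact: measurable_snd.
    exact: (mvec_comp (f := fst) measurable_fst me).
  - by apply: measurable_funM => //; exact: measurable_cst.
move=> a c ma.
have := h (fun w => a w + c *: e w) (- (c * (1 + om)^-1)) _.
have -> : (((- (c * (1 + om)^-1)) ^+ 2)%:E * (om%:E * esq e) =
   (c ^+ 2)%:E * ((q * (1 - q))%:E * esq e))%E.
  rewrite !muleA -!EFinM; congr (_%:E * _)%E; rewrite /q; field.
  exact: om1.
rewrite (_ : (fun w => _ + _ *: rmap _ _) =
  fun w => a w + c *: (e w - (1 + om)^-1 *: rmap (e w) (sd r w))); last first.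
  by apply/funext => w; rewrite scalerBr scalerA scaleNr addrA.
rewrite (_ : (fun w => a w + c *: e w + _ *: e w) =
  fun w => a w + c *: (q *: e w)); last first.
  by apply/funext => w; rewrite -addrA -scalerDl -qE scalerA mulrBr mulr1.
by apply; apply: mvecD => //; exact: mvecZl.
Qed.

(** The second moment of the residual shrinks by q^2 + q (1 - q) = q per round while its mean
    shrinks by q, which leaves the variance q^s - q^(2 s). *)
Let noisy_rounds (V : Om rn -> 'cV[R]_d) s : uniq s -> mout (seeds_of s) V ->
  noisy (seeds_of s) (fun w => V w - rounds V s w) (fun w => q ^+ size s *: V w)
    ((q ^+ size s - (q ^+ size s) ^+ 2)%:E * esq V).
Proof.
elim/last_ind: s => [|s r IH] us mV.
  rewrite expr0 expr1n subrr mul0e.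
  apply: (@eq_noisy _ _ V _ V); last exact: noisy_cst.
  - by move=> w; rewrite subr0.
  - by move=> w; rewrite scale1r.
move: us; rewrite rcons_uniq => /andP[rs us].
pose e w := V w - rounds V s w.
have sub : seeds_of s `<=` seeds_of (rcons s r).
  by move=> c [r' r's ->]; exists r' => //; rewrite mem_rcons in_cons r's orbT.
have subr : [set dr r] `<=` seeds_of (rcons s r).
  by move=> c /= ->; exists r => //; rewrite mem_rcons mem_head.
have me : mout [set dr r] e.
  apply: mvecB; first exact: mout_mono mV.
  apply: mout_rounds; first exact: mout_mono mV.
  by move=> r' r's /= /drI r'r; rewrite -r'r r's in rs.
have he := IH us (mout_mono sub mV).
move=> a c ma.
have mas : mout (seeds_of s) a by exact: mout_mono ma.
rewrite (_ : (fun w => _) = fun w => a w + c *: (e w - (1 + om)^-1 *: rmap (e w) (sd r w))); last first.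
  apply/funext => w; congr (_ + _ *: _).
  by rewrite /rounds -cats1 foldl_cat /= -/(rounds V s w) opprD addrA.
apply: (le_trans (noisy_round me _ _)); first exact: mout_mono ma.
rewrite (_ : (fun w => _) = fun w => a w + (c * q) *: e w); last first.
  by apply/funext => w; rewrite scalerA.
have h1 := he a (c * q) mas.
have := he (fun=> 0) 1 (mvec_cst _); rewrite expr1n mul1e.
rewrite (_ : (fun w => 0 + 1 *: (V w - rounds V s w)) = e); last first.
  by apply/funext => w; rewrite add0r scale1r.
have -> : esq (fun w => 0 + 1 *: (q ^+ size s *: V w)) =
    (((q ^+ size s) ^+ 2)%:E * esq V)%E.
  rewrite /esq; under eq_integral do rewrite add0r scale1r norm2Z_sqr EFinM.
  rewrite ge0_integralZl_EFin ?sqr_ge0 //.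
  - by move=> w _; rewrite lee_fin sqr_ge0.
  - by apply: measurable_norm2_sqr_EFin; exact: mout_mvec mV.
have qs : 0 <= (q ^+ size s) ^+ 2 by exact: sqr_ge0.
have qs1 : q ^+ size s <= 1 by rewrite exprn_ile1 // ltW.
have qs0 : 0 <= q ^+ size s by rewrite exprn_ge0.
have q10 : 0 <= 1 - q by rewrite subr_ge0 ltW.
have qs2 : 0 <= q ^+ size s - (q ^+ size s) ^+ 2.
  by rewrite expr2 -{1}[q ^+ size s]mulr1 -mulrBr mulr_ge0 // subr_ge0.
(* Squared mean plus variance: the second moment of the residual is at most q^s times that of [V];
   the noise of the next round is relative to it. *)
rewrite -ge0_muleDl ?lee_fin // -EFinD subrKC => h2.
apply: (le_trans (leeD h1 (lee_wpmul2l _ (lee_wpmul2l _ h2)))).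
- by rewrite lee_fin sqr_ge0.
- by rewrite lee_fin mulr_ge0 // subr_ge0 ltW.
rewrite (_ : (fun w => a w + (c * q) *: _) =
   fun w => a w + c *: (q ^+ size (rcons s r) *: V w)); last first.
  by apply/funext => w; rewrite size_rcons exprS !scalerA mulrA.
rewrite -addeA; apply: leeD2l.
rewrite !muleA -!EFinM -ge0_muleDl ?lee_fin; last 2 first.
- by rewrite mulr_ge0 // sqr_ge0.
- by apply: mulr_ge0 => //; apply: mulr_ge0; [exact: sqr_ge0|exact: mulr_ge0].
rewrite -EFinD size_rcons [q ^+ _.+1]exprS le_eqVlt; apply/orP; left; apply/eqP.
by congr (_%:E * _)%E; ring.
Qed.

Lemma noisy_msc (V : Om rn -> 'cV[R]_d) : (0 < rd)%N ->
  mout (seeds_of (enum 'I_rd)) V ->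
  noisy (seeds_of (enum 'I_rd)) (fun w => msc om (V w) (fun r => sd r w)) V
    ((om_msc om rd)%:E * esq V).
Proof.
move=> rd0 mV a c ma.
have := noisy_rounds (enum_uniq _) mV; rewrite size_enum_ord => h.
pose k := 1 - q ^+ rd.
have k0 : 0 < k by rewrite subr_gt0 exprn_ilt1 // -lt0n.
(* The output is (V - residual)/k, so the residual gets the coefficient -c/k and [V] joins the
   shift. *)
have := h (fun w => a w + (c / k) *: V w) (- (c / k)) _.
rewrite (_ : (fun w => _ + _ *: (_ - _)) =
  fun w => a w + c *: msc om (V w) (fun r => sd r w)); last first.
  apply/funext => w; rewrite /msc -/q -/k scalerA -/(rounds V (enum 'I_rd) w).
  by rewrite -addrA; congr (_ + _); rewrite scaleNr scalerBr opprB addrCA subrr addr0.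
rewrite (_ : (fun w => a w + _ *: V w + _ *: (_ *: V w)) =
  fun w => a w + c *: V w); last first.
  apply/funext => w; rewrite -addrA scalerA -scalerDl; congr (_ + _ *: _).
  by rewrite mulNr -{1}[c / k]mulr1 -mulrBr divfK // gt_eqF.
move=> H; apply: (le_trans (H _)).
  by apply: mvecD => //; exact: mvecZl.
apply: leeD2l; rewrite !muleA -!EFinM; apply: lee_wpmul2r => //.
rewrite lee_fin sqrrN exprMn -mulrA ler_wpM2l ?sqr_ge0 //.
(* The variance factor is thus q^rd / k; it is at most om q^(rd - 1) because q = (1 - q) om and 1 -
   q <= k. *)
have -> : q ^+ rd - (q ^+ rd) ^+ 2 = q ^+ rd * k by rewrite /k; ring.
rewrite exprVn expr2 invfM -mulrA [q ^+ rd * k]mulrC mulKf ?gt_eqF //.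
rewrite ler_pdivrMl // /om_msc -/q.
have -> : q ^+ rd = q ^+ rd.-1 * q by rewrite -exprSr prednK.
rewrite [k * _]mulrA [k * om * _]mulrC ler_wpM2l ?exprn_ge0 //.
have {1}-> : q = (1 - q) * om by rewrite /q; field.
apply: ler_wpM2r => //; rewrite /k lerD2l lerN2 -{2}[q]expr1.
by apply: ler_wiXn2l => //; exact: ltW.
Qed.

End MultiStep.
End Noise.

(** * Measurability of the stochastic derivatives *)

Section LipschitzMeasurable.
Context {R : realType}.

Lemma lip_continuous d (f : 'cV[R]_d -> R) L :
  (forall u v, `|f u - f v| <= L * norm2 (u - v)) -> continuous f.
Proof.
move=> lip y B /nbhs_ballP[e /= e0 eB].
have L0 : 0 < `|L| + 1 by rewrite ltr_wpDl.
have d0 : 0 < (d%:R + 1 : R) by rewrite ltr_wpDl.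
pose r := e / (`|L| + 1) / (d%:R + 1).
have r0 : 0 < r by rewrite !divr_gt0.
apply/nbhs_ballP; exists r => // v [_ yv]; apply: eB; rewrite /ball /=.
apply: (le_lt_trans (lip _ _)).
have h : norm2 (y - v) <= d%:R * r.
  by apply: norm2_le_coord => j; rewrite !mxE; apply: ltW; exact: (yv j 0).
apply: (@le_lt_trans _ _ ((`|L| + 1) * (d%:R * r))).
  apply: le_trans (_ : (`|L| + 1) * norm2 (y - v) <= _).
    by rewrite ler_wpM2r // (le_trans (ler_norm _)) // lerDl.
  by rewrite ler_wpM2l // ltW.
have -> : (`|L| + 1) * (d%:R * r) = e * (d%:R / (d%:R + 1)).
  by rewrite /r; field; rewrite !gt_eqF.
by rewrite gtr_pMr // ltr_pdivrMr // mul1r ltrDl.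
Qed.

Lemma lip_measurable e (T : measurableType e) d (f : 'cV[R]_d -> R) L (X : T -> 'cV[R]_d) :
  (forall u v, `|f u - f v| <= L * norm2 (u - v)) -> mvec X ->
  measurable_fun setT (fun w => f (X w)).
Proof. by move=> /lip_continuous; exact: continuous_mvec. Qed.

Lemma lip2_measurable e (T : measurableType e) m n (f : 'cV[R]_m -> 'cV[R]_n -> R) L
    (X : T -> 'cV[R]_m) (Y : T -> 'cV[R]_n) :
  (forall x y x' y', `|f x y - f x' y'| <= L * norm2 (col_mx (x - x') (y - y'))) ->
  mvec X -> mvec Y -> measurable_fun setT (fun w => f (X w) (Y w)).
Proof.
move=> lip mX mY.
have := @lip_measurable _ T (m + n) (fun v => f (usubmx v) (dsubmx v)) L
  (fun w => col_mx (X w) (Y w)).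
under [X in _ -> _ -> measurable_fun _ X]eq_fun do rewrite col_mxKu col_mxKd.
apply; last exact: mvec_col_mx.
by move=> u v; apply: le_trans (lip _ _ _ _) _; rewrite -!linearB vsubmxK.
Qed.

Lemma lip1_mvec e (T : measurableType e) m n (h : 'cV[R]_m -> 'cV[R]_n) L (X : T -> 'cV[R]_m) :
  lipschitz1 L h -> mvec X -> mvec (fun w => h (X w)).
Proof.
move=> lip mX i j; rewrite ord1.
apply: (lip_measurable (f := fun v => h v i 0) (L := L)) => // u v.
by apply: le_trans (lip u v); have := coord_le_norm2 (h u - h v) i; rewrite !mxE.
Qed.

Lemma entry_le_specnorm m n (A : 'M[R]_(m, n)) i j : `|A i j| <= specnorm A.
Proof.
have := specnormP A (delta_mx j 0); rewrite -colE.
have -> : norm2 (delta_mx j 0 : 'cV[R]_n) = 1.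
  by rewrite norm2_dot dot_delta mxE !eqxx sqrtr1.
by rewrite mulr1; apply: le_trans; have := coord_le_norm2 (col j A) i; rewrite mxE.
Qed.

Lemma lip2_mvec_spec e (T : measurableType e) m n p q (h : 'cV[R]_m -> 'cV[R]_n -> 'M[R]_(p, q)) L
    (X : T -> 'cV[R]_m) (Y : T -> 'cV[R]_n) :
  lipschitz2 (@specnorm R p q) L h -> mvec X -> mvec Y -> mvec (fun w => h (X w) (Y w)).
Proof.
move=> lip mX mY i j.
apply: (lip2_measurable (f := fun x y => h x y i j) (L := L)) => // x y x' y'.
by apply: le_trans (lip x y x' y'); have := entry_le_specnorm (h x y - h x' y') i j; rewrite !mxE.
Qed.

Lemma lip2_mvec e (T : measurableType e) m n p (h : 'cV[R]_m -> 'cV[R]_n -> 'cV[R]_p) L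
    (X : T -> 'cV[R]_m) (Y : T -> 'cV[R]_n) :
  lipschitz2 (@norm2 R p) L h -> mvec X -> mvec Y -> mvec (fun w => h (X w) (Y w)).
Proof.
move=> lip mX mY i j; rewrite ord1.
apply: (lip2_measurable (f := fun x y => h x y i 0) (L := L)) => // x y x' y'.
by apply: le_trans (lip x y x' y'); have := coord_le_norm2 (h x y - h x' y') i; rewrite !mxE.
Qed.

End LipschitzMeasurable.

(** * Measurability of derivatives at random points with random samples *)

Section ParametricDerivatives.
Context {R : realType} {m n : nat} {d} {S : measurableType d}.
Variable (F : 'cV[R]_m -> 'cV[R]_n -> S -> R).
Hypothesis mF : measurable_fun setT
  (fun p : borel 'cV[R]_m * borel 'cV[R]_n * S => F p.1.1 p.1.2 p.2).
Context {e} {T : measurableType e}.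
Variables (X : T -> 'cV[R]_m) (Y : T -> 'cV[R]_n) (s : T -> S).
Hypothesis mX : mvec X.
Hypothesis mY : mvec Y.
Hypothesis ms : measurable_fun setT s.

Lemma measurable_param (X' : T -> 'cV[R]_m) (Y' : T -> 'cV[R]_n) : mvec X' -> mvec Y' ->
  measurable_fun setT (fun w => F (X' w) (Y' w) (s w)).
Proof.
move=> mX' mY'.
apply: (measurableT_comp mF (g := fun w => ((X' w : borel 'cV[R]_m), (Y' w : borel 'cV[R]_n), s w))).
apply/measurable_fun_pair => //; apply/measurable_fun_pair; exact: mvec_borel.
Qed.

Section First.
Hypothesis sm : forall t, smooth1 (fun x y => F x y t).

Lemma measurable_gradx : mvec (fun w => gradx (fun x y => F x y (s w)) (X w) (Y w)).
Proof.
move=> i j; under eq_fun do rewrite mxE.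
apply: (measurable_derive (h := fun w x' => F x' (Y w) (s w))) => [t|w].
  by apply: measurable_param => //; apply: mvecD => //; exact: mvec_cst.
by have [] := hasgrad_is_derive (delta_mx i 0) (smooth1_gradx (X w) (Y w) (sm (s w))).
Qed.

Lemma measurable_grady (X' : T -> 'cV[R]_m) (Y' : T -> 'cV[R]_n) : mvec X' -> mvec Y' ->
  mvec (fun w => grady (fun x y => F x y (s w)) (X' w) (Y' w)).
Proof.
move=> mX' mY' i j; under eq_fun do rewrite mxE.
apply: (measurable_derive (h := fun w y' => F (X' w) y' (s w))) => [t|w].
  by apply: measurable_param => //; apply: mvecD => //; exact: mvec_cst.
by have [] := hasgrad_is_derive (delta_mx i 0) (smooth1_grady (X' w) (Y' w) (sm (s w))).
Qed.
End First.

Hypothesis sm : forall t, smooth2 (fun x y => F x y t).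
Let sm1 t : smooth1 (fun x y => F x y t). Proof. by have [] := sm t. Qed.

Lemma measurable_hessxy : mvec (fun w => hessxy (fun x y => F x y (s w)) (X w) (Y w)).
Proof.
move=> i j; under eq_fun do rewrite mxE.
apply: (measurable_derive (h := fun w x' => grady_coord (fun x y => F x y (s w)) j x' (Y w))) => [t|w].
  by apply: measurable_grady => //; apply: mvecD => //; exact: mvec_cst.
by have [] := hasgrad_is_derive (delta_mx i 0)
  (smooth1_gradx (X w) (Y w) (smooth2_coord j (sm (s w)))).
Qed.

Lemma measurable_hessyy : mvec (fun w => hessyy (fun x y => F x y (s w)) (X w) (Y w)).
Proof.
move=> i j; under eq_fun do rewrite mxE.
apply: (measurable_derive (h := fun w y' => grady_coord (fun x y => F x y (s w)) j (X w) y')) => [t|w].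
  by apply: measurable_grady => //; apply: mvecD => //; exact: mvec_cst.
by have [] := hasgrad_is_derive (delta_mx i 0)
  (smooth1_grady (X w) (Y w) (smooth2_coord j (sm (s w)))).
Qed.

End ParametricDerivatives.

(** * Mean and variance of a random matrix applied to a vector *)

Section MeanMulmx.
Context {R : realType} {d} {T : measurableType d} (P : probability T R) {m n : nat}.
Variables (X : T -> 'M[R]_(m, n)) (A : 'M[R]_(m, n)) (s2 : R).
Hypothesis mX : mvec X.
Hypothesis EX : mean_mx P X A.
Hypothesis X2 : (mean_sq P (fun t => specnorm (X t - A)) <= (s2 ^+ 2)%:E)%E.

(** The factor |z|^2 is pulled out of the measurable integrand |X z - A z|^2, so that the spectral
    norm is met only through monotonicity of the integral. *)
Lemma mean_sq_mulmx (z : 'cV[R]_n) :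
  (mean_sq P (fun t => norm2 (X t *m z - A *m z)) <= (s2 ^+ 2 * norm2 z ^+ 2)%:E)%E.
Proof.
have [z0|z0] := eqVneq (norm2 z) 0.
  rewrite z0 expr0n mulr0 mean_sqE integral0_eq // => t _.
  by rewrite (norm2_eq0 z0) !mulmx0 subrr norm2_0 expr0n.
have zp : 0 < norm2 z by rewrite lt_def z0 norm2_ge0.
have mXz : mvec (fun t => X t *m z - A *m z).
  apply: mvecB; last exact: mvec_cst.
  by apply: mvec_mulmx => //; exact: mvec_cst.
have X2' := X2; rewrite mean_sqE in X2'; rewrite mean_sqE mulrC EFinM.
have -> : (\int[P]_t (norm2 (X t *m z - A *m z) ^+ 2)%:E =
  (norm2 z ^+ 2)%:E * \int[P]_t ((norm2 z ^+ 2)^-1 * norm2 (X t *m z - A *m z) ^+ 2)%:E)%E.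
  rewrite -ge0_integralZl_EFin ?sqr_ge0 //.
  - apply: eq_integral => t _; rewrite -EFinM mulVKf // gt_eqF // exprn_gt0 //.
  - by move=> t _; rewrite lee_fin mulr_ge0 ?invr_ge0 ?sqr_ge0.
  - apply/measurable_EFinP; apply: measurable_funM; first exact: measurable_cst.
    exact: measurable_norm2_sqr.
apply: lee_wpmul2l; first by rewrite lee_fin sqr_ge0.
apply: le_trans X2'; apply: le_integral_ge0 => t.
  by rewrite lee_fin mulr_ge0 ?invr_ge0 ?sqr_ge0.
rewrite lee_fin ler_pdivrMl ?exprn_gt0 // mulrC -exprMn -mulmxBl.
by rewrite ler_pXn2r ?nnegrE ?specnormP // (le_trans _ (specnormP _ z)).
Qed.

Lemma integrable_entry i j : P.-integrable setT (fun t => (X t i j)%:E).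
Proof.
have h := @integrable_coord R d T P m (fun t => col j (X t)) (col j A) (s2 ^+ 2) _ _ i.
have : P.-integrable setT (fun t => (col j (X t) i 0)%:E).
  apply: h.
  - by move=> a b; under eq_fun do rewrite mxE; exact: mX.
  - have := mean_sq_mulmx (delta_mx j 0); rewrite mean_sqE.
    have -> : norm2 (delta_mx j 0 : 'cV[R]_n) = 1.
      by rewrite norm2_dot dot_delta mxE !eqxx sqrtr1.
    rewrite expr1n mulr1; apply: le_trans; apply: le_integral_ge0 => t.
      by rewrite lee_fin sqr_ge0.
    by rewrite -!colE.
by under eq_fun do rewrite mxE.
Qed.

Lemma mean_mulmx (z : 'cV[R]_n) : mean_mx P (fun t => X t *m z) (A *m z).
Proof.
move=> i k; rewrite unlock.
have -> : (fun t => ((X t *m z) i k)%:E) = (fun t => \sum_j ((z j k)%:E * (X t i j)%:E))%E.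
  apply/funext => t; rewrite mxE -sumEFin; apply: eq_bigr => j _.
  by rewrite -EFinM mulrC.
rewrite integral_sum //; last by move=> j; apply: integrableZl => //; exact: integrable_entry.
rewrite mxE -sumEFin; apply: eq_bigr => j _.
rewrite integralZl //; last exact: integrable_entry.
by have := EX i j; rewrite unlock => ->; rewrite -EFinM mulrC.
Qed.

End MeanMulmx.

(** * Noise of the compressed estimators *)

Section CompressedAverage.
Context {R : realType} {pb : problem R} {rd : nat} {rn : randomness pb rd}.
Hypothesis fr : fresh rn.
Local Notation N := (nw pb).
Local Notation draws := (draw N rd).
Local Notation ev := (@draw_events R pb rd rn).
Hypothesis rd0 : (0 < rd)%N.

Variables (d : nat) (om : R) (C : 'I_N -> random_map R d).
Hypothesis uC : forall i, unbiased_compressor om (C i).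
Variables (dr : 'I_N -> 'I_rd -> draws) (sd : forall i, 'I_rd -> Om rn -> seed (C i)).
Hypothesis drE : forall i r,
  ev (dr i r) = preimage_set_system setT (sd i r) measurable.
Hypothesis drI : forall i r i' r', dr i r = dr i' r' -> i = i' /\ r = r'.
Hypothesis sdL : forall i r, has_law (Pr rn) (sd i r) (seed_law (C i)).
Variables (F : set draws) (D : 'I_N -> 'I_rd -> set draws).
Hypothesis drF : forall i r, F (dr i r).
Hypothesis DF : forall i r, D i r `<=` F.
Hypothesis DD : forall i r i' r' c, D i r c -> D i' r' c -> i = i' /\ r = r'.
Hypothesis Ddr : forall i r i' r', ~ D i r (dr i' r').
Variables (U : 'I_N -> 'I_rd -> Om rn -> 'cV[R]_d) (m : 'I_N -> Om rn -> 'cV[R]_d) (b : R).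
Hypothesis b0 : 0 <= b.
Hypothesis mm : forall i, mout F (m i).
Hypothesis mU : forall E i r, E `<=` F -> (forall c, E c -> ~ D i r c) -> mout E (U i r).
Hypothesis nU : forall i r, noisy (D i r) (U i r) (m i) b%:E.

Let Y i w := rd%:R^-1 *: \sum_(r < rd) U i r w.
Let Ei i := [set c | exists r, D i r c].
Lemma om_msc_ge0 : 0 <= om -> 0 <= om_msc om rd.
Proof. by move=> h; rewrite mulr_ge0 // exprn_ge0 // divr_ge0 // addr_ge0. Qed.

Let mY E i : E `<=` F -> (forall c, E c -> ~ Ei i c) -> mout E (Y i).
Proof.
move=> EF Ec; apply: mvecZl; apply: mvec_sum => r; apply: mU => // c /Ec h h'.
by apply: h; exists r.
Qed.

Let nY i : noisy (Ei i) (Y i) (m i) (b / rd%:R)%:E.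
Proof.
have rdn : rd%:R != 0 :> R by rewrite pnatr_eq0 -lt0n.
have h : noisy (Ei i) (fun w => \sum_(r < rd) U i r w) (fun w => \sum_(r < rd) m i w)
    (\sum_(r < rd) b%:E)%E.
  apply: (@noisy_mono _ _ _ _ [set c | exists2 r, r \in index_enum 'I_rd & D i r c]).
    by move=> c [r _ Dc]; exists r.
  apply: (@noisy_sum _ _ _ _ _ _ F (D i)) => //.
  - exact: index_enum_uniq.
  - move=> r r' rr'; apply: mU => // c Dc Dc'.
    by have [_ e] := DD Dc Dc'; rewrite e eqxx in rr'.
have := noisyZ (rd%:R^-1) h.
have -> : ((rd%:R^-1 ^+ 2)%:E * \sum_(r < rd) b%:E)%E = (b / rd%:R)%:E.
  rewrite sumEFin sumr_const card_ord -EFinM -mulr_natr; congr (_%:E).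
  by field.
apply: (@eq_noisy _ _ _ _ _ _ (Y i)) => // w; rewrite sumr_const card_ord.
by rewrite -[m i w *+ rd]scaler_nat scalerA mulVf // scale1r.
Qed.

(** Within a worker, sampling noise followed by compression is two layers, combined by [noisy_comp].
    Across workers the draws are disjoint, so variances add and the squared prefactor leaves a gain
    of 1/N. *)
Lemma noisy_compressed_average :
  noisy F (fun w => N%:R^-1 *: \sum_(i < N) msc om (Y i w) (fun r => sd i r w))
    (fun w => N%:R^-1 *: \sum_(i < N) m i w)
    ((N%:R^-1 ^+ 2)%:E * \sum_(i < N)
       ((b / rd%:R)%:E + (om_msc om rd)%:E * (esq (m i) + (b / rd%:R)%:E)))%E.
Proof.
have brd : (0 <= (b / rd%:R)%:E)%E by rewrite lee_fin divr_ge0.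
pose S i := seeds_of (dr i) (enum 'I_rd).
have SF i : S i `<=` F by move=> c [r _ ->].
have EF i : Ei i `<=` F by move=> c [r /DF].
have drI' i : injective (dr i) by move=> r r' /drI[].
apply: noisyZ.
apply: (@noisy_mono _ _ _ _ [set c | exists2 i, i \in index_enum 'I_N & (Ei i `|` S i) c]).
  by move=> c [i _ [/EF|/SF]].
apply: (@noisy_sum _ _ _ _ _ _ F (fun i => Ei i `|` S i)).
- exact: index_enum_uniq.
- move=> i; apply: adde_ge0 => //; apply: mule_ge0; last by rewrite adde_ge0 ?esq_ge0.
  by rewrite lee_fin om_msc_ge0 //; case: (uC i).
- by move=> i c [/EF|/SF].
- exact: mm.
- move=> i; apply: (@noisy_comp _ _ _ _ _ _ _ _ (Y i)) => //.
  + by rewrite om_msc_ge0 //; case: (uC i).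
  + apply: (noisy_msc fr (uC i) (drE i)) => //.
    by apply: mY => [|c [r _ ->] [r' /Ddr]//]; exact: SF.
- move=> i j ij.
  apply: (mout_msc (uC i) (drE i)) => [|r].
    apply: mY => [c [/EF|/SF] //|c [[r Dc]|[r _ ->]] [r' Dc']].
      by have [e _] := DD Dc Dc'; rewrite e eqxx in ij.
    exact: Ddr Dc'.
  move=> [[r' /Ddr //]|[r' _ /drI[e _]]]; by rewrite e eqxx in ij.
Qed.

End CompressedAverage.

(** * Dependence of the iterates on past draws, and noise of the directions *)

Section Run.
Context {R : realType} {mu Cf Lf Lg Lgxy Lgyy LPhi Ly Lz sigma omu oml bf bg : R}.
Context {pb : problem R} {rd : nat} {rn : randomness pb rd}.
Variables (p : params R) (s0 : state pb).
Hypothesis asm : assumptions mu Cf Lf Lg Lgxy Lgyy LPhi Ly Lz sigma omu oml bf bg pb.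
Hypothesis fr : fresh rn.
Hypothesis rd0 : (0 < rd)%N.
Hypothesis pp : positive_params p.
Hypothesis zs0 : norm2 (zs s0) <= rho p.
Local Notation N := (nw pb).
Local Notation draws := (draw N rd).
Local Notation ev := (@draw_events R pb rd rn).
Local Notation iter k := (fun w : Om rn => iterate omu oml p s0 k w).

Definition draw_time (c : draws) : nat :=
  match c with
  | DrawPhi k _ _ | DrawXi k _ _ | DrawX k _ _ | DrawY k _ _ | DrawZ k _ _ => k
  end.

(** Its complement is the past: iterate [k] is fixed by the draws outside [from k], while the
    directions of step [k] are noisy over it. *)
Definition from (k : nat) : set draws := [set c | (k <= draw_time c)%N].

Let rho0 : 0 < rho p. Proof. by case: pp. Qed.
Let uCu i : unbiased_compressor omu (Cu pb i).
Proof. by have [_ _ _ [/(_ i)[]]] := asm. Qed.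
Let uCl i : unbiased_compressor oml (Cl pb i).
Proof. by have [_ _ _ [/(_ i)[]]] := asm. Qed.
Let FF : measurable_fun setT
  (fun q : borel 'cV[R]_(dx pb) * borel 'cV[R]_(dy pb) * Sf pb => Ff pb q.1.1 q.1.2 q.2).
Proof. by have [[_ []]] := asm. Qed.
Let GG : measurable_fun setT
  (fun q : borel 'cV[R]_(dx pb) * borel 'cV[R]_(dy pb) * Sg pb => Gg pb q.1.1 q.1.2 q.2).
Proof. by have [[_ _ []]] := asm. Qed.
Let Fsm t : smooth1 (fun x y => Ff pb x y t).
Proof. by have [[_ [_ _ h] _] _ _ _ _] := asm; exact: h. Qed.
Let Gsm t : smooth2 (fun x y => Gg pb x y t).
Proof. by have [[_ _ [_ _ h]] _ _ _ _] := asm; exact: h. Qed.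
Let Gsm1 t : smooth1 (fun x y => Gg pb x y t).
Proof. by have [] := Gsm t. Qed.

(** At z = 0 the left factor has the default value 0, but it multiplies the zero vector. On the
    right the denominator is at least rho > 0, so the factor is continuous in |z|, as measurability
    requires. *)
Lemma proj_ball n (z : 'cV[R]_n) :
  Num.min 1 (rho p / norm2 z) *: z = (rho p * (Num.max (rho p) (norm2 z))^-1) *: z.
Proof.
have [z0|z0] := eqVneq (norm2 z) 0; first by rewrite (norm2_eq0 z0) !scaler0.
have zp : 0 < norm2 z by rewrite lt_def z0 norm2_ge0.
congr (_ *: _); case: (leP (norm2 z) (rho p)) => h.
  by rewrite divff ?gt_eqF //; apply/min_idPl; rewrite ler_pdivlMr // mul1r.
by apply/min_idPr; rewrite ler_pdivrMr // mul1r ltW.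
Qed.

Lemma proj_ball_le n (z : 'cV[R]_n) : norm2 (Num.min 1 (rho p / norm2 z) *: z) <= rho p.
Proof.
rewrite proj_ball norm2Z ger0_norm; last first.
  by rewrite mulr_ge0 ?invr_ge0 ?le_max ?(ltW rho0).
rewrite mulrAC ler_pdivrMr ?lt_max ?rho0 // ler_pM2l //.
by rewrite le_max lexx orbT.
Qed.

(** This is the purpose of the projection: the Hessian-vector products get the uniform variance
    sigma^2 rho^2, and the Lipschitz bounds of the Hessians a uniform factor. *)
Lemma iterate_z_le k w : norm2 (zs (iter k w)) <= rho p.
Proof. by case: k => //= k; exact: proj_ball_le. Qed.

Definition sample_x k (i : 'I_N) (r : 'I_rd) w :=
  hessxy (fun x y => Gg pb x y (xi rn k i r w)) (xs (iter k w)) (ys (iter k w)) *m zs (iter k w)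
  + gradx (fun x y => Ff pb x y (phi rn k i r w)) (xs (iter k w)) (ys (iter k w)).
Definition sample_y k (i : 'I_N) (r : 'I_rd) w :=
  grady (fun x y => Gg pb x y (xi rn k i r w)) (xs (iter k w)) (ys (iter k w)).
Definition sample_z k (i : 'I_N) (r : 'I_rd) w :=
  hessyy (fun x y => Gg pb x y (xi rn k i r w)) (xs (iter k w)) (ys (iter k w)) *m zs (iter k w)
  + grady (fun x y => Ff pb x y (phi rn k i r w)) (xs (iter k w)) (ys (iter k w)).

Definition state_mout (E : set draws) (s : Om rn -> state pb) :=
  [/\ mout E (fun w => xs (s w)), mout E (fun w => ys (s w)),
      mout E (fun w => zs (s w)) & mout E (fun w => hs (s w))].

Section Samples.
Variables (k : nat) (E : set draws) (i : 'I_N) (r : 'I_rd).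
Hypothesis ms : state_mout E (iter k).
Hypothesis Exi : ~ E (DrawXi k i r).

Let mxi : measurable_fun setT (xi rn k i r : sig E -> Sg pb).
Proof. exact: (draw_measurable (c := DrawXi k i r)). Qed.
Let mphi : ~ E (DrawPhi k i r) -> measurable_fun setT (phi rn k i r : sig E -> Sf pb).
Proof. exact: (draw_measurable (c := DrawPhi k i r)). Qed.

Lemma mout_sample_x : ~ E (DrawPhi k i r) -> mout E (sample_x k i r).
Proof.
move=> /mphi mp; have [mx my mz _] := ms.
apply: mvecD; last exact: (measurable_gradx FF mx my mp Fsm).
exact: (mvec_mulmx (measurable_hessxy GG mx my mxi Gsm) mz).
Qed.

Lemma mout_sample_y : mout E (sample_y k i r).
Proof. by have [mx my mz _] := ms; exact: (measurable_grady GG mxi Gsm1 mx my). Qed.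

Lemma mout_sample_z : ~ E (DrawPhi k i r) -> mout E (sample_z k i r).
Proof.
move=> /mphi mp; have [mx my mz _] := ms.
apply: mvecD; last exact: (measurable_grady FF mp Fsm mx my).
exact: (mvec_mulmx (measurable_hessyy GG mx my mxi Gsm) mz).
Qed.

End Samples.

Lemma iterate_mout k : state_mout (from k) (iter k).
Proof.
elim: k => [|k IH]; first by split; exact: mvec_cst.
have sub : from k.+1 `<=` from k by move=> c /ltnW.
have ms : state_mout (from k.+1) (iter k).
  by have [h1 h2 h3 h4] := IH; split; exact: mout_mono sub _.
have out c : draw_time c = k -> ~ from k.+1 c.
  by move=> e; rewrite /from /= e ltnn.
have mX : mout (from k.+1) (fun w => hatDx omu k (iter k w) w).
  apply: mvecZl; apply: mvec_sum => i.
  apply: (mout_msc (uCu i) (dr := DrawX k i) (sd := seedx rn k i)) => [//||r]; last exact: out.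
  apply: mvecZl; apply: mvec_sum => r.
  by apply: mout_sample_x => //; exact: out.
have mY : mout (from k.+1) (fun w => hatDy oml k (iter k w) w).
  apply: mvecZl; apply: mvec_sum => i.
  apply: (mout_msc (uCl i) (dr := DrawY k i) (sd := seedy rn k i)) => [//||r]; last exact: out.
  apply: mvecZl; apply: mvec_sum => r.
  by apply: mout_sample_y => //; exact: out.
have mZ : mout (from k.+1) (fun w => hatDz oml k (iter k w) w).
  apply: mvecZl; apply: mvec_sum => i.
  apply: (mout_msc (uCl i) (dr := DrawZ k i) (sd := seedz rn k i)) => [//||r]; last exact: out.
  apply: mvecZl; apply: mvec_sum => r.
  by apply: mout_sample_z => //; exact: out.
have [mx my mz mh] := ms.
split => /=.
- by apply: mvecB => //; exact: mvecZl.
- by apply: mvecB => //; exact: mvecZl.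
- have mz1 : mout (from k.+1) (fun w => zs (iter k w) - gamma p *: hatDz oml k (iter k w) w).
    by apply: mvecB => //; exact: mvecZl.
  rewrite /mout; under eq_fun do rewrite proj_ball.
  apply: mvecZ => //; apply: measurable_funM; first exact: measurable_cst.
  exact: (measurableT_comp (measurable_inv_max rho0) (measurable_norm2 mz1)).
- by apply: mvecD; exact: mvecZl.
Qed.

Section Moments.
Variable k : nat.
Let x w := xs (iter k w).
Let y w := ys (iter k w).
Let z w := zs (iter k w).

Let ms E : E `<=` from k -> state_mout E (iter k).
Proof. by move=> h; have [h1 h2 h3 h4] := iterate_mout k; split; exact: mout_mono h _. Qed.

Let cont i := (let: And5 _ (conj c _) _ _ _ := asm in c) i.

Let mgloc_y E i : E `<=` from k -> mout E (fun w => grady (gloc pb i) (x w) (y w)).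
Proof.
move=> /ms[mx my _ _]; have [_ _ _ h _] := cont i.
have := lip2_mvec h mx my; move=> H a b; have := H (rshift _ a) b.
by under eq_fun do rewrite col_mxEd.
Qed.

Let mgfloc E i : E `<=` from k -> mout E (fun w => gradxy (floc pb i) (x w) (y w)).
Proof. by move=> /ms[mx my _ _]; have [_ _ h _ _] := cont i; exact: lip2_mvec h mx my. Qed.

Let mfloc_x E i : E `<=` from k -> mout E (fun w => gradx (floc pb i) (x w) (y w)).
Proof.
move=> /(@mgfloc _ i) H a b; have := H (lshift _ a) b.
by under eq_fun do rewrite col_mxEu.
Qed.

Let mfloc_y E i : E `<=` from k -> mout E (fun w => grady (floc pb i) (x w) (y w)).
Proof.
move=> /(@mgfloc _ i) H a b; have := H (rshift _ a) b.
by under eq_fun do rewrite col_mxEd.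
Qed.

Let mhxy E i : E `<=` from k -> mout E (fun w => hessxy (gloc pb i) (x w) (y w) *m z w).
Proof.
move=> /ms[mx my mz _]; have [_ _ _ _ [h _]] := cont i.
by apply: mvec_mulmx => //; exact: lip2_mvec_spec h mx my.
Qed.

Let mhyy E i : E `<=` from k -> mout E (fun w => hessyy (gloc pb i) (x w) (y w) *m z w).
Proof.
move=> /ms[mx my mz _]; have [_ _ _ _ [_ h]] := cont i.
by apply: mvec_mulmx => //; exact: lip2_mvec_spec h mx my.
Qed.

Let from1 c : draw_time c = k -> [set c] `<=` from k.
Proof. by move=> e _ /= ->; rewrite /from /= e. Qed.

Let noise := let: And5 _ _ c _ _ := asm in c.

Let sz2 w : sigma ^+ 2 * norm2 (z w) ^+ 2 <= sigma ^+ 2 * rho p ^+ 2.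
Proof.
by rewrite ler_wpM2l ?sqr_ge0 // ler_pXn2r ?nnegrE ?(ltW rho0) // iterate_z_le.
Qed.

Let noisy_hxy i r : noisy [set DrawXi k i r]
  (fun w => hessxy (fun x y => Gg pb x y (xi rn k i r w)) (x w) (y w) *m z w)
  (fun w => hessxy (gloc pb i) (x w) (y w) *m z w) (sigma ^+ 2 * rho p ^+ 2)%:E.
Proof.
rewrite -(integral_prob_cst (Pr rn)).
have [mx my mz _] := ms (@from1 (DrawXi k i r) erefl).
have mH w : mvec (fun t => hessxy (fun x y => Gg pb x y t) (x w) (y w)).
  exact: (measurable_hessxy GG (mvec_cst _) (mvec_cst _) (measurable_id (D := setT)) Gsm).
apply: (noisy_draw fr (X := xi rn k i r) (mu := Dg pb i)
  (V := fun w t => hessxy (fun x y => Gg pb x y t) (x w) (y w) *m z w)) => //.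
- by have [] := fr.1 k i r.
- apply: mvec_mulmx; last exact: (mvec_comp (f := fst) measurable_fst mz).
  exact: (measurable_hessxy GG (mvec_comp measurable_fst mx)
    (mvec_comp measurable_fst my) measurable_snd Gsm).
- by apply: mhxy; exact: from1.
- by move=> w; have [_ _ [h1 h2] _] := noise i (x w) (y w); exact: (mean_mulmx (mH w) h1 h2).
- move=> w; have [_ _ [h1 h2] _] := noise i (x w) (y w).
  apply: le_trans (mean_sq_mulmx (mH w) h2 (z w)) _; by rewrite lee_fin.
Qed.

Let noisy_hyy i r : noisy [set DrawXi k i r]
  (fun w => hessyy (fun x y => Gg pb x y (xi rn k i r w)) (x w) (y w) *m z w)
  (fun w => hessyy (gloc pb i) (x w) (y w) *m z w) (sigma ^+ 2 * rho p ^+ 2)%:E.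
Proof.
rewrite -(integral_prob_cst (Pr rn)).
have [mx my mz _] := ms (@from1 (DrawXi k i r) erefl).
have mH w : mvec (fun t => hessyy (fun x y => Gg pb x y t) (x w) (y w)).
  exact: (measurable_hessyy GG (mvec_cst _) (mvec_cst _) (measurable_id (D := setT)) Gsm).
apply: (noisy_draw fr (X := xi rn k i r) (mu := Dg pb i)
  (V := fun w t => hessyy (fun x y => Gg pb x y t) (x w) (y w) *m z w)) => //.
- by have [] := fr.1 k i r.
- apply: mvec_mulmx; last exact: (mvec_comp (f := fst) measurable_fst mz).
  exact: (measurable_hessyy GG (mvec_comp measurable_fst mx)
    (mvec_comp measurable_fst my) measurable_snd Gsm).
- by apply: mhyy; exact: from1.
- by move=> w; have [_ _ _ [h1 h2]] := noise i (x w) (y w); exact: (mean_mulmx (mH w) h1 h2).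
- move=> w; have [_ _ _ [h1 h2]] := noise i (x w) (y w).
  apply: le_trans (mean_sq_mulmx (mH w) h2 (z w)) _; by rewrite lee_fin.
Qed.

Let noisy_gy i r : noisy [set DrawXi k i r] (sample_y k i r)
  (fun w => grady (gloc pb i) (x w) (y w)) (sigma ^+ 2)%:E.
Proof.
rewrite -(integral_prob_cst (Pr rn)).
have [mx my _ _] := ms (@from1 (DrawXi k i r) erefl).
apply: (noisy_draw fr (X := xi rn k i r) (mu := Dg pb i)
  (V := fun w t => grady (fun x y => Gg pb x y t) (x w) (y w))) => //.
- by have [] := fr.1 k i r.
- exact: (measurable_grady GG measurable_snd Gsm1 (mvec_comp measurable_fst mx)
    (mvec_comp measurable_fst my)).
- by apply: mgloc_y; exact: from1.
- by move=> w; have [_ [h _] _ _] := noise i (x w) (y w).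
- by move=> w; have [_ [_ h] _ _] := noise i (x w) (y w).
Qed.

Let noisy_fx i r : noisy [set DrawPhi k i r]
  (fun w => gradx (fun x y => Ff pb x y (phi rn k i r w)) (x w) (y w))
  (fun w => gradx (floc pb i) (x w) (y w)) (sigma ^+ 2)%:E.
Proof.
rewrite -(integral_prob_cst (Pr rn)).
have [mx my _ _] := ms (@from1 (DrawPhi k i r) erefl).
apply: (noisy_draw fr (X := phi rn k i r) (mu := Df pb i)
  (V := fun w t => gradx (fun x y => Ff pb x y t) (x w) (y w))) => //.
- by have [] := fr.1 k i r.
- exact: (measurable_gradx FF (mvec_comp measurable_fst mx)
    (mvec_comp measurable_fst my) measurable_snd Fsm).
- by apply: mfloc_x; exact: from1.
- move=> w a b; have [[h _] _ _ _] := noise i (x w) (y w).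
  have := h (lshift _ a) b; rewrite col_mxEu.
  by under eq_fun do rewrite col_mxEu.
- move=> w; have [[_ h] _ _ _] := noise i (x w) (y w).
  apply: le_trans h; rewrite !mean_sqE; apply: le_integral_ge0 => t.
    by rewrite lee_fin sqr_ge0.
  rewrite lee_fin ler_pXn2r ?nnegrE // opp_col_mx add_col_mx; exact: norm2_col_mxu.
Qed.

Let noisy_fy i r : noisy [set DrawPhi k i r]
  (fun w => grady (fun x y => Ff pb x y (phi rn k i r w)) (x w) (y w))
  (fun w => grady (floc pb i) (x w) (y w)) (sigma ^+ 2)%:E.
Proof.
rewrite -(integral_prob_cst (Pr rn)).
have [mx my _ _] := ms (@from1 (DrawPhi k i r) erefl).
apply: (noisy_draw fr (X := phi rn k i r) (mu := Df pb i)
  (V := fun w t => grady (fun x y => Ff pb x y t) (x w) (y w))) => //.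
- by have [] := fr.1 k i r.
- exact: (measurable_grady FF measurable_snd Fsm (mvec_comp measurable_fst mx)
    (mvec_comp measurable_fst my)).
- by apply: mfloc_y; exact: from1.
- move=> w a b; have [[h _] _ _ _] := noise i (x w) (y w).
  have := h (rshift _ a) b; rewrite col_mxEd.
  by under eq_fun do rewrite col_mxEd.
- move=> w; have [[_ h] _ _ _] := noise i (x w) (y w).
  apply: le_trans h; rewrite !mean_sqE; apply: le_integral_ge0 => t.
    by rewrite lee_fin sqr_ge0.
  rewrite lee_fin ler_pXn2r ?nnegrE // opp_col_mx add_col_mx; exact: norm2_col_mxd.
Qed.

Let s2 : 0 <= sigma ^+ 2. Proof. exact: sqr_ge0. Qed.
Let s2r2 : 0 <= sigma ^+ 2 * rho p ^+ 2. Proof. by rewrite -exprMn sqr_ge0. Qed.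

Let noisy_sx i r : noisy ([set DrawXi k i r] `|` [set DrawPhi k i r]) (sample_x k i r)
  (fun w => dloc_x i (x w) (y w) (z w)) (sigma ^+ 2 * (1 + rho p ^+ 2))%:E.
Proof.
rewrite mulrDr mulr1 [sigma ^+ 2 + _]addrC EFinD.
apply: noisyD; rewrite ?lee_fin //.
  have sub := @from1 (DrawPhi k i r) erefl; have [mx my mz _] := ms sub.
  apply: mvec_mulmx => //; apply: (measurable_hessxy GG mx my _ Gsm).
  by apply: (draw_measurable (c := DrawXi k i r)).
exact: mfloc_x (@from1 (DrawXi k i r) erefl).
Qed.

Let noisy_sz i r : noisy ([set DrawXi k i r] `|` [set DrawPhi k i r]) (sample_z k i r)
  (fun w => dloc_z i (x w) (y w) (z w)) (sigma ^+ 2 * (1 + rho p ^+ 2))%:E.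
Proof.
rewrite mulrDr mulr1 [sigma ^+ 2 + _]addrC EFinD.
apply: noisyD; rewrite ?lee_fin //.
  have sub := @from1 (DrawPhi k i r) erefl; have [mx my mz _] := ms sub.
  apply: mvec_mulmx => //; apply: (measurable_hessyy GG mx my _ Gsm).
  by apply: (draw_measurable (c := DrawXi k i r)).
exact: mfloc_y (@from1 (DrawXi k i r) erefl).
Qed.

Let s2r : 0 <= sigma ^+ 2 * (1 + rho p ^+ 2).
Proof. by rewrite mulrDr mulr1 addr_ge0. Qed.

Lemma noisy_hatDx : noisy (from k) (fun w => hatDx omu k (iter k w) w)
  (fun w => davg_x (x w) (y w) (z w))
  ((N%:R^-1 ^+ 2)%:E * \sum_(i < N)
     ((sigma ^+ 2 * (1 + rho p ^+ 2) / rd%:R)%:E + (om_msc omu rd)%:E *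
       (esq (fun w => dloc_x i (x w) (y w) (z w)) + (sigma ^+ 2 * (1 + rho p ^+ 2) / rd%:R)%:E)))%E.
Proof.
apply: (@noisy_compressed_average _ _ _ _ fr rd0 _ omu (Cu pb) uCu (DrawX k) (seedx rn k)
  _ _ _ (from k) (fun i r => [set DrawXi k i r] `|` [set DrawPhi k i r])
  _ _ _ _ (sample_x k)) => //.
- by move=> i r i' r' [].
- by move=> i r; have [] := fr.1 k i r.
- by move=> i r; rewrite /from /=.
- by move=> i r c [] ->; rewrite /from /=.
- by move=> i r i' r' c [] -> [] [].
- by move=> i r i' r' [].
- by move=> i; apply: mvecD; [exact: mhxy|exact: mfloc_x].
- by move=> E i r EF Ec; apply: mout_sample_x => [|/Ec|/Ec];
     [exact: ms|apply; left|apply; right].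
Qed.

Lemma noisy_hatDz : noisy (from k) (fun w => hatDz oml k (iter k w) w)
  (fun w => davg_z (x w) (y w) (z w))
  ((N%:R^-1 ^+ 2)%:E * \sum_(i < N)
     ((sigma ^+ 2 * (1 + rho p ^+ 2) / rd%:R)%:E + (om_msc oml rd)%:E *
       (esq (fun w => dloc_z i (x w) (y w) (z w)) + (sigma ^+ 2 * (1 + rho p ^+ 2) / rd%:R)%:E)))%E.
Proof.
apply: (@noisy_compressed_average _ _ _ _ fr rd0 _ oml (Cl pb) uCl (DrawZ k) (seedz rn k)
  _ _ _ (from k) (fun i r => [set DrawXi k i r] `|` [set DrawPhi k i r])
  _ _ _ _ (sample_z k)) => //.
- by move=> i r i' r' [].
- by move=> i r; have [] := fr.1 k i r.
- by move=> i r; rewrite /from /=.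
- by move=> i r c [] ->; rewrite /from /=.
- by move=> i r i' r' c [] -> [] [].
- by move=> i r i' r' [].
- by move=> i; apply: mvecD; [exact: mhyy|exact: mfloc_y].
- by move=> E i r EF Ec; apply: mout_sample_z => [|/Ec|/Ec];
     [exact: ms|apply; left|apply; right].
Qed.

Lemma noisy_hatDy : noisy (from k) (fun w => hatDy oml k (iter k w) w)
  (fun w => grady (gavg pb) (x w) (y w))
  ((N%:R^-1 ^+ 2)%:E * \sum_(i < N)
     ((sigma ^+ 2 / rd%:R)%:E + (om_msc oml rd)%:E *
       (esq (fun w => grady (gloc pb i) (x w) (y w)) + (sigma ^+ 2 / rd%:R)%:E)))%E.
Proof.
have -> : (fun w => grady (gavg pb) (x w) (y w)) =
    fun w => N%:R^-1 *: \sum_(i < N) grady (gloc pb i) (x w) (y w).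
  by apply/funext => w; rewrite (grady_gavg asm).
apply: (@noisy_compressed_average _ _ _ _ fr rd0 _ oml (Cl pb) uCl (DrawY k) (seedy rn k)
  _ _ _ (from k) (fun i r => [set DrawXi k i r]) _ _ _ _ (sample_y k)) => //.
- by move=> i r i' r' [].
- by move=> i r; have [] := fr.1 k i r.
- by move=> i r; rewrite /from /=.
- by move=> i r c ->; rewrite /from /=.
- by move=> i r i' r' c -> [].
- by move=> i; exact: mgloc_y.
- by move=> E i r EF Ec; apply: mout_sample_y => [|/Ec]; [exact: ms|apply].
Qed.

End Moments.
End Run.

(** * Lyapunov descent *)

Section FiniteMean.
Context {R : realType} {d} {T : measurableType d} (P : probability T R).

(** Bundles finiteness of a mean with its value, so that the recursions are inequalities between
    real numbers. *)
Definition finmean (X : T -> R) (v : R) : Prop :=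
  [/\ measurable_fun setT X, forall w, 0 <= X w & (\int[P]_w (X w)%:E = v%:E)%E].

Lemma finmean_ge0 X v : finmean X v -> 0 <= v.
Proof.
by case=> _ X0 e; rewrite -lee_fin -e; apply: integral_ge0 => w _; rewrite lee_fin.
Qed.

Lemma finmean_cst c : 0 <= c -> finmean (fun=> c) c.
Proof. by move=> c0; split => //; exact: integral_prob_cst. Qed.

Lemma finmeanD X Y u v : finmean X u -> finmean Y v -> finmean (fun w => X w + Y w) (u + v).
Proof.
move=> [mX X0 eX] [mY Y0 eY]; split.
- exact: measurable_funD.
- by move=> w; rewrite addr_ge0.
- under eq_integral do rewrite EFinD.
  rewrite ge0_integralD //; try by [move=> w _; rewrite lee_fin|exact/measurable_EFinP].
  by rewrite eX eY.
Qed.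

Lemma finmeanZ X v c : 0 <= c -> finmean X v -> finmean (fun w => c * X w) (c * v).
Proof.
move=> c0 [mX X0 eX]; split.
- by apply: measurable_funM => //; exact: measurable_cst.
- by move=> w; rewrite mulr_ge0.
- under eq_integral do rewrite EFinM.
  rewrite ge0_integralZl_EFin //; [by rewrite eX|by move=> w _; rewrite lee_fin|exact/measurable_EFinP].
Qed.

Lemma finmean_le X Y u v : finmean X u -> finmean Y v -> (forall w, X w <= Y w) -> u <= v.
Proof.
move=> [_ X0 eX] [_ _ eY] XY; rewrite -lee_fin -eX -eY.
by apply: le_integral_ge0 => w; rewrite lee_fin.
Qed.

Lemma finmean_ex (X : T -> R) v : measurable_fun setT X -> (forall w, 0 <= X w) ->
  (\int[P]_w (X w)%:E <= v%:E)%E -> exists2 u, finmean X u & u <= v.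
Proof.
move=> mX X0 Xv.
have I0 : (0 <= \int[P]_w (X w)%:E)%E by apply: integral_ge0 => w _; rewrite lee_fin.
have fi : (\int[P]_w (X w)%:E)%E \is a fin_num.
  by rewrite ge0_fin_numE // (le_lt_trans Xv) // ltry.
exists (fine (\int[P]_w (X w)%:E)%E); first by split => //; rewrite fineK.
by rewrite -lee_fin fineK.
Qed.

Lemma finmean_dom (X Y : T -> R) v : measurable_fun setT X -> (forall w, 0 <= X w) ->
  (forall w, X w <= Y w) -> finmean Y v -> exists2 u, finmean X u & u <= v.
Proof.
move=> mX X0 XY [_ _ eY]; apply: finmean_ex => //; rewrite -eY.
by apply: le_integral_ge0 => w; rewrite lee_fin.
Qed.

End FiniteMean.

(** * The Lyapunov inequality as real arithmetic *)

Section LyapunovArithmetic.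
Context {R : realType}.
Variables (mu Lg L1 L2 LP Ly Lz n wu wl al be ga th s s1 r2 bg2 bf2 : R).
Hypotheses (mu0 : 0 < mu) (muL : mu <= Lg) (L10 : 0 <= L1) (L20 : 0 <= L2) (n0 : 0 < n).
Hypotheses (wu0 : 0 <= wu) (wl0 : 0 <= wl) (be0 : 0 < be) (ga0 : 0 < ga) (th0 : 0 < th).
Hypotheses (s0 : 0 <= s) (s10 : 0 <= s1) (r20 : 0 <= r2) (bg0 : 0 <= bg2) (bf0 : 0 <= bf2).
Let A := L2 + 25 * (Lg / mu) ^+ 2 * L1.
Hypothesis hbe : 8 * (be * wl * Lg ^+ 2) <= mu * n.
Hypothesis hga : 36 * (ga * wl * Lg ^+ 2) <= mu * n.
Hypothesis hth : 12 * (th * wu) <= n.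
Hypothesis hal : al ^+ 2 * (2 * (2 * LP ^+ 2 / th ^+ 2 + 26 * A * Ly ^+ 2 / (be ^+ 2 * mu ^+ 2)
  + 78 * Lg ^+ 2 * Lz ^+ 2 / (ga ^+ 2 * mu ^+ 2))) <= 1.
Variables (p h y z p' h' y' z' g H : R).
Hypotheses (y0 : 0 <= y) (z0 : 0 <= z) (g0 : 0 <= g) (H0 : 0 <= H).
Hypothesis hp : 2 / al * p' + g + 2^-1 * H <= 2 / al * p + h.
Hypothesis hh : h' <= (1 - th) * h + 2 * th * (3 * L2 * y + 3 * Lg ^+ 2 * z)
  + 2 / th * (LP ^+ 2 * (al ^+ 2 * H))
  + th ^+ 2 * (n^-1 * ((1 + wu) * s1 + wu * (6 * r2 * bg2 + 6 * bf2 + 3 * g + 9 * L2 * y + 9 * Lg ^+ 2 * z))).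
Hypothesis hy : y' <= (1 - be * mu) * y + (be * mu)^-1 * (Ly ^+ 2 * (al ^+ 2 * H))
  + be ^+ 2 * (n^-1 * ((1 + wl) * s + wl * (2 * Lg ^+ 2 * y + 2 * bg2))).
Hypothesis hz : z' <= (1 - ga * mu) * z
  + (ga * mu)^-1 * (2 * (2 * ga ^+ 2 * L1 * y + Lz ^+ 2 * (al ^+ 2 * H)))
  + ga ^+ 2 * (n^-1 * ((1 + wl) * s1 + wl * (4 * r2 * bg2 + 4 * bf2 + 8 * L1 * y + 4 * Lg ^+ 2 * z))).

(** Budget, with K y standing for kappa^2 L1 y. For z: 6 + 9/12 in units of Lg^2 z, against 26 -
    104/36. For y: 6 + 9/12 in units of L2 y and 104 + 208/36 in units of K y, against 13 - 26/8 in
    units of A y = L2 y + 25 K y. For the gradient: 1 - 3/12 is left, more than the 1/2 claimed. The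
    drift terms are paid by H/2 through [hal]. *)
Lemma lyapunov_step :
  2 / al * p' + h' / th + 13 * A / (be * mu) * y' + 26 * Lg ^+ 2 / (ga * mu) * z' + 2^-1 * g
  <= 2 / al * p + h / th + 13 * A / (be * mu) * y + 26 * Lg ^+ 2 / (ga * mu) * z
   + (26 * (1 + wl) * A * be / (mu * n) * s
      + ((1 + wu) * th / n + 39 * Lg ^+ 2 * (1 + wl) * ga / (mu * n)) * s1
      + (6 * r2 * wu * th / n + 52 * A * wl * be / (n * mu)
         + 156 * Lg ^+ 2 * r2 * wl * ga / (n * mu)) * bg2
      + (6 * wu * th / n + 156 * Lg ^+ 2 * wl * ga / (n * mu)) * bf2).
Proof.
have Lg0 : 0 < Lg by apply: lt_le_trans muL.
pose K := (Lg / mu) ^+ 2 * L1.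
have K0 : 0 <= K by rewrite mulr_ge0 // sqr_ge0.
have AE : A = L2 + 25 * K by rewrite /A /K mulrA.
have A0 : 0 <= A by rewrite AE addr_ge0 // mulr_ge0.
have KL : L1 <= K.
  rewrite /K ler_peMl // exprn_ege1 // ler_pdivlMr // mul1r //.
have mn0 : 0 < mu * n by rewrite mulr_gt0.
(* Relative compression noise feeds the errors back into themselves; the step-size conditions bound
   the factors q1, q2 Lg^2 and q3 Lg^2 by 1/12, 1/8 and 1/36. *)
pose q1 := th * wu / n; pose q2 := be * wl / (mu * n); pose q3 := ga * wl / (mu * n).
have q10 : 0 <= q1 by rewrite divr_ge0 ?mulr_ge0 // ltW.
have q20 : 0 <= q2 by rewrite divr_ge0 ?mulr_ge0 // ltW.
have q30 : 0 <= q3 by rewrite divr_ge0 ?mulr_ge0 // ltW.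
have q1l : q1 <= 12^-1 by rewrite /q1 ler_pdivrMr // ler_pdivlMl.
have q2l : q2 * Lg ^+ 2 <= 8^-1 by rewrite /q2 mulrAC ler_pdivrMr // ler_pdivlMl.
have q3l : q3 * Lg ^+ 2 <= 36^-1 by rewrite /q3 mulrAC ler_pdivrMr // ler_pdivlMl.
have c1 : h' / th <= h / th - h + 2 * (3 * L2 * y + 3 * Lg ^+ 2 * z)
    + 2 * LP ^+ 2 / th ^+ 2 * (al ^+ 2 * H) + (1 + wu) * th / n * s1
    + q1 * (6 * r2 * bg2 + 6 * bf2 + 3 * g + 9 * L2 * y + 9 * Lg ^+ 2 * z).
  rewrite ler_pdivrMr //; apply: (le_trans hh); rewrite le_eqVlt; apply/orP; left; apply/eqP.
  by rewrite /q1; field; rewrite !gt_eqF.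
have cy0 : 0 <= 13 * A / (be * mu) by rewrite divr_ge0 ?mulr_ge0 // ltW.
have cz0 : 0 <= 26 * Lg ^+ 2 / (ga * mu) by rewrite divr_ge0 ?mulr_ge0 ?sqr_ge0 // ltW.
have c2 := ler_wpM2l cy0 hy; have c3 := ler_wpM2l cz0 hz.
have e2 : 13 * A / (be * mu) * ((1 - be * mu) * y + (be * mu)^-1 * (Ly ^+ 2 * (al ^+ 2 * H))
  + be ^+ 2 * (n^-1 * ((1 + wl) * s + wl * (2 * Lg ^+ 2 * y + 2 * bg2)))) =
  13 * A / (be * mu) * y - 13 * (A * y) + 2^-1 * (26 * A * Ly ^+ 2 / (be ^+ 2 * mu ^+ 2)) * (al ^+ 2 * H)
  + 13 * (A * ((1 + wl) * be / (mu * n) * s)) + 26 * (q2 * Lg ^+ 2 * (A * y)) + 26 * (A * (q2 * bg2)).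
  by rewrite /q2; field; rewrite !gt_eqF.
have e3 : 26 * Lg ^+ 2 / (ga * mu) * ((1 - ga * mu) * z
  + (ga * mu)^-1 * (2 * (2 * ga ^+ 2 * L1 * y + Lz ^+ 2 * (al ^+ 2 * H)))
  + ga ^+ 2 * (n^-1 * ((1 + wl) * s1 + wl * (4 * r2 * bg2 + 4 * bf2 + 8 * L1 * y + 4 * Lg ^+ 2 * z)))) =
  26 * Lg ^+ 2 / (ga * mu) * z - 26 * (Lg ^+ 2 * z) + 104 * (K * y)
  + (2 / 3) * (78 * Lg ^+ 2 * Lz ^+ 2 / (ga ^+ 2 * mu ^+ 2)) * (al ^+ 2 * H)
  + 26 * (Lg ^+ 2 * ((1 + wl) * ga / (mu * n) * s1))
  + 104 * (Lg ^+ 2 * (q3 * (r2 * bg2))) + 104 * (Lg ^+ 2 * (q3 * bf2))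
  + 208 * (q3 * Lg ^+ 2 * (L1 * y)) + 104 * (q3 * Lg ^+ 2 * (Lg ^+ 2 * z)).
  by rewrite /q3 /K; field; rewrite !gt_eqF.
rewrite e2 in c2; rewrite e3 in c3.
have d1 : q1 * g <= 12^-1 * g by rewrite ler_wpM2r.
have d2 : q1 * (L2 * y) <= 12^-1 * (L2 * y) by rewrite ler_wpM2r // mulr_ge0.
have d3 : q1 * (Lg ^+ 2 * z) <= 12^-1 * (Lg ^+ 2 * z) by rewrite ler_wpM2r // mulr_ge0 // sqr_ge0.
have d4 : q2 * Lg ^+ 2 * (A * y) <= 8^-1 * (A * y) by rewrite ler_wpM2r // mulr_ge0.
have d5 : q3 * Lg ^+ 2 * (L1 * y) <= 36^-1 * (L1 * y) by rewrite ler_wpM2r // mulr_ge0.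
have d6 : q3 * Lg ^+ 2 * (Lg ^+ 2 * z) <= 36^-1 * (Lg ^+ 2 * z).
  by rewrite ler_wpM2r // mulr_ge0 // sqr_ge0.
have d7 : L1 * y <= K * y by rewrite ler_wpM2r.
have AyE : A * y = L2 * y + 25 * (K * y) by rewrite AE mulrDl mulrA.
have Ky0 : 0 <= K * y by rewrite mulr_ge0.
have L2y0 : 0 <= L2 * y by rewrite mulr_ge0.
have Lz0 : 0 <= Lg ^+ 2 * z by rewrite mulr_ge0 // sqr_ge0.
have n1 : 0 <= A * ((1 + wl) * be / (mu * n) * s).
  by rewrite mulr_ge0 // mulr_ge0 // divr_ge0 ?(ltW mn0) // mulr_ge0 ?(ltW be0) // addr_ge0.
have n2 : 0 <= A * (q2 * bg2) by rewrite mulr_ge0 // mulr_ge0.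
have n3 : 0 <= Lg ^+ 2 * ((1 + wl) * ga / (mu * n) * s1).
  by rewrite mulr_ge0 ?sqr_ge0 // mulr_ge0 // divr_ge0 ?(ltW mn0) // mulr_ge0 ?(ltW ga0) // addr_ge0.
have n4 : 0 <= Lg ^+ 2 * (q3 * (r2 * bg2)).
  by rewrite mulr_ge0 ?sqr_ge0 // mulr_ge0 // mulr_ge0.
have n5 : 0 <= Lg ^+ 2 * (q3 * bf2) by rewrite mulr_ge0 ?sqr_ge0 // mulr_ge0.
have -> : 26 * (1 + wl) * A * be / (mu * n) * s
      + ((1 + wu) * th / n + 39 * Lg ^+ 2 * (1 + wl) * ga / (mu * n)) * s1
      + (6 * r2 * wu * th / n + 52 * A * wl * be / (n * mu)
         + 156 * Lg ^+ 2 * r2 * wl * ga / (n * mu)) * bg2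
      + (6 * wu * th / n + 156 * Lg ^+ 2 * wl * ga / (n * mu)) * bf2 =
   26 * (A * ((1 + wl) * be / (mu * n) * s)) + (1 + wu) * th / n * s1
   + 39 * (Lg ^+ 2 * ((1 + wl) * ga / (mu * n) * s1))
   + 6 * (q1 * (r2 * bg2)) + 52 * (A * (q2 * bg2)) + 156 * (Lg ^+ 2 * (q3 * (r2 * bg2)))
   + 6 * (q1 * bf2) + 156 * (Lg ^+ 2 * (q3 * bf2)).
  by rewrite /q1 /q2 /q3; field; rewrite !gt_eqF.
have e1 : q1 * (6 * r2 * bg2 + 6 * bf2 + 3 * g + 9 * L2 * y + 9 * Lg ^+ 2 * z) =
  6 * (q1 * (r2 * bg2)) + 6 * (q1 * bf2) + 3 * (q1 * g) + 9 * (q1 * (L2 * y)) + 9 * (q1 * (Lg ^+ 2 * z)).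
  by ring.
rewrite e1 in c1.
have aH0 : 0 <= al ^+ 2 * H by rewrite mulr_ge0 // sqr_ge0.
have t1 : 0 <= 2 * LP ^+ 2 / th ^+ 2 * (al ^+ 2 * H).
  by apply: mulr_ge0 => //; apply: divr_ge0; [apply: mulr_ge0|]; rewrite ?sqr_ge0.
have t2 : 0 <= 26 * A * Ly ^+ 2 / (be ^+ 2 * mu ^+ 2) * (al ^+ 2 * H).
  apply: mulr_ge0 => //; apply: divr_ge0; last by rewrite -exprMn sqr_ge0.
  by apply: mulr_ge0; [apply: mulr_ge0|exact: sqr_ge0].
have t3 : 0 <= 78 * Lg ^+ 2 * Lz ^+ 2 / (ga ^+ 2 * mu ^+ 2) * (al ^+ 2 * H).
  apply: mulr_ge0 => //; apply: divr_ge0; last by rewrite -exprMn sqr_ge0.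
  by apply: mulr_ge0; [apply: mulr_ge0 => //|]; exact: sqr_ge0.
have t : 2 * (2 * LP ^+ 2 / th ^+ 2 * (al ^+ 2 * H)
  + 26 * A * Ly ^+ 2 / (be ^+ 2 * mu ^+ 2) * (al ^+ 2 * H)
  + 78 * Lg ^+ 2 * Lz ^+ 2 / (ga ^+ 2 * mu ^+ 2) * (al ^+ 2 * H)) <= H.
  have := ler_wpM2r H0 hal; rewrite mul1r; apply: le_trans.
  by rewrite le_eqVlt; apply/orP; left; apply/eqP; ring.
move: hp c1 c2 c3 t t1 t2 t3 d1 d2 d3 d4 d5 d6 d7 n1 n2 n3 n4 n5 Ky0 L2y0 Lz0 g0 H0; rewrite AyE.
set T1 := 2 * LP ^+ 2 / th ^+ 2 * (al ^+ 2 * H).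
set T2' := 2^-1 * _ * (al ^+ 2 * H).
have -> : T2' = 2^-1 * (26 * A * Ly ^+ 2 / (be ^+ 2 * mu ^+ 2) * (al ^+ 2 * H)) by exact: esym (mulrA _ _ _).
set T2 := 26 * A * Ly ^+ 2 / _ * _.
set T3' := 2 / 3 * _ * (al ^+ 2 * H).
have -> : T3' = 2 / 3 * (78 * Lg ^+ 2 * Lz ^+ 2 / (ga ^+ 2 * mu ^+ 2) * (al ^+ 2 * H)) by exact: esym (mulrA _ _ _).
set T3 := 78 * Lg ^+ 2 * _ / _ * _.
move: (A * (_ * s)) (A * (q2 * _)) (Lg ^+ 2 * (_ * s1)) (Lg ^+ 2 * (q3 * (r2 * _))) (Lg ^+ 2 * (q3 * bf2)) => m1 m2 m3 m4 m5.
have -> : 2 * (3 * L2 * y + 3 * Lg ^+ 2 * z) = 6 * (L2 * y) + 6 * (Lg ^+ 2 * z) by ring.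
move: (q1 * g) (q1 * (L2 * y)) (q1 * (Lg ^+ 2 * z)) (q3 * Lg ^+ 2 * (L1 * y)) (q3 * Lg ^+ 2 * (Lg ^+ 2 * z)) => u1 u2 u3 u4 u5.
move: (q2 * Lg ^+ 2 * _) (q1 * (r2 * _)) (q1 * bf2) => u6 u7 u8.
move: (K * y) (L2 * y) (Lg ^+ 2 * z) (L1 * y) => Ky L2y Lgz L1y.
move: (2 / al * _) (2 / al * _) (h' / th) (h / th) (13 * A / (be * mu) * _)  (13 * A / (be * mu) * _) (26 * Lg ^+ 2 / (ga * mu) * _) (26 * Lg ^+ 2 / (ga * mu) * _) ((1 + wu) * th / n * s1).
clear; move=> *; lra.
Qed.

End LyapunovArithmetic.

(** When the projection t z differs from z, the removed part (1 - t) z makes a nonnegative inner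
    product with t z - v, since <v, z> <= r |z| = t |z|^2. *)
Lemma proj_ball_dist (R : realType) n (r : R) (z v : 'cV[R]_n) : 0 < r -> norm2 v <= r ->
  norm2 (Num.min 1 (r / norm2 z) *: z - v) <= norm2 (z - v).
Proof.
move=> r0 vr; have [z0|z0] := eqVneq (norm2 z) 0.
  by rewrite (norm2_eq0 z0) scaler0.
have zp : 0 < norm2 z by rewrite lt_def z0 norm2_ge0.
set t := Num.min _ _.
have [h|h] := leP (norm2 z) r.
  by rewrite /t (_ : Num.min _ _ = 1) ?scale1r //; apply/min_idPl; rewrite ler_pdivlMr // mul1r.
have tE : t = r / norm2 z by apply/min_idPr; rewrite ler_pdivrMr // mul1r ltW.
have t1 : t <= 1 by rewrite tE ler_pdivrMr // mul1r ltW.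
rewrite -(ler_pXn2r (n := 2)) ?nnegrE //.
have -> : z - v = (t *: z - v) + (1 - t) *: z.
  by rewrite addrAC -scalerDl subrKC scale1r.
rewrite [X in _ <= X]norm2D_sqr -[X in _ <= X]addrA lerDl addr_ge0 ?sqr_ge0 // dotZr dotBl dotZl.
rewrite mulr_ge0 // mulr_ge0 ?subr_ge0 //.
rewrite -norm2_sqr tE expr2 mulrA divfK //.
by apply: le_trans (dot_le v z) _; rewrite ler_pM2r.
Qed.

(** * One iteration in mean, and telescoping *)

Section OneStep.
Context {R : realType} {mu Cf Lf Lg Lgxy Lgyy LPhi Ly Lz sigma omu oml bf bg : R}.
Context {pb : problem R} {rd : nat} {rn : randomness pb rd}.
Variables (p : params R) (s0 : state pb).
Hypothesis asm : assumptions mu Cf Lf Lg Lgxy Lgyy LPhi Ly Lz sigma omu oml bf bg pb.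
Hypothesis fr : fresh rn.
Hypothesis rd0 : (0 < rd)%N.
Hypothesis pp : positive_params p.
Hypothesis zs0 : norm2 (zs s0) <= rho p.
Local Notation N := (nw pb).
Local Notation iter k := (fun w : Om rn => iterate omu oml p s0 k w).
Local Notation wu := (om_msc omu rd).
Local Notation wl := (om_msc oml rd).
Local Notation A := (Lcomb mu Lf Lg Lgxy Lgyy (rho p)).
Local Notation sg2 := (sigma ^+ 2 / rd%:R).
Local Notation sg21 := (sigma ^+ 2 * (1 + rho p ^+ 2) / rd%:R).
Local Notation finmean := (finmean (Pr rn)).
Hypothesis hbe : beta p < 2 / (mu + Lg).
Hypothesis hbw : lt_quot (beta p) (mu * N%:R) (8 * wl * Lg ^+ 2).
Hypothesis hga : gamma p <= 1 / Lg.
Hypothesis hgw : le_quot (gamma p) (mu * N%:R) (36 * wl * Lg ^+ 2).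
Hypothesis hth : theta p <= 1.
Hypothesis htw : le_quot (theta p) N%:R (12 * wu).
Hypothesis hrho : Cf / mu <= rho p.
Hypothesis hal : alpha p <= 1 / (2 * LPhi).
Hypothesis hC2 : alpha p <= C2 mu Lf Lg Lgxy Lgyy LPhi Ly Lz p.

Definition lyapunov (vP vh vy vz : R) : R :=
  2 / alpha p * vP + vh / theta p + 13 * A / (beta p * mu) * vy
  + 26 * Lg ^+ 2 / (gamma p * mu) * vz.

Definition step_noise : R :=
  26 * (1 + wl) * A * beta p / (mu * N%:R) * sg2
  + ((1 + wu) * theta p / N%:R + 39 * Lg ^+ 2 * (1 + wl) * gamma p / (mu * N%:R)) * sg21
  + (6 * rho p ^+ 2 * wu * theta p / N%:R + 52 * A * wl * beta p / (N%:R * mu)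
     + 156 * Lg ^+ 2 * rho p ^+ 2 * wl * gamma p / (N%:R * mu)) * bg ^+ 2
  + (6 * wu * theta p / N%:R + 156 * Lg ^+ 2 * wl * gamma p / (N%:R * mu)) * bf ^+ 2.

Definition has_means k (vP vh vy vz : R) : Prop :=
  [/\ finmean (fun w => Phi pb (xs (iter k w))) vP,
      finmean (fun w => gapx (iter k w)) vh,
      finmean (fun w => gapy (iter k w)) vy
    & finmean (fun w => gapz (iter k w)) vz].

Let mu0 : 0 < mu. Proof. exact: mu_gt0 asm. Qed.
Let muL : mu <= Lg. Proof. exact: mu_le_Lg asm. Qed.
Let N0 : 0 < N%:R :> R.
Proof. by rewrite ltr0n; case: asm => [[[]]]. Qed.
Let i0 : 'I_N.
Proof. by have [[[h _ _] _ _] _ _ _ _] := asm; exact: (Ordinal h). Qed.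
Let wu0 : 0 <= wu.
Proof. by apply: om_msc_ge0; have [_ _ _ [/(_ i0)[[]]]] := asm. Qed.
Let wl0 : 0 <= wl.
Proof. by apply: om_msc_ge0; have [_ _ _ [/(_ i0)[_ []]]] := asm. Qed.
Let al0 : 0 < alpha p. Proof. by case: pp. Qed.
Let be0 : 0 < beta p. Proof. by case: pp. Qed.
Let ga0 : 0 < gamma p. Proof. by case: pp. Qed.
Let th0 : 0 < theta p. Proof. by case: pp. Qed.
Let rho0 : 0 < rho p. Proof. by case: pp. Qed.
Let LP0 : 0 < LPhi. Proof. by case: asm => _ _ _ _ [[[]]]. Qed.
Let lipP : lipschitz1 LPhi (grad (Phi pb)). Proof. by case: asm => _ _ _ _ [[_ []]]. Qed.
Let lipy : lipschitz1 Ly (ystar pb). Proof. by case: asm => _ _ _ _ [[_ []]]. Qed.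
Let lipz : lipschitz1 Lz (zstar pb). Proof. by case: asm => _ _ _ _ [[_ []]]. Qed.
Let s20 : 0 <= sg2. Proof. by rewrite divr_ge0 ?sqr_ge0. Qed.
Let s210 : 0 <= sg21.
Proof. by apply: divr_ge0 => //; apply: mulr_ge0; rewrite ?addr_ge0 ?sqr_ge0. Qed.
Let L1 := Lf ^+ 2 + Lgyy ^+ 2 * rho p ^+ 2.
Let L2 := Lf ^+ 2 + Lgxy ^+ 2 * rho p ^+ 2.
Let L10 : 0 <= L1. Proof. by rewrite /L1 -exprMn addr_ge0 ?sqr_ge0. Qed.
Let L20 : 0 <= L2. Proof. by rewrite /L2 -exprMn addr_ge0 ?sqr_ge0. Qed.
Let Lg0 : 0 < Lg. Proof. exact: Lg_gt0 asm. Qed.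

Let be_le : 8 * (beta p * wl * Lg ^+ 2) <= mu * N%:R.
Proof.
have mn : 0 < mu * N%:R by rewrite mulr_gt0.
have e : 8 * (beta p * wl * Lg ^+ 2) = beta p * (8 * wl * Lg ^+ 2) by ring.
have [z|h] := hbw; rewrite e; first by rewrite z mulr0 ltW.
have [w|w] := eqVneq (8 * wl * Lg ^+ 2) 0; first by rewrite w mulr0 ltW.
have wp : 0 < 8 * wl * Lg ^+ 2.
  by rewrite lt_def w mulr_ge0 ?sqr_ge0 // mulr_ge0.
by rewrite -ler_pdivlMr // ltW.
Qed.

Let ga_le : 36 * (gamma p * wl * Lg ^+ 2) <= mu * N%:R.
Proof.
have mn : 0 < mu * N%:R by rewrite mulr_gt0.
have e : 36 * (gamma p * wl * Lg ^+ 2) = gamma p * (36 * wl * Lg ^+ 2) by ring.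
have [z|h] := hgw; rewrite e; first by rewrite z mulr0 ltW.
have [w|w] := eqVneq (36 * wl * Lg ^+ 2) 0; first by rewrite w mulr0 ltW.
have wp : 0 < 36 * wl * Lg ^+ 2.
  by rewrite lt_def w mulr_ge0 ?sqr_ge0 // mulr_ge0.
by rewrite -ler_pdivlMr.
Qed.

Let th_le : 12 * (theta p * wu) <= N%:R.
Proof.
have [z|h] := htw.
  by rewrite mulrCA z mulr0.
have [w|w] := eqVneq (12 * wu) 0; first by rewrite mulrCA w mulr0.
have wp : 0 < 12 * wu by rewrite lt_def w mulr_ge0.
by rewrite mulrCA -ler_pdivlMr.
Qed.

Let al_le : alpha p ^+ 2 * (2 * (2 * LPhi ^+ 2 / theta p ^+ 2
  + 26 * (L2 + 25 * (Lg / mu) ^+ 2 * L1) * Ly ^+ 2 / (beta p ^+ 2 * mu ^+ 2)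
  + 78 * Lg ^+ 2 * Lz ^+ 2 / (gamma p ^+ 2 * mu ^+ 2))) <= 1.
Proof.
have := hC2; rewrite /C2 /Lcomb -/L1 -/L2; set X := 2 * (_ + _ + _) => h.
have [X0|X0] := leP X 0.
  by apply: (@le_trans _ _ 0) => //; rewrite mulr_ge0_le0 // sqr_ge0.
have sX : 0 < Num.sqrt X by rewrite sqrtr_gt0.
have := h; rewrite -[X in _ <= X]mul1r ler_pdivlMr // => h1.
rewrite -[X](sqr_sqrtr (ltW X0)) -exprMn exprn_ile1 // mulr_ge0 ?ltW //.
Qed.

Section AtStep.
Variable k : nat.
Let x w := xs (iter k w).
Let y w := ys (iter k w).
Let z w := zs (iter k w).
Let h w := hs (iter k w).
Let x' w := x w - alpha p *: h w.

Let zr w : norm2 (z w) <= rho p. Proof. exact: iterate_z_le. Qed.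

Let msF : state_mout (from k) (iter k). Proof. exact: (iterate_mout s0 asm pp k). Qed.
Let mx : mout (from k) x. Proof. by case: msF. Qed.
Let my : mout (from k) y. Proof. by case: msF. Qed.
Let mz : mout (from k) z. Proof. by case: msF. Qed.
Let mh : mout (from k) h. Proof. by case: msF. Qed.
Let mx' : mout (from k) x'. Proof. by apply: mvecB => //; exact: mvecZl. Qed.

Let measPhi (u : Om rn -> 'cV[R]_(dx pb)) : mvec u -> measurable_fun setT (fun w => Phi pb (u w)).
Proof.
apply: continuous_mvec => v; apply: (hasgrad_continuous (f := Phi pb) (G := grad (Phi pb))).
by move=> v'; rewrite (grad_Phi asm); exact: hasgrad_Phi asm _.
Qed.

Lemma measurable_gaps :
  [/\ measurable_fun setT (fun w => Phi pb (xs (iter k w))),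
      measurable_fun setT (fun w => gapx (iter k w)),
      measurable_fun setT (fun w => gapy (iter k w)) &
      measurable_fun setT (fun w => gapz (iter k w))].
Proof.
have Mx := mout_mvec fr mx; have My := mout_mvec fr my.
have Mz := mout_mvec fr mz; have Mh := mout_mvec fr mh.
split.
- exact: measPhi.
- by apply: measurable_norm2_sqr; apply: mvecB => //; exact: lip1_mvec lipP _.
- by apply: measurable_norm2_sqr; apply: mvecB => //; exact: lip1_mvec lipy _.
- by apply: measurable_norm2_sqr; apply: mvecB => //; exact: lip1_mvec lipz _.
Qed.

Let x'E w : norm2 (x w - x' w) ^+ 2 = alpha p ^+ 2 * norm2 (h w) ^+ 2.
Proof. by rewrite /x' subKr norm2Z_sqr. Qed.

(** Polarization makes |grad Phi|^2 and |h|^2 appear with a favourable sign against the gap of h;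
    alpha <= 1/(2 LPhi) lets the quadratic term take only half of |h|^2. *)
Lemma Phi_step w :
  2 / alpha p * Phi pb (x' w) + norm2 (grad (Phi pb) (x w)) ^+ 2 + 2^-1 * norm2 (h w) ^+ 2
  <= 2 / alpha p * Phi pb (x w) + gapx (iter k w).
Proof.
have D := Phi_descent asm (x w) (- (alpha p *: h w)).
rewrite norm2N norm2Z_sqr dotNr dotZr -/(x' w) in D.
have := ler_wpM2l (ltW (divr_gt0 (ltr0n _ 2) al0) : 0 <= 2 / alpha p) D.
have -> : 2 / alpha p * (Phi pb (x w) + - (alpha p * dot (grad (Phi pb) (x w)) (h w))
   + LPhi / 2 * (alpha p ^+ 2 * norm2 (h w) ^+ 2)) =
   2 / alpha p * Phi pb (x w) - 2 * dot (grad (Phi pb) (x w)) (h w)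
   + LPhi * alpha p * norm2 (h w) ^+ 2.
  by field; rewrite gt_eqF.
have -> : gapx (iter k w) = norm2 (h w) ^+ 2 - 2 * dot (grad (Phi pb) (x w)) (h w)
    + norm2 (grad (Phi pb) (x w)) ^+ 2.
  by rewrite /gapx norm2D_sqr norm2N dotNr dotC mulrN.
have : LPhi * alpha p * norm2 (h w) ^+ 2 <= 2^-1 * norm2 (h w) ^+ 2.
  rewrite ler_wpM2r ?sqr_ge0 // mulrC.
  by move: hal; rewrite ler_pdivlMr ?mulr_gt0 //; lra.
lra.
Qed.

Lemma drift_x w :
  norm2 ((1 - theta p) *: h w - grad (Phi pb) (x' w) + theta p *: davg_x (x w) (y w) (z w)) ^+ 2
  <= (1 - theta p) * gapx (iter k w)
   + 2 * theta p * (3 * L2 * gapy (iter k w) + 3 * Lg ^+ 2 * gapz (iter k w))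
   + 2 / theta p * (LPhi ^+ 2 * (alpha p ^+ 2 * norm2 (h w) ^+ 2)).
Proof.
set D := davg_x _ _ _; set G := grad (Phi pb) (x w); set G' := grad (Phi pb) (x' w).
(* Old gap, bias of the mean direction, and motion of the gradient: the first is contracted by 1 -
   theta, the other two enter as the perturbation with weight theta. *)
have -> : (1 - theta p) *: h w - G' + theta p *: D =
   (1 - theta p) *: (h w - G) + (theta p *: (D - G) + (G - G')).
  move: (h w) => H; move: D G G'; clear=> D G G'.
  by apply/matrixP => i j; rewrite !mxE; ring.
have th1 : 0 < theta p <= 1 by rewrite th0.
apply: le_trans (norm2_convex_le (a := norm2 (h w - G)) _ th1 _) _.
  by rewrite norm2Z ger0_norm // subr_ge0.
rewrite -/(gapx (iter k w)) -addrA lerD2l.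
have B := bias_le asm (x w) (y w) (zr w); rewrite -/D -/G -/L2 in B.
have GG : norm2 (G - G') ^+ 2 <= LPhi ^+ 2 * (alpha p ^+ 2 * norm2 (h w) ^+ 2).
  rewrite -x'E -exprMn ler_pXn2r ?nnegrE ?mulr_ge0 ?(ltW LP0) //; exact: lipP.
have S := norm2D_sqr_le (theta p *: (D - G)) (G - G').
clearbody D G G'; rewrite (norm2Z_sqr (theta p) (D - G)) in S.
apply: (@le_trans _ _ ((theta p)^-1 * (2 * (theta p ^+ 2 * norm2 (D - G) ^+ 2 + norm2 (G - G') ^+ 2)))).
  by rewrite ler_wpM2l ?invr_ge0 ?(ltW th0).
have -> : (theta p)^-1 * (2 * (theta p ^+ 2 * norm2 (D - G) ^+ 2 + norm2 (G - G') ^+ 2)) =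
  2 * theta p * norm2 (D - G) ^+ 2 + 2 / theta p * norm2 (G - G') ^+ 2.
  by field; rewrite gt_eqF.
apply: lerD; apply: ler_wpM2l => //; first by rewrite mulr_ge0 // ltW.
by rewrite divr_ge0 // ltW.
Qed.

Lemma variance_le n (d : 'I_N -> Om rn -> 'cV[R]_n) (s w q : R) : 0 <= w ->
  (forall i, esq (d i) <= q%:E)%E ->
  ((N%:R^-1 ^+ 2)%:E * \sum_(i < N) (s%:E + w%:E * (esq (d i) + s%:E)) <=
   (N%:R^-1 * ((1 + w) * s + w * q))%:E)%E.
Proof.
move=> w0 hd.
have -> : (N%:R^-1 * ((1 + w) * s + w * q))%:E =
    ((N%:R^-1 ^+ 2)%:E * \sum_(i < N) ((1 + w) * s + w * q)%:E)%E.
  rewrite sumEFin sumr_const card_ord -EFinM -mulr_natr; congr (_%:E).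
  by field; rewrite gt_eqF.
apply: lee_wpmul2l; first by rewrite lee_fin sqr_ge0.
apply: lee_sum => i _.
have -> : ((1 + w) * s + w * q)%:E = (s%:E + w%:E * (q%:E + s%:E))%E.
  by transitivity (s + w * (q + s))%:E => //; congr (_%:E); ring.
by apply: leeD2l; apply: lee_wpmul2l; [rewrite lee_fin|apply: leeD2r].
Qed.

Section Means.
Variables (vP vh vy vz : R).
Hypothesis mm : has_means k vP vh vy vz.

Let fP : finmean (fun w => Phi pb (x w)) vP. Proof. by case: mm. Qed.
Let fh : finmean (fun w => gapx (iter k w)) vh. Proof. by case: mm. Qed.
Let fy : finmean (fun w => gapy (iter k w)) vy. Proof. by case: mm. Qed.
Let fz : finmean (fun w => gapz (iter k w)) vz. Proof. by case: mm. Qed.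
Let Phi0 v : 0 <= Phi pb v. Proof. by case: asm => _ _ _ _ [_]; exact. Qed.

Let ai : 0 <= 2 / alpha p. Proof. by rewrite divr_ge0 // ltW. Qed.

(** As [Phi] is nonnegative, every term on the left of [Phi_step] is dominated by the right side,
    whose mean is finite by induction. *)
Lemma Phi_means : exists vP' vg vH,
  [/\ finmean (fun w => Phi pb (x' w)) vP', finmean (fun w => norm2 (grad (Phi pb) (x w)) ^+ 2) vg,
      finmean (fun w => norm2 (h w) ^+ 2) vH
    & 2 / alpha p * vP' + vg + 2^-1 * vH <= 2 / alpha p * vP + vh].
Proof.
have fY := finmeanD (finmeanZ ai fP) fh.
have Mx := mout_mvec fr mx; have Mh := mout_mvec fr mh.
have P0 w : 0 <= 2 / alpha p * Phi pb (x' w) by rewrite mulr_ge0.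
have G0 w := sqr_ge0 (norm2 (grad (Phi pb) (x w))).
have H0 w := sqr_ge0 (norm2 (h w)).
have [vP' fP' _] : exists2 u, finmean (fun w => Phi pb (x' w)) u & u <= alpha p / 2 * (2 / alpha p * vP + vh).
  apply: (finmean_dom _ _ _ (finmeanZ (_ : 0 <= alpha p / 2) fY)).
  - by apply: measPhi; exact: (mout_mvec fr mx').
  - by [].
  - move=> w; rewrite -ler_pdivrMl ?divr_gt0 // invf_div.
    by have := Phi_step w; have := G0 w; have := H0 w; lra.
  - by rewrite divr_ge0 // ltW.
have [vg fg _] : exists2 u, finmean (fun w => norm2 (grad (Phi pb) (x w)) ^+ 2) u & u <= 2 / alpha p * vP + vh.
  apply: (finmean_dom _ _ _ fY).
  - by apply: measurable_norm2_sqr; exact: lip1_mvec lipP _.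
  - by [].
  - by move=> w; have := Phi_step w; have := P0 w; have := H0 w; lra.
have [vH fH _] : exists2 u, finmean (fun w => norm2 (h w) ^+ 2) u & u <= 2 * (2 / alpha p * vP + vh).
  apply: (finmean_dom _ _ _ (finmeanZ (ler0n _ 2) fY)) => //.
  - exact: measurable_norm2_sqr.
  - by move=> w; have := Phi_step w; have := P0 w; have := G0 w; lra.
exists vP', vg, vH; split => //.
apply: (finmean_le (finmeanD (finmeanD (finmeanZ ai fP') fg) (finmeanZ _ fH)) fY Phi_step).
by rewrite invr_ge0.
Qed.

Variables (vg vH : R).
Hypothesis fg : finmean (fun w => norm2 (grad (Phi pb) (x w)) ^+ 2) vg.
Hypothesis fH : finmean (fun w => norm2 (h w) ^+ 2) vH.

Let c0 n (a : R) : 0 <= a -> 0 <= n%:R * a. Proof. by move=> ?; rewrite mulr_ge0. Qed.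
Let Lg20 : 0 <= Lg ^+ 2. Proof. exact: sqr_ge0. Qed.
Let al20 : 0 <= alpha p ^+ 2. Proof. exact: sqr_ge0. Qed.
Let gx0 s : 0 <= gapx (pb := pb) s. Proof. exact: sqr_ge0. Qed.
Let gy0 s : 0 <= gapy (pb := pb) s. Proof. exact: sqr_ge0. Qed.
Let gz0 s : 0 <= gapz (pb := pb) s. Proof. exact: sqr_ge0. Qed.

Let esq_le n (u : Om rn -> 'cV[R]_n) Y v : finmean Y v ->
  (forall w, norm2 (u w) ^+ 2 <= Y w) -> (esq u <= v%:E)%E.
Proof.
move=> [_ _ <-] uY; apply: le_integral_ge0 => w; first by rewrite lee_fin sqr_ge0.
by rewrite lee_fin.
Qed.

Let fc c : 0 <= c -> finmean (fun=> c) c. Proof. exact: finmean_cst. Qed.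

(** A new gap is |a + c X|^2 with [a] fixed by the past and [X] a compressed direction. Asking only
    for [Z] below it leaves room for the projection of z. *)
Let noisy_esq n (X m a : Om rn -> 'cV[R]_n) (c B e : R) B' (Z : Om rn -> R) :
  noisy (from k) X m B' -> (B' <= B%:E)%E -> mout (from k) a ->
  (esq (fun w => (a w + c *: m w)%R) <= e%:E)%E ->
  measurable_fun setT Z -> (forall w, 0 <= Z w) ->
  (forall w, Z w <= norm2 (a w + c *: X w) ^+ 2) ->
  exists2 v, finmean Z v & v <= e + c ^+ 2 * B.
Proof.
move=> nX BB ma he mZ Z0 ZX; apply: finmean_ex => //.
apply: le_trans (_ : (esq (fun w => (a w + c *: X w)%R) <= _)%E).
  by apply: le_integral_ge0 => w; rewrite lee_fin.
apply: le_trans (nX a c ma) _; rewrite EFinD; apply: leeD => //.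
by rewrite [X in (_ <= X)%E]EFinM; apply: lee_wpmul2l => //; rewrite lee_fin sqr_ge0.
Qed.

Lemma gapx_mean (mG : measurable_fun setT (fun w => gapx (iter k.+1 w))) : exists2 vh', finmean (fun w => gapx (iter k.+1 w)) vh' &
  vh' <= (1 - theta p) * vh + 2 * theta p * (3 * L2 * vy + 3 * Lg ^+ 2 * vz)
  + 2 / theta p * (LPhi ^+ 2 * (alpha p ^+ 2 * vH))
  + theta p ^+ 2 * (N%:R^-1 * ((1 + wu) * sg21 + wu * (6 * rho p ^+ 2 * bg ^+ 2 + 6 * bf ^+ 2
     + 3 * vg + 9 * L2 * vy + 9 * Lg ^+ 2 * vz))).
Proof.
apply: (noisy_esq (a := fun w => (1 - theta p) *: h w - grad (Phi pb) (x' w))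
  (noisy_hatDx asm fr rd0 pp zs0 (k := k))).
- apply: variance_le => // i.
  apply: esq_le (fun w => dloc_x_le asm (x w) (y w) (zr w) i).
  have r0 : 0 <= 6 * rho p ^+ 2 * bg ^+ 2 by rewrite -mulrA -exprMn mulr_ge0 ?sqr_ge0.
  have b0 : 0 <= 6 * bf ^+ 2 by rewrite mulr_ge0 ?sqr_ge0.
  exact: (finmeanD (finmeanD (finmeanD (finmeanD (fc r0) (fc b0)) (finmeanZ (ler0n _ 3) fg))
    (finmeanZ (c0 9 L20) fy)) (finmeanZ (c0 9 Lg20) fz)).
- by apply: mvecB; [exact: mvecZl|exact: lip1_mvec lipP _].
- apply: esq_le drift_x.
  have t1 : 0 <= 1 - theta p by rewrite subr_ge0.
  have t2 : 0 <= 2 / theta p by rewrite divr_ge0 // ltW.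
  exact: (finmeanD (finmeanD (finmeanZ t1 fh) (finmeanZ (c0 2 (ltW th0))
    (finmeanD (finmeanZ (c0 3 L20) fy) (finmeanZ (c0 3 Lg20) fz))))
    (finmeanZ t2 (finmeanZ (sqr_ge0 _) (finmeanZ al20 fH)))).
- exact: mG.
- by [].
- by move=> w /=; rewrite /gapx /= [X in X <= _](_ : _ = norm2 ((1 - theta p) *: h w - grad (Phi pb) (x' w) +
    theta p *: hatDx omu k (iter k w) w) ^+ 2) // addrAC.
Qed.

Lemma gapy_mean (mG : measurable_fun setT (fun w => gapy (iter k.+1 w))) : exists2 vy', finmean (fun w => gapy (iter k.+1 w)) vy' &
  vy' <= (1 - beta p * mu) * vy + (beta p * mu)^-1 * (Ly ^+ 2 * (alpha p ^+ 2 * vH))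
  + beta p ^+ 2 * (N%:R^-1 * ((1 + wl) * sg2 + wl * (2 * Lg ^+ 2 * vy + 2 * bg ^+ 2))).
Proof.
have b1 : beta p * ((mu + Lg) / 2) <= 1.
  have L : 0 < (mu + Lg) / 2 by rewrite divr_gt0 // addr_gt0.
  by rewrite -ler_pdivlMr // div1r invf_div ltW.
have bm : 0 <= 1 - beta p * mu.
  rewrite subr_ge0; apply: le_trans b1; rewrite ler_pM2l //.
  by move: muL; lra.
rewrite -[beta p ^+ 2 * (N%:R^-1 * _)](congr1 (fun t => t * _) (sqrrN (beta p))).
apply: (noisy_esq (a := fun w => y w - ystar pb (x' w)) (noisy_hatDy s0 asm fr rd0 pp (k := k))).
- apply: variance_le => // i.
  apply: esq_le (fun w => dloc_y_le asm (x w) (y w) i).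
  have b0 : 0 <= 2 * bg ^+ 2 by rewrite mulr_ge0 ?sqr_ge0.
  exact: (finmeanD (finmeanZ (c0 2 Lg20) fy) (fc b0)).
- by apply: mvecB => //; exact: lip1_mvec lipy _.
- apply: (esq_le (Y := fun w => (1 - beta p * mu) * gapy (iter k w) +
      (beta p * mu)^-1 * (Ly ^+ 2 * (alpha p ^+ 2 * norm2 (h w) ^+ 2)))).
    have bi : 0 <= (beta p * mu)^-1 by rewrite invr_ge0 mulr_ge0 // ltW.
    exact: (finmeanD (finmeanZ bm fy) (finmeanZ bi (finmeanZ (sqr_ge0 _) (finmeanZ al20 fH)))).
  move=> w; rewrite scaleNr addrAC -x'E.
  exact: (y_step_le asm (x w) (y w) (x' w) be0 b1).
- exact: mG.
- by [].
- by move=> w /=; rewrite /gapy /= scaleNr addrAC.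
Qed.

Lemma gapz_mean (mG : measurable_fun setT (fun w => gapz (iter k.+1 w))) : exists2 vz', finmean (fun w => gapz (iter k.+1 w)) vz' &
  vz' <= (1 - gamma p * mu) * vz
  + (gamma p * mu)^-1 * (2 * (2 * gamma p ^+ 2 * L1 * vy + Lz ^+ 2 * (alpha p ^+ 2 * vH)))
  + gamma p ^+ 2 * (N%:R^-1 * ((1 + wl) * sg21 + wl * (4 * rho p ^+ 2 * bg ^+ 2 + 4 * bf ^+ 2
     + 8 * L1 * vy + 4 * Lg ^+ 2 * vz))).
Proof.
have g1 : gamma p * Lg <= 1 by move: hga; rewrite ler_pdivlMr.
have gm : 0 <= 1 - gamma p * mu.
  by rewrite subr_ge0; apply: le_trans g1; rewrite ler_pM2l.
rewrite -[gamma p ^+ 2 * (N%:R^-1 * _)](congr1 (fun t => t * _) (sqrrN (gamma p))).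
apply: (noisy_esq (a := fun w => z w - zstar pb (x' w)) (noisy_hatDz asm fr rd0 pp zs0 (k := k))).
- apply: variance_le => // i.
  apply: esq_le (fun w => dloc_z_le asm (x w) (y w) (zr w) i).
  have r0 : 0 <= 4 * rho p ^+ 2 * bg ^+ 2 by rewrite -mulrA -exprMn mulr_ge0 ?sqr_ge0.
  have b0 : 0 <= 4 * bf ^+ 2 by rewrite mulr_ge0 ?sqr_ge0.
  exact: (finmeanD (finmeanD (finmeanD (fc r0) (fc b0))
    (finmeanZ (c0 8 L10) fy)) (finmeanZ (c0 4 Lg20) fz)).
- by apply: mvecB => //; exact: lip1_mvec lipz _.
- apply: (esq_le (Y := fun w => (1 - gamma p * mu) * gapz (iter k w) +
      (gamma p * mu)^-1 * (2 * (2 * gamma p ^+ 2 * L1 * gapy (iter k w) +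
      Lz ^+ 2 * (alpha p ^+ 2 * norm2 (h w) ^+ 2))))).
    have gi : 0 <= (gamma p * mu)^-1 by rewrite invr_ge0 mulr_ge0 // ltW.
    have g2 : 0 <= 2 * gamma p ^+ 2 * L1 by rewrite mulr_ge0 // mulr_ge0 // sqr_ge0.
    exact: (finmeanD (finmeanZ gm fz) (finmeanZ gi (finmeanZ (ler0n _ 2)
      (finmeanD (finmeanZ g2 fy) (finmeanZ (sqr_ge0 _) (finmeanZ al20 fH)))))).
  move=> w; rewrite scaleNr addrAC -x'E.
  exact: (z_step_le asm (x w) (y w) (zr w) (x' w) ga0 g1).
- exact: mG.
- by [].
- move=> w /=; rewrite /gapz /= scaleNr addrAC ler_pXn2r ?nnegrE //.
  by apply: proj_ball_dist => //; apply: le_trans hrho; exact: zstar_le asm _.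
Qed.

End Means.
End AtStep.

Lemma lyapunov_decrease k vP vh vy vz : has_means k vP vh vy vz ->
  exists vg vP' vh' vy' vz', [/\ has_means k.+1 vP' vh' vy' vz',
    finmean (fun w => norm2 (grad (Phi pb) (xs (iter k w))) ^+ 2) vg &
    lyapunov vP' vh' vy' vz' + 2^-1 * vg <= lyapunov vP vh vy vz + step_noise].
Proof.
move=> mm; have [_ _ fy fz] := mm.
have [vP' [vg [vH [fP' fg fH hp]]]] := Phi_means mm.
have [_ M1 M2 M3] := measurable_gaps k.+1.
have [vh' fh' hh] := gapx_mean mm fg fH M1.
have [vy' fy' hy] := gapy_mean mm fH M2.
have [vz' fz' hz] := gapz_mean mm fH M3.
exists vg, vP', vh', vy', vz'; split => //.
have := lyapunov_step mu0 muL L10 L20 N0 wu0 wl0 be0 ga0 th0 s20 s210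
  (sqr_ge0 (rho p)) (sqr_ge0 bg) (sqr_ge0 bf) be_le ga_le th_le al_le
  (finmean_ge0 fy) (finmean_ge0 fz) (finmean_ge0 fg) (finmean_ge0 fH) hp hh hy hz.
by [].
Qed.

Lemma lyapunov_sum K : exists vP vh vy vz S, [/\ has_means K vP vh vy vz,
    (\sum_(k < K) mean_sq (Pr rn) (fun w => norm2 (grad (Phi pb) (xs (iter k w)))) = S%:E)%E &
    lyapunov vP vh vy vz + 2^-1 * S <=
    lyapunov (Phi pb (xs s0)) (gapx s0) (gapy s0) (gapz s0) + K%:R * step_noise].
Proof.
elim: K => [|K [vP [vh [vy [vz [S [mm eS IH]]]]]]].
  exists (Phi pb (xs s0)), (gapx s0), (gapy s0), (gapz s0), 0; split.
  - have P0 : 0 <= Phi pb (xs s0) by case: asm => _ _ _ _ [_]; exact.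
    have gx0 : 0 <= gapx s0 by exact: sqr_ge0.
    have gy0 : 0 <= gapy s0 by exact: sqr_ge0.
    have gz0 : 0 <= gapz s0 by exact: sqr_ge0.
    by split; [exact: (finmean_cst (Pr rn) P0)|exact: (finmean_cst (Pr rn) gx0)
      |exact: (finmean_cst (Pr rn) gy0)|exact: (finmean_cst (Pr rn) gz0)].
  - by rewrite big_ord0.
  - by rewrite mulr0 mul0r.
have [vg [vP' [vh' [vy' [vz' [mm' fg le]]]]]] := lyapunov_decrease mm.
exists vP', vh', vy', vz', (S + vg); split => //.
  rewrite big_ord_recr /= eS mean_sqE; case: fg => _ _ ->; by [].
by rewrite -[K.+1%:R]natr1 mulrDl mul1r; move: IH le; lra.
Qed.

Lemma avg_sqgrad_le K : (0 < K)%N ->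
  (avg_sqgrad omu oml rn p s0 K <=
   (2 / K%:R * lyapunov (Phi pb (xs s0)) (gapx s0) (gapy s0) (gapz s0) + 2 * step_noise)%:E)%E.
Proof.
move=> K0; have Kp : 0 < K%:R :> R by rewrite ltr0n.
have [vP [vh [vy [vz [S [[fP fh fy fz] eS le]]]]]] := lyapunov_sum K.
have A0 : 0 <= A.
  by rewrite /Lcomb -/L1 -/L2 addr_ge0 // mulr_ge0 // mulr_ge0 // sqr_ge0.
have V0 : 0 <= lyapunov vP vh vy vz.
  have := finmean_ge0 fP; have := finmean_ge0 fh; have := finmean_ge0 fy; have := finmean_ge0 fz.
  move=> *; rewrite /lyapunov; do 3?apply: addr_ge0.
  - by rewrite mulr_ge0 // divr_ge0 // ltW.
  - by rewrite divr_ge0 // ltW.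
  - by rewrite mulr_ge0 // divr_ge0 ?mulr_ge0 // ltW.
  - by rewrite mulr_ge0 // divr_ge0 ?mulr_ge0 ?sqr_ge0 // ltW.
rewrite /avg_sqgrad eS -EFinM lee_fin.
set V := lyapunov (Phi pb _) _ _ _ in le *.
have -> : 2 / K%:R * V + 2 * step_noise = K%:R^-1 * (2 * (V + K%:R * step_noise)).
  by field; rewrite gt_eqF.
by rewrite ler_wpM2l ?invr_ge0 ?(ltW Kp) //; lra.
Qed.

Lemma convergence_bound K : (0 < K)%N ->
  (avg_sqgrad omu oml rn p s0 K <=
      (4 * Phi pb (xs s0) / (K%:R * alpha p)
       + 2 * gapx s0 / (K%:R * theta p)
       + 26 * A * gapy s0 / (mu * K%:R * beta p)
       + 52 * Lg ^+ 2 * gapz s0 / (mu * K%:R * gamma p)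
       + 52 * (1 + wl) * A * beta p / (mu * N%:R) * sg2
       + (2 * (1 + wu) * theta p / N%:R
          + 78 * Lg ^+ 2 * (1 + wl) * gamma p / (mu * N%:R)) * sg21
       + (12 * rho p ^+ 2 * wu * theta p / N%:R
          + 104 * A * wl * beta p / (N%:R * mu)
          + 312 * Lg ^+ 2 * rho p ^+ 2 * wl * gamma p / (N%:R * mu)) * bg ^+ 2
       + (12 * wu * theta p / N%:R
          + 312 * Lg ^+ 2 * wl * gamma p / (N%:R * mu)) * bf ^+ 2)%:E)%E.
Proof.
move=> K0; apply: le_trans (avg_sqgrad_le K0) _; rewrite lee_fin le_eqVlt.
apply/orP; left; apply/eqP; rewrite /lyapunov /step_noise.
set n := N%:R; set k := K%:R.
have : n != 0 by rewrite gt_eqF.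
have : k != 0 by rewrite gt_eqF // ltr0n.
have : mu != 0 by rewrite gt_eqF.
have : alpha p != 0 by rewrite gt_eqF.
have : beta p != 0 by rewrite gt_eqF.
have : gamma p != 0 by rewrite gt_eqF.
have : theta p != 0 by rewrite gt_eqF.
move: (Phi pb (xs s0)) (gapx s0) (gapy s0) (gapz s0) A wu wl sg2 sg21.
move: (alpha p) (beta p) (gamma p) (theta p) (rho p) n k.
move=> al be ga th r n k vP vx vy vz a u l s1 s2 h1 h2 h3 h4 h5 h6 h7.
by field; rewrite h1 h2 h3 h4 h5 h6 h7.
Qed.

End OneStep.

(** * Choice of the parameters *)

Section CompressionRounds.
Context {R : realType}.

(** With q = om/(1 + om), [om_msc] equals (1 + om) q^rd, and q <= exp(-1/(1 + om)); 4 W ln X rounds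
    bring q^rd below X^-4. *)
Lemma om_msc_decay (om W X : R) rd : 0 <= om -> 1 + om <= W -> 1 <= X -> (0 < rd)%N ->
  4 * W * ln X <= rd%:R -> om_msc om rd <= W / X ^+ 4.
Proof.
move=> om0 omW X1 rd0 h.
have p0 : 0 < 1 + om by rewrite ltr_wpDr.
have W0 : 0 < W by apply: lt_le_trans omW.
have X0 : 0 < X by apply: lt_le_trans X1.
have -> : om_msc om rd = (1 + om) * (om / (1 + om)) ^+ rd.
  rewrite /om_msc -{2}(prednK rd0) exprS mulrA; congr (_ * _).
  by field; rewrite gt_eqF.
apply: ler_pM => //; [exact: ltW|by rewrite exprn_ge0 // divr_ge0 // ltW|].
have q1 : om / (1 + om) <= expR (- (1 + om)^-1).
  apply: le_trans (expR_ge1Dx _); rewrite le_eqVlt; apply/orP; left; apply/eqP.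
  by field; rewrite gt_eqF.
apply: (@le_trans _ _ (expR (- (1 + om)^-1) ^+ rd)).
  by apply: lerXn2r; rewrite ?nnegrE ?expR_ge0 // divr_ge0 // ltW.
rewrite -expRM_natr.
have -> : (X ^+ 4)^-1 = expR (- (4%:R * ln X)).
  by rewrite expRN expRM_natl lnK.
rewrite ler_expR mulNr lerN2 [_^-1 * _]mulrC ler_pdivlMr //.
by apply: (le_trans _ h); rewrite mulrAC ler_wpM2r ?ln_ge0 // ler_pM2l.
Qed.

(** For X >= 4, ln(1/X) <= 1/X - 1 gives ln X >= 3/4, so rounding up by less than 1 is covered by 2
    W ln X. *)
Lemma rounds_bounds (W X : R) rd : 1 <= W -> 4 <= X ->
  rd%:Z = Num.ceil (4 * W * ln X) ->
  [/\ (0 < rd)%N, 4 * W * ln X <= rd%:R, rd%:R <= 6 * (W * ln X) & 0 <= ln X <= X].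
Proof.
move=> W1 X4 rdE.
have X0 : 0 < X by apply: lt_le_trans X4.
have l34 : 3 / 4 <= ln X.
  have h : X^-1 <= 4^-1 by rewrite lef_pV2 ?posrE.
  have : ln (1 + (X^-1 - 1)) <= X^-1 - 1.
    by apply: le_ln1Dx; rewrite ltrBrDl subrr invr_gt0.
  by rewrite subrKC lnV ?posrE //; lra.
have Wl : 3 / 4 <= W * ln X.
  by apply: (@le_trans _ _ (1 * ln X)); [rewrite mul1r|rewrite ler_wpM2r // (le_trans _ l34)].
have e : (Num.ceil (4 * W * ln X))%:~R = rd%:R :> R by rewrite -rdE.
have h1 := ceil_ge (4 * W * ln X); rewrite e in h1.
have h2 := ceilB1_lt (4 * W * ln X); rewrite intrB e in h2.
split => //.
- by rewrite -(ltr0n R); apply: lt_le_trans h1; rewrite -mulrA; lra.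
- by move: h2; rewrite -mulrA /=; lra.
- by rewrite (le_trans _ l34) //= ltW // ln_sublinear.
Qed.

(* [om_msc <= W / X^4], while [X >= 4 W] and [X >= (W B / sigma^2)^2] by the
   choice of [X]. *)
Lemma om_msc_small (om W B sigma X : R) rd : 0 < sigma -> 0 <= B -> 0 <= om -> 1 + om <= W ->
  X = 4 * W + W ^+ 2 * B ^+ 2 / sigma ^+ 4 ->
  rd%:Z = Num.ceil (4 * W * ln X) ->
  om_msc om rd <= 1 /\ om_msc om rd * B <= sigma ^+ 2 / rd%:R.
Proof.
move=> s0 B0 om0 omW XE rdE.
have W1 : 1 <= W by lra.
have W0 : 0 < W by lra.
pose t := W * B / sigma ^+ 2.
have t0 : 0 <= t by apply: divr_ge0; [rewrite mulr_ge0 // ltW|exact: sqr_ge0].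
have XE' : X = 4 * W + t ^+ 2.
  by rewrite XE /t; field; rewrite gt_eqF.
have t2 : 0 <= t ^+ 2 by exact: sqr_ge0.
have X4 : 4 <= X by lra.
have X0 : 0 < X by lra.
have [rd0 h1 h2 /andP[l0 lX]] := rounds_bounds W1 X4 rdE.
have X1 : 1 <= X by lra.
have D := om_msc_decay om0 omW X1 rd0 h1.
have Xn0 n : 0 < X ^+ n by rewrite exprn_gt0.
(* From t^2 <= X and X >= 4, which gives X <= X^2 / 4. *)
have tX : t <= X / 2.
  rewrite -(ler_pXn2r (n := 2)) ?nnegrE //; last by rewrite divr_ge0 // ltW.
  have : X * 4 <= X * X by rewrite ler_pM2l.
  have -> : (X / 2) ^+ 2 = X * X / 4 by field.
  lra.
have X4X : X <= X ^+ 4 by rewrite -[X in X <= _]expr1; apply: ler_weXn2l.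
split; first by apply: le_trans D _; rewrite ler_pdivrMr // mul1r; apply: le_trans X4X; lra.
have rdp : 0 < rd%:R :> R by rewrite ltr0n.
rewrite ler_pdivlMr //.
have WB : W * B = t * sigma ^+ 2 by rewrite /t divfK // gt_eqF // exprn_gt0.
(* The logarithm in [rd] is bounded by X. With W <= X/4 and t <= X/2 the product is at most 6
   (X/4)(X/2)/X^3 sigma^2 <= sigma^2. *)
apply: (@le_trans _ _ (W / X ^+ 4 * B * (6 * (W * X)))).
  apply: ler_pM => //.
  - by rewrite mulr_ge0 // om_msc_ge0.
  - by rewrite ler_wpM2r.
  - by apply: le_trans h2 _; rewrite ler_pM2l // ler_pM2l.
have -> : W / X ^+ 4 * B * (6 * (W * X)) = 6 * W * t / X ^+ 3 * sigma ^+ 2.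
  have -> : W / X ^+ 4 * B * (6 * (W * X)) = 6 * W * (W * B) / X ^+ 3.
    by field; rewrite gt_eqF.
  by rewrite WB; ring.
rewrite ler_piMl ?sqr_ge0 // ler_pdivrMr // mul1r.
apply: (@le_trans _ _ (6 * (X / 4) * (X / 2))).
  by apply: ler_pM => //; [rewrite mulr_ge0 // ltW|lra].
have : X ^+ 2 * 1 <= X ^+ 2 * X by rewrite ler_pM2l.
rewrite mulr1 -exprSr -[X ^+ 2]/(X * X) => H; apply: le_trans H.
have := mulr_gt0 X0 X0; lra.
Qed.

End CompressionRounds.

(** The part [S] of 1/st balances the initial term Dv/(K st) against the noise st V/n, both then of
    order [E]; [P] serves the stability conditions and costs a multiple of D/K, hence of [F]. The
    ratio [r] appears because [S] is tuned to the single gap [Dv] while the rate uses [D]. *)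
Lemma step_rate (R : realType) (n K s D E F Dv V kap c r P Pm S st : R) :
  0 < n -> 0 < K -> 0 < Dv -> Dv <= D -> D <= r * Dv ->
  0 <= E -> E ^+ 2 = D * s / (n * K) -> 0 <= F -> D / K <= 6 * F ->
  0 < V -> 0 <= s -> 0 <= c -> V <= c * s -> 1 <= kap -> kap <= 4 -> 0 <= P <= Pm ->
  S ^+ 2 = kap * K * V / (n * Dv) -> 0 <= S -> st = (P + S)^-1 ->
  D / K / st <= (6 * Pm + 2 * r * Num.sqrt c) * (E + F) /\
  st * V / n <= 2 * Num.sqrt c * (E + F).
Proof.
move=> n0 K0 Dv0 DvD Dr E0 E2 F0 DF V0 s0 c0 Vc k1 k4 /andP[P0 PPm] S2 S0 ->.
have D0 : 0 < D by apply: lt_le_trans DvD.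
have kap0 : 0 < kap by lra.
have r0 : 0 <= r.
  have : 0 < r * Dv by apply: lt_le_trans Dr.
  by rewrite pmulr_lgt0 // => /ltW.
have Sp : 0 < S.
  rewrite lt_def S0 andbT; apply/negP => /eqP z.
  move: S2; rewrite z expr0n /= => /esym/eqP; rewrite gt_eqF //.
  by rewrite divr_gt0 ?mulr_gt0.
have nK : 0 < n * K by rewrite mulr_gt0.
have sc := sqrtr_ge0 c.
have VD : V * Dv <= c * (D * s).
  by rewrite [D * s]mulrC mulrA; apply: ler_pM => //; exact: ltW.
have e2 : (2 * Num.sqrt c * E) ^+ 2 = 4 * (c * (D * s)) / (n * K).
  by rewrite !exprMn sqr_sqrtr // E2; ring.
have e20 : 0 <= 2 * Num.sqrt c * E by rewrite mulr_ge0 // mulr_ge0.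
have h1 : Dv / K * S <= 2 * Num.sqrt c * E.
  rewrite -(ler_pXn2r (n := 2)) ?nnegrE //; last first.
    by rewrite mulr_ge0 // divr_ge0 // ltW.
  rewrite e2 exprMn S2.
  have -> : (Dv / K) ^+ 2 * (kap * K * V / (n * Dv)) = kap * (V * Dv) / (n * K).
    by field; rewrite !gt_eqF.
  rewrite ler_pM2r ?invr_gt0 //; apply: ler_pM => //; first exact: ltW.
  by rewrite mulr_ge0 // ltW.
have h2 : V / (n * S) <= 2 * Num.sqrt c * E.
  rewrite -(ler_pXn2r (n := 2)) ?nnegrE //; last first.
    by rewrite divr_ge0 ?mulr_ge0 // ltW.
  rewrite e2.
  have -> : (V / (n * S)) ^+ 2 = V * Dv / (kap * (n * K)).
    rewrite expr_div_n exprMn S2; field.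
    by rewrite !gt_eqF.
  have -> : V * Dv / (kap * (n * K)) = V * Dv / kap / (n * K) by field; rewrite !gt_eqF.
  rewrite ler_pM2r ?invr_gt0 // ler_pdivrMr //.
  apply: le_trans VD _.
  have cDs : 0 <= c * (D * s) by rewrite mulr_ge0 // mulr_ge0 // ltW.
  have : c * (D * s) * 1 <= c * (D * s) * kap by rewrite ler_wpM2l.
  rewrite mulr1; lra.
split.
- rewrite invrK mulrDr.
  have a1 : D / K * P <= 6 * F * Pm.
    by apply: ler_pM => //; rewrite divr_ge0 // ltW.
  have a2 : D / K * S <= r * (2 * Num.sqrt c * E).
    apply: le_trans (_ : r * (Dv / K * S) <= _); last by rewrite ler_wpM2l.
    by rewrite mulrA ler_wpM2r // mulrA ler_wpM2r // invr_ge0 ltW.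
  have a3 : 0 <= Pm * E by rewrite mulr_ge0 // (le_trans P0).
  have a4 : 0 <= r * (Num.sqrt c * F) by rewrite mulr_ge0 // mulr_ge0.
  have -> : (6 * Pm + 2 * r * Num.sqrt c) * (E + F) =
    6 * (Pm * E) + 6 * F * Pm + r * (2 * Num.sqrt c * E) + 2 * (r * (Num.sqrt c * F)) by ring.
  lra.
- apply: (@le_trans _ _ (V / (n * S))).
    have PS : 0 < P + S by rewrite ltr_wpDl.
    rewrite -mulrA mulrC invfM mulrA ler_wpM2l ?divr_ge0 ?(ltW V0) ?(ltW n0) //.
    by rewrite lef_pV2 ?posrE // lerDr.
  apply: le_trans h2 _; rewrite ler_wpM2l ?mulr_ge0 // lerDl //.
Qed.

Lemma inv_le_quot (R : realType) (a b P Q S : R) : 0 < a -> 0 <= b -> 0 < P -> 0 <= Q ->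
  b / a <= Q -> 0 <= S -> le_quot ((P + Q + S)^-1) a b.
Proof.
move=> a0 b0 P0 Q0 bQ S0; have [->|bn] := eqVneq b 0; [by left|right].
have bp : 0 < b by rewrite lt_def bn.
have Qp : 0 < b / a by rewrite divr_gt0.
rewrite -[a / b]invrK invf_div lef_pV2 ?posrE //; last by rewrite -addrA ltr_wpDr // addr_ge0.
by rewrite -addrA ler_wpDl ?(ltW P0) // ler_wpDr.
Qed.

(** Heterogeneity damped by [w] is no larger than the sampling noise [s]. The three updates use c =
    2, 4 and 6, whence the factors 4, 6 and 8. *)
Lemma noise_level (R : realType) (w s q c bf2 bg2 : R) : 0 <= w <= 1 -> 0 < s -> 0 <= q -> 0 <= c ->
  0 <= bf2 -> 0 <= bg2 -> w * bf2 <= s -> w * bg2 <= s ->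
  0 < (1 + w) * (s * (1 + q)) + c * w * bf2 + c * w * q * bg2 <= (2 + c) * (1 + q) * s.
Proof.
move=> /andP[w0 w1] s0 q0 c0 bf0 bg0 hf hg.
have sq0 : 0 < s * (1 + q) by rewrite mulr_gt0 // ltr_wpDr.
have h1 : w * (s * (1 + q)) <= 1 * (s * (1 + q)) by rewrite ler_wpM2r // ltW.
have h2 := ler_wpM2l c0 hf; have h3 := ler_wpM2l (mulr_ge0 c0 q0) hg.
have p1 : 0 <= w * (s * (1 + q)) by rewrite mulr_ge0 // ltW.
have p2 : 0 <= c * (w * bf2) by rewrite mulr_ge0 // mulr_ge0.
have p3 : 0 <= c * q * (w * bg2) by rewrite mulr_ge0 // mulr_ge0.
have -> : (1 + w) * (s * (1 + q)) + c * w * bf2 + c * w * q * bg2 =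
  s * (1 + q) + w * (s * (1 + q)) + c * (w * bf2) + c * q * (w * bg2) by ring.
have -> : (2 + c) * (1 + q) * s = 2 * (s * (1 + q)) + c * s + c * q * s by ring.
by apply/andP; split; lra.
Qed.

Lemma sqrt_sum3_le (R : realType) (a b c : R) : 0 <= a -> 0 <= b -> 0 <= c ->
  Num.sqrt (a ^+ 2 + b ^+ 2 + c ^+ 2) <= a + b + c.
Proof.
move=> a0 b0 c0; rewrite -[leRHS]ger0_norm ?addr_ge0 // -sqrtr_sqr ler_wsqrtr //.
have := mulr_ge0 a0 b0; have := mulr_ge0 a0 c0; have := mulr_ge0 b0 c0.
have -> : (a + b + c) ^+ 2 = a ^+ 2 + b ^+ 2 + c ^+ 2 + 2 * (a * b) + 2 * (a * c) + 2 * (b * c).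
  by ring.
lra.
Qed.

(** * Assembly of the rate *)

Section Rate.
Context {R : realType} (mu Cf Lf Lg Lgxy Lgyy LPhi Ly Lz : R).
Let r0 := Cf / mu.
Let A := Lcomb mu Lf Lg Lgxy Lgyy r0.
Let cx := Num.sqrt (8 * (1 + r0 ^+ 2)).
Let cy := Num.sqrt (4 : R).
Let cz := Num.sqrt (6 * (1 + r0 ^+ 2)).
(** Chosen with [cLz] so that (cLy/be)^2 and (cLz/ga)^2 are the last two summands of C2^-2; 52 = 2 *
    26 and 156 = 2 * 78. *)
Let cLy := Num.sqrt (52 * A) * Ly / mu.
Let cLz := Num.sqrt 156 * Lg * Lz / mu.

(* [cx], [cy], [cz] bound the noise levels of the three updates in units of
   [sigma^2 / rd]; the three products with [r] come from [step_rate], the first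
   term from [2 LPhi] in [1 / alpha]. *)
Definition rate_const (r : R) : R :=
  48 * LPhi
  + (8 * LPhi + 2) * (6 * 13 + 2 * r * cx)
  + (4 * cLy + 26 * A / mu) * (6 * ((mu + Lg) / 2 + 8 * Lg ^+ 2 / mu) + 2 * r * cy)
  + (4 * cLz + 52 * Lg ^+ 2 / mu) * (6 * (Lg + 36 * Lg ^+ 2 / mu) + 2 * r * cz)
  + 52 * A / mu * (2 * cy) + 78 * Lg ^+ 2 / mu * (2 * cz) + 2 * (2 * cx).

(** The term in 1/alpha reduces to the others: the square root in C2^-1 is at most the sum of the
    roots of its three summands, which are multiples of 1/th, 1/be and 1/ga. *)
Lemma rate_assembly (al be ga th n K P Dx Dy Dz D Vx Vy Vz Y r : R) :
  0 < mu -> 0 < Lg -> 0 < LPhi -> 0 < Ly -> 0 < Lz -> 0 <= A ->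
  0 < be -> 0 < ga -> 0 < th -> 0 < K -> 0 <= D ->
  0 <= P <= D -> 0 <= Dx <= D -> 0 <= Dy <= D -> 0 <= Dz <= D ->
  D / K <= 6 * Y ->
  al^-1 = 2 * LPhi + Num.sqrt (2 * (2 * LPhi ^+ 2 / th ^+ 2
    + 26 * A * Ly ^+ 2 / (be ^+ 2 * mu ^+ 2) + 78 * Lg ^+ 2 * Lz ^+ 2 / (ga ^+ 2 * mu ^+ 2))) ->
  D / K / th <= (6 * 13 + 2 * r * cx) * Y -> th * Vx / n <= 2 * cx * Y ->
  D / K / be <= (6 * ((mu + Lg) / 2 + 8 * Lg ^+ 2 / mu) + 2 * r * cy) * Y ->
  be * Vy / n <= 2 * cy * Y ->
  D / K / ga <= (6 * (Lg + 36 * Lg ^+ 2 / mu) + 2 * r * cz) * Y -> ga * Vz / n <= 2 * cz * Y ->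
  4 * (P / K * al^-1) + 2 * (Dx / K / th) + 26 * A / mu * (Dy / K / be)
  + 52 * Lg ^+ 2 / mu * (Dz / K / ga) + 52 * A / mu * (be * Vy / n)
  + 78 * Lg ^+ 2 / mu * (ga * Vz / n) + 2 * (th * Vx / n) <= rate_const r * Y.
Proof.
move=> mu0 Lg0 LP0 Ly0 Lz0 A0 be0 ga0 th0 K0 D0 /andP[P0 PD] /andP[x0 xD] /andP[y0 yD] /andP[z0 zD].
move=> hk alE hx hx' hy hy' hz hz'.
have cLy0 : 0 <= cLy by rewrite divr_ge0 ?mulr_ge0 ?sqrtr_ge0 // ltW.
have cLz0 : 0 <= cLz by rewrite divr_ge0 ?mulr_ge0 ?sqrtr_ge0 // ltW.
have DK0 : 0 <= D / K by rewrite divr_ge0 // ltW.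
have ale : al^-1 <= 2 * LPhi + (2 * LPhi / th + cLy / be + cLz / ga).
  rewrite alE lerD2l.
  have -> : 2 * (2 * LPhi ^+ 2 / th ^+ 2
    + 26 * A * Ly ^+ 2 / (be ^+ 2 * mu ^+ 2) + 78 * Lg ^+ 2 * Lz ^+ 2 / (ga ^+ 2 * mu ^+ 2)) =
    (2 * LPhi / th) ^+ 2 + (cLy / be) ^+ 2 + (cLz / ga) ^+ 2.
    rewrite /cLy /cLz !expr_div_n !exprMn !sqr_sqrtr ?mulr_ge0 //.
    by field; rewrite !gt_eqF.
  by apply: sqrt_sum3_le => //; apply: divr_ge0 => //; rewrite ?mulr_ge0 // ltW.
have mono u v : 0 <= u -> u <= D -> 0 < v -> u / K / v <= D / K / v.
  by move=> u0 uD v0; rewrite ler_wpM2r ?invr_ge0 ?(ltW v0) // ler_wpM2r // invr_ge0 ltW.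
have al0 : 0 <= al^-1 by rewrite alE addr_ge0 ?sqrtr_ge0 // mulr_ge0 // ltW.
have t1 : P / K * al^-1 <= 2 * LPhi * (D / K) + 2 * LPhi * (D / K / th)
    + cLy * (D / K / be) + cLz * (D / K / ga).
  apply: (@le_trans _ _ (D / K * (2 * LPhi + (2 * LPhi / th + cLy / be + cLz / ga)))).
    apply: ler_pM => //; first by rewrite divr_ge0 // ltW.
    by rewrite ler_wpM2r // invr_ge0 ltW.
  by rewrite le_eqVlt; apply/orP; left; apply/eqP; ring.
have a1 : 2 * LPhi * (D / K) <= 2 * LPhi * (6 * Y) by rewrite ler_wpM2l // mulr_ge0 // ltW.
have a2 : (8 * LPhi + 2) * (D / K / th) <= (8 * LPhi + 2) * ((6 * 13 + 2 * r * cx) * Y).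
  by rewrite ler_wpM2l // addr_ge0 // mulr_ge0 // ltW.
have A1 : 0 <= 26 * A / mu by rewrite divr_ge0 ?mulr_ge0 // ltW.
have A2 : 0 <= 52 * Lg ^+ 2 / mu by rewrite divr_ge0 ?mulr_ge0 ?sqr_ge0 // ltW.
have A3 : 0 <= 52 * A / mu by rewrite divr_ge0 ?mulr_ge0 // ltW.
have A4 : 0 <= 78 * Lg ^+ 2 / mu by rewrite divr_ge0 ?mulr_ge0 ?sqr_ge0 // ltW.
have b1 := ler_wpM2l A1 (mono _ _ y0 yD be0).
have b2 := ler_wpM2l A2 (mono _ _ z0 zD ga0).
have b3 := mono _ _ x0 xD th0.
have c1 := ler_wpM2l (addr_ge0 (mulr_ge0 (ler0n R 4) cLy0) A1) hy.
have c2 := ler_wpM2l (addr_ge0 (mulr_ge0 (ler0n R 4) cLz0) A2) hz.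
have d1 := ler_wpM2l A3 hy'.
have d2 := ler_wpM2l A4 hz'.
have -> : rate_const r * Y = 4 * (2 * LPhi * (6 * Y)) + (8 * LPhi + 2) * ((6 * 13 + 2 * r * cx) * Y)
  + (4%:R * cLy + 26 * A / mu) * ((6 * ((mu + Lg) / 2 + 8 * Lg ^+ 2 / mu) + 2 * r * cy) * Y)
  + (4%:R * cLz + 52 * Lg ^+ 2 / mu) * ((6 * (Lg + 36 * Lg ^+ 2 / mu) + 2 * r * cz) * Y)
  + 52 * A / mu * (2 * cy * Y) + 78 * Lg ^+ 2 / mu * (2 * cz * Y) + 2 * (2 * cx * Y).
  by rewrite /rate_const; ring.
move: t1 a1 a2 b1 b2 b3 c1 c2 d1 d2 hx'.
rewrite [(8 * LPhi + 2) * (D / K / th)]mulrDl.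
rewrite [(4%:R * cLy + _) * (D / K / be)]mulrDl [(4%:R * cLz + _) * (D / K / ga)]mulrDl.
set B1 := (8 * LPhi + 2) * _; set B2 := (_ + 26 * A / mu) * _; set B3 := (_ + 52 * Lg ^+ 2 / mu) * _.
set E1 := 52 * A / mu * (2 * cy * Y); set E2 := 78 * Lg ^+ 2 / mu * (2 * cz * Y).
set M1 := 26 * A / mu * (D / K / be); set M2 := 26 * A / mu * (Dy / K / be).
set M3 := 52 * Lg ^+ 2 / mu * (D / K / ga); set M4 := 52 * Lg ^+ 2 / mu * (Dz / K / ga).
set Q1 := 52 * A / mu * (be * _ / _); set Q2 := 78 * Lg ^+ 2 / mu * (ga * _ / _).
set T := th * Vx / n; set U := P / K * al^-1.
have -> : 8 * LPhi * (D / K / th) = 4 * (2 * LPhi * (D / K / th)) by ring.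
have -> : 4%:R * cLy * (D / K / be) = 4 * (cLy * (D / K / be)) by ring.
have -> : 4%:R * cLz * (D / K / ga) = 4 * (cLz * (D / K / ga)) by ring.
set G1 := 2 * LPhi * (D / K); set G2 := 2 * LPhi * (D / K / th).
set G3 := cLy * _; set G4 := cLz * _; set G5 := 2 * LPhi * (6 * Y).
set H1 := D / K / th; set H2 := Dx / K / th; set H3 := 2 * cx * Y.
clearbody B1 B2 B3 E1 E2 M1 M2 M3 M4 Q1 Q2 T U G1 G2 G3 G4 G5 H1 H2 H3.
clear; move=> *; lra.
Qed.

End Rate.

Theorem theoremC4 (R : realType) (mu Cf Lf Lg Lgxy Lgyy LPhi Ly Lz : R) :
  (forall (pb : problem R) (sigma omu oml bf bg : R) (rd : nat)
      (rn : randomness pb rd) (p : params R) (s0 : state pb) (K : nat),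
    let n := (nw pb)%:R in
    let k := K%:R in
    let wu := om_msc omu rd in
    let wl := om_msc oml rd in
    let A := Lcomb mu Lf Lg Lgxy Lgyy (rho p) in
    let sg2 := sigma ^+ 2 / rd%:R in
    let sg21 := sigma ^+ 2 * (1 + rho p ^+ 2) / rd%:R in
    assumptions mu Cf Lf Lg Lgxy Lgyy LPhi Ly Lz sigma omu oml bf bg pb ->
    fresh rn -> (0 < rd)%N -> (0 < K)%N ->
    positive_params p -> norm2 (zs s0) <= rho p ->
    beta p < 2 / (mu + Lg) -> lt_quot (beta p) (mu * n) (8 * wl * Lg ^+ 2) ->
    gamma p <= 1 / Lg -> le_quot (gamma p) (mu * n) (36 * wl * Lg ^+ 2) ->
    theta p <= 1 -> le_quot (theta p) n (12 * wu) ->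
    Cf / mu <= rho p ->
    alpha p <= 1 / (2 * LPhi) ->
    alpha p <= C2 mu Lf Lg Lgxy Lgyy LPhi Ly Lz p ->
    (avg_sqgrad omu oml rn p s0 K <=
      (4 * Phi pb (xs s0) / (k * alpha p)
       + 2 * gapx s0 / (k * theta p)
       + 26 * A * gapy s0 / (mu * k * beta p)
       + 52 * Lg ^+ 2 * gapz s0 / (mu * k * gamma p)
       + 52 * (1 + wl) * A * beta p / (mu * n) * sg2
       + (2 * (1 + wu) * theta p / n
          + 78 * Lg ^+ 2 * (1 + wl) * gamma p / (mu * n)) * sg21
       + (12 * rho p ^+ 2 * wu * theta p / n
          + 104 * A * wl * beta p / (n * mu)
          + 312 * Lg ^+ 2 * rho p ^+ 2 * wl * gamma p / (n * mu)) * bg ^+ 2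
       + (12 * wu * theta p / n
          + 312 * Lg ^+ 2 * wl * gamma p / (n * mu)) * bf ^+ 2)%:E)%E)
  /\
  (* The constant hidden in O depends only on mu_g, on the Lipschitz constants
     and on the ratios of the initial gaps; the hidden logarithm is the one in
     the choice of the number of rounds. *)
  (exists C : R -> R,
   forall (pb : problem R) (sigma omu oml bf bg : R) (rd : nat)
      (rn : randomness pb rd) (p : params R) (s0 : state pb) (K : nat),
    let n := (nw pb)%:R in
    let k := K%:R in
    let wu := om_msc omu rd in
    let wl := om_msc oml rd in
    let sg2 := sigma ^+ 2 / rd%:R in
    let sg21 := sigma ^+ 2 * (1 + rho p ^+ 2) / rd%:R in
    let W := 1 + omu + oml in
    let X := 4 * W + W ^+ 2 * (bf ^+ 2 + bg ^+ 2) ^+ 2 / sigma ^+ 4 in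
    let T := k * rd%:R in
    assumptions mu Cf Lf Lg Lgxy Lgyy LPhi Ly Lz sigma omu oml bf bg pb ->
    fresh rn -> (0 < K)%N ->
    positive_params p -> norm2 (zs s0) <= rho p ->
    0 < sigma -> 0 < gapx s0 -> 0 < gapy s0 -> 0 < gapz s0 ->
    rd%:Z = Num.ceil (4 * W * ln X) ->
    alpha p = (2 * LPhi + (C2 mu Lf Lg Lgxy Lgyy LPhi Ly Lz p)^-1)^-1 ->
    rho p = Cf / mu ->
    beta p =
      ((mu + Lg) / 2 + 8 * wl * Lg ^+ 2 / (mu * n)
       + Num.sqrt (2 * k * ((1 + wl) * sg2 + 2 * wl * bg ^+ 2)
                   / (n * gapy s0)))^-1 ->
    gamma p =
      (Lg + 36 * wl * Lg ^+ 2 / (mu * n)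
       + Num.sqrt (3 * k * ((1 + wl) * sg21 + 4 * wl * bf ^+ 2
                            + 4 * wl * (Cf ^+ 2 / mu ^+ 2) * bg ^+ 2)
                   / (2 * n * gapz s0)))^-1 ->
    theta p =
      (1 + 12 * wu / n
       + Num.sqrt (k * ((1 + wu) * sg21 + 6 * wu * bf ^+ 2
                        + 6 * wu * (Cf ^+ 2 / mu ^+ 2) * bg ^+ 2)
                   / (n * gapx s0)))^-1 ->
    (avg_sqgrad omu oml rn p s0 K <=
      (C (gapmax s0 / Num.min (gapx s0) (Num.min (gapy s0) (gapz s0)))
       * (Num.sqrt (gapmax s0) * sigma / Num.sqrt (n * T)
          + W * gapmax s0 * ln X / T))%:E)%E).

Proof.
split.
  move=> pb sigma omu oml bf bg rd rn p s0 K n k wu wl A sg2 sg21.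
  move=> asm fr rd0 K0 pp zs0 hbe hbw hga hgw hth htw hrho hal hC2.
  exact: (convergence_bound asm fr rd0 pp zs0 hbe hbw hga hgw hth htw hrho hal hC2 K0).
have k12 : 1 <= 2 :> R by rewrite ler1n.
have k24 : 2 <= 4 :> R by rewrite ler_nat.
have k14 : 1 <= 4 :> R by rewrite ler1n.
have k132 : 1 <= 3 / 2 :> R by rewrite ler_pdivlMr // mul1r ler_nat.
have k324 : 3 / 2 <= 4 :> R by rewrite ler_pdivrMr // -natrM ler_nat.
have e13 : 13 = 1 + 12 :> R by ring.
exists (rate_const mu Cf Lf Lg Lgxy Lgyy LPhi Ly Lz).
move=> pb sigma omu oml bf bg rd rn p s0 K n k wu wl sg2 sg21 W X T.
move=> asm fr K0 pp zs0 s_gt0 gx0 gy0 gz0 rdE alE rhoE beE gaE thE.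
have mu0 := mu_gt0 asm; have muL := mu_le_Lg asm; have Lg0 := Lg_gt0 asm.
have [al0 be0 ga0 th0 rho0] := pp.
have [LP0 Ly0 Lz0] : [/\ 0 < LPhi, 0 < Ly & 0 < Lz] by case: asm => _ _ _ _ [[]].
have i0 : 'I_(nw pb) by have [[[h _ _] _ _] _ _ _ _] := asm; exact: (Ordinal h).
have [omu0 oml0] : 0 <= omu /\ 0 <= oml.
  by have [_ _ _ [/(_ i0)[[h1 _ _ _] [h2 _ _ _]]]] := asm.
have n1 : 1 <= n by rewrite /n ler1n; case: asm => [[[]]].
have n0 : 0 < n by apply: lt_le_trans n1.
have k0 : 0 < k by rewrite ltr0n.
have W1 : 1 <= W by rewrite /W; lra.
pose B := bf ^+ 2 + bg ^+ 2.
have bf0 := sqr_ge0 bf; have bg0 := sqr_ge0 bg.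
have B0 : 0 <= B by rewrite addr_ge0.
have [wu1 wuB] : wu <= 1 /\ wu * B <= sg2.
  by apply: (om_msc_small s_gt0 B0 omu0 (W := W) _ erefl rdE); rewrite /W; lra.
have [wl1 wlB] : wl <= 1 /\ wl * B <= sg2.
  by apply: (om_msc_small s_gt0 B0 oml0 (W := W) _ erefl rdE); rewrite /W; lra.
have X4 : 4 <= X.
  have : 0 <= W ^+ 2 * (bf ^+ 2 + bg ^+ 2) ^+ 2 / sigma ^+ 4.
    by apply: divr_ge0; [rewrite -exprMn sqr_ge0|rewrite exprn_ge0 // ltW].
  by rewrite /X; lra.
have [rd0 rdl rdu /andP[lX0 _]] := rounds_bounds W1 X4 rdE.
have rdp : 0 < rd%:R :> R by rewrite ltr0n.
have wu0 : 0 <= wu by exact: om_msc_ge0.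
have wl0 : 0 <= wl by exact: om_msc_ge0.
have sg20 : 0 < sg2 by rewrite divr_gt0 // exprn_gt0.
pose r0 := Cf / mu.
have q0 : 0 <= r0 ^+ 2 by exact: sqr_ge0.
have sg21E : sg21 = sg2 * (1 + r0 ^+ 2) by rewrite /sg21 rhoE /sg2 mulrAC.
have CfE : Cf ^+ 2 / mu ^+ 2 = r0 ^+ 2 by rewrite /r0 expr_div_n.
rewrite CfE in gaE thE.
have wubf : wu * bf ^+ 2 <= sg2.
  by apply: le_trans wuB; rewrite ler_wpM2l // lerDl.
have wubg : wu * bg ^+ 2 <= sg2.
  by apply: le_trans wuB; rewrite ler_wpM2l // lerDr.
have wlbf : wl * bf ^+ 2 <= sg2.
  by apply: le_trans wlB; rewrite ler_wpM2l // lerDl.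
have wlbg : wl * bg ^+ 2 <= sg2.
  by apply: le_trans wlB; rewrite ler_wpM2l // lerDr.
have q1 : 0 < 1 + r0 ^+ 2 by rewrite ltr_wpDr.
have sq1 : 0 < sg2 * (1 + r0 ^+ 2) by rewrite mulr_gt0.
pose Vy := (1 + wl) * sg2 + 2 * wl * bg ^+ 2.
pose Vz := (1 + wl) * sg21 + 4 * wl * bf ^+ 2 + 4 * wl * r0 ^+ 2 * bg ^+ 2.
pose Vx := (1 + wu) * sg21 + 6 * wu * bf ^+ 2 + 6 * wu * r0 ^+ 2 * bg ^+ 2.
have wl01 : 0 <= wl <= 1 by rewrite wl0.
have wu01 : 0 <= wu <= 1 by rewrite wu0.
have [Vy0 Vy4] : 0 < Vy /\ Vy <= 4 * sg2.
  (* The y-direction involves neither [bf] nor [rho]: [bg] takes the slot of [bf], with q = 0. *)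
  have := noise_level wl01 sg20 (lexx 0) (ler0n R 2) bg0 (lexx 0) wlbg.
  rewrite !mulr0 !addr0 !mulr1 => /(_ (ltW sg20)) /andP[V0 V4]; split => //.
  by rewrite (_ : 4 = 2 + 2 :> R) //; ring.
have [Vz0 Vz6] : 0 < Vz /\ Vz <= 6 * (1 + r0 ^+ 2) * sg2.
  have := noise_level wl01 sg20 q0 (ler0n R 4) bf0 bg0 wlbf wlbg; rewrite -sg21E.
  by move=> /andP[V0 V6]; split => //; rewrite (_ : 6 = 2 + 4 :> R) //; ring.
have [Vx0 Vx8] : 0 < Vx /\ Vx <= 8 * (1 + r0 ^+ 2) * sg2.
  have := noise_level wu01 sg20 q0 (ler0n R 6) bf0 bg0 wubf wubg; rewrite -sg21E.
  by move=> /andP[V0 V8]; split => //; rewrite (_ : 8 = 2 + 6 :> R) //; ring.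
pose D := gapmax s0.
have PD : Phi pb (xs s0) <= D by rewrite /D /gapmax le_max lexx.
have xD : gapx s0 <= D by rewrite /D /gapmax !le_max lexx orbT.
have yD : gapy s0 <= D by rewrite /D /gapmax !le_max lexx !orbT.
have zD : gapz s0 <= D by rewrite /D /gapmax !le_max lexx !orbT.
have D0 : 0 < D by apply: lt_le_trans xD.
have P0 : 0 <= Phi pb (xs s0) by case: asm => _ _ _ _ [_]; exact.
set m := Num.min (gapx s0) _.
have m0 : 0 < m by rewrite !lt_min gx0 gy0.
have mx : m <= gapx s0 by rewrite !ge_min lexx.
have my : m <= gapy s0 by rewrite !ge_min lexx !orbT.
have mz : m <= gapz s0 by rewrite !ge_min lexx !orbT.
rewrite -/D.
(* The argument of the hidden constant, gapmax over the smallest gap, compares [D] with each gap to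
   which a step size is tuned. *)
have ratio u : m <= u -> D <= D / m * u.
  by move=> mu'; rewrite mulrAC ler_pdivlMr // ler_pM2l.
set r := D / m in ratio *.
set E := Num.sqrt D * sigma / _; set F := W * D * ln X / T.
have T0 : 0 < T by rewrite mulr_gt0.
have nT : 0 < n * T by rewrite mulr_gt0.
have E0 : 0 <= E by rewrite divr_ge0 ?mulr_ge0 ?sqrtr_ge0 // ltW.
(* Since T = K rd, the factor 1/rd of the averaged variance turns K into T. *)
have E2 : E ^+ 2 = D * sg2 / (n * k).
  rewrite /E expr_div_n exprMn !sqr_sqrtr ?(ltW D0) ?(ltW nT) // /T /sg2.
  by field; rewrite !gt_eqF.
have F0 : 0 <= F by rewrite divr_ge0 ?(ltW T0) // mulr_ge0 // mulr_ge0 ?(ltW D0) // (le_trans ler01).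
(* D/K is rd D/T, and rd <= 6 W ln X: the number of rounds is the source of the logarithm. *)
have DF : D / k <= 6 * F.
  have -> : D / k = D / T * rd%:R by rewrite /T; field; rewrite !gt_eqF.
  have -> : 6 * F = D / T * (6 * (W * ln X)) by rewrite /F; ring.
  by rewrite ler_wpM2l // divr_ge0 // ltW.
have Y0 : 0 <= E + F by rewrite addr_ge0.
set Sy := Num.sqrt _ in beE; set Sz := Num.sqrt _ in gaE; set Sx := Num.sqrt _ in thE.
have Sy0 : 0 < Sy.
  by rewrite sqrtr_gt0; apply: divr_gt0; apply: mulr_gt0 => //; apply: mulr_gt0.
have Sz0 : 0 <= Sz by exact: sqrtr_ge0.
have Sx0 : 0 <= Sx by exact: sqrtr_ge0.
have Sy2 : Sy ^+ 2 = 2 * k * Vy / (n * gapy s0).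
  by rewrite sqr_sqrtr // divr_ge0 // ltW //; apply: mulr_gt0 => //; apply: mulr_gt0.
have Sz2 : Sz ^+ 2 = 3 / 2 * k * Vz / (n * gapz s0).
  rewrite sqr_sqrtr -/Vz; last first.
    by apply: divr_ge0; apply: ltW; apply: mulr_gt0 => //; apply: mulr_gt0.
  by field; rewrite !gt_eqF.
have Sx2 : Sx ^+ 2 = 1 * k * Vx / (n * gapx s0).
  by rewrite mul1r sqr_sqrtr //; apply: divr_ge0; apply: ltW; apply: mulr_gt0.
have Py0 : 0 < (mu + Lg) / 2 by rewrite divr_gt0 // addr_gt0.
have wn v c : 0 <= v <= 1 -> 0 <= c -> 0 <= c * v / n <= c.
  move=> /andP[v0 v1] c0; rewrite divr_ge0 ?mulr_ge0 ?(ltW n0) //= ler_pdivrMr //.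
  by rewrite ler_wpM2l // (le_trans v1).
have Lg20 : 0 <= Lg ^+ 2 / mu by rewrite divr_ge0 ?sqr_ge0 // ltW.
have Qy : 0 <= 8 * wl * Lg ^+ 2 / (mu * n) <= 8 * Lg ^+ 2 / mu.
  have := wn wl (8 * Lg ^+ 2 / mu) wl01; rewrite -mulrA mulr_ge0 // => /(_ isT).
  by rewrite (_ : 8 * (Lg ^+ 2 / mu) * wl / n = 8 * wl * Lg ^+ 2 / (mu * n)) //; field; rewrite !gt_eqF.
have Qz : 0 <= 36 * wl * Lg ^+ 2 / (mu * n) <= 36 * Lg ^+ 2 / mu.
  have := wn wl (36 * Lg ^+ 2 / mu) wl01; rewrite -mulrA mulr_ge0 // => /(_ isT).
  by rewrite (_ : 36 * (Lg ^+ 2 / mu) * wl / n = 36 * wl * Lg ^+ 2 / (mu * n)) //; field; rewrite !gt_eqF.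
have Qx : 0 <= 12 * wu / n <= 12 by apply: wn.
have PQy : 0 <= (mu + Lg) / 2 + 8 * wl * Lg ^+ 2 / (mu * n) <= (mu + Lg) / 2 + 8 * Lg ^+ 2 / mu.
  by move: Qy => /andP[? ?]; rewrite addr_ge0 ?(ltW Py0) //= lerD2l.
have PQz : 0 <= Lg + 36 * wl * Lg ^+ 2 / (mu * n) <= Lg + 36 * Lg ^+ 2 / mu.
  by move: Qz => /andP[? ?]; rewrite addr_ge0 ?(ltW Lg0) //= lerD2l.
have PQx : 0 <= 1 + 12 * wu / n <= 13.
  by move: Qx => /andP[? ?]; rewrite e13 addr_ge0 //= lerD2l.
have q80 : 0 <= 8 * (1 + r0 ^+ 2) by rewrite mulr_ge0 // ltW.
have q60 : 0 <= 6 * (1 + r0 ^+ 2) by rewrite mulr_ge0 // ltW.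
(* [kap] is 2, 3/2 and 1 for beta, gamma and theta. The deterministic parts are bounded
   independently of compression and workers, by om_msc <= 1 and n >= 1. *)
have [hy hy'] := step_rate n0 k0 gy0 yD (ratio _ my) E0 E2 F0 DF Vy0 (ltW sg20) (ler0n _ 4)
  Vy4 k12 k24 PQy Sy2 (ltW Sy0) beE.
have [hz hz'] := step_rate n0 k0 gz0 zD (ratio _ mz) E0 E2 F0 DF Vz0 (ltW sg20) q60
  Vz6 k132 k324 PQz Sz2 Sz0 gaE.
have [hx hx'] := step_rate n0 k0 gx0 xD (ratio _ mx) E0 E2 F0 DF Vx0 (ltW sg20) q80
  Vx8 (lexx 1) k14 PQx Sx2 Sx0 thE.
have mn0 : 0 < mu * n by rewrite mulr_gt0.
(* Strictness comes from [Sy > 0], that is from sigma > 0. *)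
have hbe : beta p < 2 / (mu + Lg).
  rewrite beE -[2 / _]invf_div ltf_pV2 ?posrE //; last first.
    by rewrite ltr_wpDl // (andP PQy).1.
  by rewrite -addrA ltrDl ltr_wpDl // (andP Qy).1.
have hbw : lt_quot (beta p) (mu * n) (8 * wl * Lg ^+ 2).
  have [->|bn] := eqVneq (8 * wl * Lg ^+ 2) 0; [by left|right].
  have bp : 0 < 8 * wl * Lg ^+ 2 by rewrite lt_def bn mulr_ge0 ?sqr_ge0 // mulr_ge0.
  rewrite beE -[mu * n / _]invf_div ltf_pV2 ?posrE ?divr_gt0 //; last first.
    by rewrite ltr_wpDl // (andP PQy).1.
  by rewrite addrAC ltrDr addr_gt0.
have hga : gamma p <= 1 / Lg.
  rewrite gaE div1r lef_pV2 ?posrE //; last by rewrite -addrA ltr_wpDr // addr_ge0 // (andP Qz).1.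
  by rewrite -addrA lerDl addr_ge0 // (andP Qz).1.
have hgw : le_quot (gamma p) (mu * n) (36 * wl * Lg ^+ 2).
  rewrite gaE; apply: inv_le_quot => //; last exact: (andP Qz).1.
  by rewrite mulr_ge0 ?sqr_ge0 // mulr_ge0.
have hth : theta p <= 1.
  rewrite thE invf_le1; last by rewrite -addrA ltr_wpDr // addr_ge0 // (andP Qx).1.
  by rewrite -addrA lerDl addr_ge0 // (andP Qx).1.
have htw : le_quot (theta p) n (12 * wu).
  by rewrite thE; apply: inv_le_quot => //; [rewrite mulr_ge0|exact: (andP Qx).1].
have hrho : Cf / mu <= rho p by rewrite rhoE.
pose A := Lcomb mu Lf Lg Lgxy Lgyy r0.
have A0 : 0 <= A.
  rewrite /A /Lcomb -!exprMn addr_ge0 //; first by rewrite addr_ge0 ?sqr_ge0.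
  by apply: mulr_ge0; [rewrite mulr_ge0 ?sqr_ge0|rewrite addr_ge0 ?sqr_ge0].
pose Q := 2 * (2 * LPhi ^+ 2 / theta p ^+ 2 + 26 * A * Ly ^+ 2 / (beta p ^+ 2 * mu ^+ 2)
  + 78 * Lg ^+ 2 * Lz ^+ 2 / (gamma p ^+ 2 * mu ^+ 2)).
have C2E : C2 mu Lf Lg Lgxy Lgyy LPhi Ly Lz p = (Num.sqrt Q)^-1 by rewrite /C2 rhoE.
have Q0 : 0 < Q.
  rewrite mulr_gt0 // -addrA ltr_wpDr //.
    apply: addr_ge0; rewrite -exprMn divr_ge0 ?sqr_ge0 //.
      by rewrite mulr_ge0 ?sqr_ge0 // mulr_ge0.
    by rewrite -mulrA -exprMn mulr_ge0 ?sqr_ge0.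
  by rewrite divr_gt0 ?exprn_gt0 // mulr_gt0 // exprn_gt0.
have sQ0 : 0 < Num.sqrt Q by rewrite sqrtr_gt0.
have alE' : (alpha p)^-1 = 2 * LPhi + Num.sqrt Q by rewrite alE C2E !invrK.
have LP2 : 0 < 2 * LPhi by rewrite mulr_gt0.
have hal : alpha p <= 1 / (2 * LPhi).
  by rewrite div1r -[alpha p]invrK alE' lef_pV2 ?posrE ?addr_gt0 // lerDl ltW.
have hC2 : alpha p <= C2 mu Lf Lg Lgxy Lgyy LPhi Ly Lz p.
  by rewrite C2E -[alpha p]invrK alE' lef_pV2 ?posrE ?addr_gt0 // lerDr ltW.
apply: le_trans (convergence_bound asm fr rd0 pp zs0 hbe hbw hga hgw hth htw hrho hal hC2 K0) _.
rewrite lee_fin rhoE -/r0 -/A.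
have Dk : D / k <= 6 * (E + F) by apply: le_trans DF _; rewrite ler_wpM2l // lerDr.
have P01 : 0 <= Phi pb (xs s0) <= D by rewrite P0.
have x01 : 0 <= gapx s0 <= D by rewrite xD ltW.
have y01 : 0 <= gapy s0 <= D by rewrite yD ltW.
have z01 : 0 <= gapz s0 <= D by rewrite zD ltW.
apply: (le_trans _ (rate_assembly mu0 Lg0 LP0 Ly0 Lz0 A0 be0 ga0 th0 k0 (ltW D0)
  P01 x01 y01 z01 Dk alE' hx hx' hy hy' hz hz')).
rewrite le_eqVlt; apply/orP; left; apply/eqP; rewrite /Vx /Vy /Vz -/A.
have : n != 0 by rewrite gt_eqF.
have : k != 0 by rewrite gt_eqF.
have : mu != 0 by rewrite gt_eqF.
have : alpha p != 0 by rewrite gt_eqF.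
have : beta p != 0 by rewrite gt_eqF.
have : gamma p != 0 by rewrite gt_eqF.
have : theta p != 0 by rewrite gt_eqF.
rewrite -/wu -/wl -/sg2 -/n -/k.
have -> : sigma ^+ 2 * (1 + r0 ^+ 2) / rd%:R = sg21 by rewrite /sg21 rhoE.
move: (alpha p) (beta p) (gamma p) (theta p) (n) (k) => al be ga th n' k'.
move: (Phi pb (xs s0)) (gapx s0) (gapy s0) (gapz s0) (A) (wu) (wl) (sg2) (sg21) (r0).
move=> vP vx vy vz a u l s1 s2 q h1 h2 h3 h4 h5 h6 h7.
by field; rewrite h1 h2 h3 h4 h5 h6 h7.
Qed.
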